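(* Let $p\in(2,+\infty)$ and $q>p-1$. There exists a constant $\Lambda_{p,q}>0$ such that the following holds. If $q\neq p$, then for every $u\in \mathrm W^{1,p}(\mathbb S^1)$, $$\|u'\|_{\mathrm L^p(\mathbb S^1)}^2\ \ge\ \frac{\Lambda_{p,q}}{p-q}\left(\|u\|_{\mathrm L^p(\mathbb S^1)}^2-\|u\|_{\mathrm L^q(\mathbb S^1)}^2\right).$$ If $q=p$, then for every $u\in \mathrm W^{1,p}(\mathbb S^1)$ with $u\not\equiv0$, $$\|u'\|_{\mathrm L^p(\mathbb S^1)}^2\ \ge\ \frac2p\,\Lambda_{p,p}\,\|u\|_{\mathrm L^p(\mathbb S^1)}^{2-p}\int_{\mathbb S^1}|u|^p\,\log\left(\frac{|u|}{\|u\|_{\mathrm L^p(\mathbb S^1)}}\right)d\sigma.$$ Moreover, the sharp (i.e. largest possible) constant $\Lambda_{p,q}$ in these inequalities satisfies $$\lambda_1\le\Lambda_{p,q}\le\lambda_1^\star.$$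
   Context: $\mathbb S^1$ is the unit circle, identified with $[0,2\pi)$ with periodic boundary conditions, and $d\sigma=\frac{dx}{2\pi}$ is the uniform probability measure on it. Functions are real-valued, $u'$ denotes the derivative in $x$, and $\|u\|_{\mathrm L^r(\mathbb S^1)}:=\left(\int_{\mathbb S^1}|u|^r\,d\sigma\right)^{1/r}$. The convention $0\log 0=0$ is used. Let $\mathcal W_1$ be the set of all $v\in\mathrm W^{1,p}(\mathbb S^1)\setminus\{0\}$ such that $\int_{\mathbb S^1}v\,d\sigma=0$, and define $$\lambda_1^\star:=\inf_{v\in\mathcal W_1}\frac{\|v'\|_{\mathrm L^p(\mathbb S^1)}^2}{\|v\|_{\mathrm L^2(\mathbb S^1)}^2},\qquad \lambda_1:=\inf_{v\in\mathcal W_1}\frac{\|v'\|_{\mathrm L^p(\mathbb S^1)}^2}{\|v\|_{\mathrm L^p(\mathbb S^1)}^2}.$$ *)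

(* Defs.v *)
From HB Require Import structures.
From mathcomp Require Import all_boot all_order all_algebra.
From mathcomp Require Import all_classical all_reals all_analysis.

Set Implicit Arguments.
Unset Strict Implicit.
Unset Printing Implicit Defensive.

Import Order.TTheory GRing.Theory Num.Theory.
Import numFieldNormedType.Exports.

Local Open Scope classical_set_scope.
Local Open Scope ring_scope.

Lemma twopi_gt0 (R : realType) : (0 : R) < pi *+ 2.
Proof. by rewrite mulrn_wgt0// pi_gt0. Qed.

(* dx / 2pi on the circle. It is a measure on the whole line, carried by
   [0, 2pi], so functions on the circle are represented by functions R -> R
   whose values outside [0, 2pi] play no role. *)
Definition dsigma (R : realType) : probability _ R :=
  uniform_prob (twopi_gt0 R).

(* The library's norm is extended-real valued; it is finite on
   W^{1,p}(S^1), which is contained in L^oo. *)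
Definition Lr_norm (R : realType) (r : R) (u : R -> R) : R :=
  fine (Lnorm (dsigma R) r%:E (EFin \o u)).

Definition circle_test_function (R : realType) (phi : R -> R) : Prop :=
  periodic phi (pi *+ 2) /\
  forall (n : nat) (x : R), derivable (derive1n n phi) x 1.

Definition weak_derivative (R : realType) (u du : R -> R) : Prop :=
  forall phi : R -> R, circle_test_function phi ->
    (\int[dsigma R]_x (u x * derive1 phi x) =
     - \int[dsigma R]_x (du x * phi x))%R.

(* u is in W^{1,p}(S^1), and du represents u', which is determined only up to
   a null set. *)
Definition W1p (R : realType) (p : R) (u du : R -> R) : Prop :=
  [/\ u \in Lfun (dsigma R) p%:E, du \in Lfun (dsigma R) p%:E
    & weak_derivative u du].

Definition nonzero (R : realType) (u : R -> R) : Prop :=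
  ~ {ae dsigma R, forall x, u x = 0}.

Definition calW1 (R : realType) (p : R) (v dv : R -> R) : Prop :=
  [/\ W1p p v dv, nonzero v & (\int[dsigma R]_x v x = 0)%R].

Definition rayleigh_inf (R : realType) (p r : R) : R :=
  inf [set t : R | exists v dv : R -> R,
         calW1 p v dv /\ t = Lr_norm p dv ^+ 2 / Lr_norm r v ^+ 2].

Definition lambda1_star (R : realType) (p : R) : R := rayleigh_inf p 2.

Definition lambda1 (R : realType) (p : R) : R := rayleigh_inf p p.

(* The convention 0 log 0 = 0 holds since ln 0 = 0 and 0 `^ p = 0. *)
Definition interpolation_inequality (R : realType) (p q L : R) : Prop :=
  (q != p -> forall u du : R -> R, W1p p u du ->
     Lr_norm p du ^+ 2 >=
       L / (p - q) * (Lr_norm p u ^+ 2 - Lr_norm q u ^+ 2)) /\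
  (q = p -> forall u du : R -> R, W1p p u du -> nonzero u ->
     Lr_norm p du ^+ 2 >=
       2 / p * L * Lr_norm p u `^ (2 - p) *
       (\int[dsigma R]_x (`|u x| `^ p * ln (`|u x| / Lr_norm p u)))%R).

(* Main.v *)
(* The inequality is affine in the constant, so the best constant is the
   supremum of the admissible ones, and it is attained.

   Upper bound: insert [u = 1 + t v] with [v] of mean zero and expand to second
   order as [t] tends to [0].

   Lower bound: let [0 < L < lambda1] and [q <> p], and suppose that the
   deficit is negative somewhere. After a scaling this survives the addition of
   [(int |u|^s)^2 - eps int u], which makes the functional coercive. Instead of
   minimizing in a Sobolev space, one minimizes the finite-difference version of
   the functional on the grid with [n + 1] points. By the Euler-Lagrange
   equations, the minimizers and their discrete fluxes are equi-Lipschitz, and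
   along an ultrafilter they converge to a C^1 solution of
   [u' = |w|^(1/(p-1)) sgn w], [w' = b u^(q-1) - c u^(p-1) - e] with [e > 0];
   the last term forces [u > 0]. Multiplying the equation by [u^(2-p) w'] and
   integrating by parts ([rigidity]) gives
   [int u^(2-p) w'^2 <= c (p - q) int |u'|^p], while the definition of [lambda1]
   and Hoelder's inequality give the opposite strict inequality. The case
   [q = p] follows by letting [q] decrease to [p].

   The weak derivative is turned into a classical primitive by a
   du Bois-Reymond argument: a continuous function orthogonal to all
   trigonometric functions of positive frequency is constant. *)
Require Import Defs.
From mathcomp Require Import all_boot all_order all_algebra.
From mathcomp Require Import all_classical all_reals all_analysis.
From mathcomp Require Import measurable_realfun ring lra.
Set Implicit Arguments.
Unset Strict Implicit.
Unset Printing Implicit Defensive.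
Import Order.TTheory GRing.Theory Num.Theory.
Import numFieldNormedType.Exports.
Local Open Scope classical_set_scope.
Local Open Scope ring_scope.

(** * Odd powers; derivative and convexity of [|y|^p] *)

Section SignedPower.
Variable R : realType.
Implicit Types a p x y d : R.

(** Without its two perturbations the functional is homogeneous of degree 2, so a single negative
    value makes it unbounded below; the added term therefore has a higher degree. It is built on the
    larger exponent [s] of [p] and [q] for the sake of its variation: for [s = q] this only changes
    [b], which the rigidity estimate does not see, and for [s = p] it lowers [c], which is
    favourable as then [p > q]. The linear term is favourable too, because [e] enters the rigidity
    identity through a nonnegative term. The condition [q > p - 1] is the sign of the coefficient
    [q + 1 - p] of the other term dropped there, and positivity of [u] is required by the negative
    powers of [u] in the identity. On the grid, existence of minimizers is finite-dimensional
    compactness, the Euler-Lagrange equations are partial derivatives, and the ultrafilter makes all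
    bounded sequences converge at once. The energy enters these equations with the positive exponent
    [1 - 2/p], so they pass to the limit before the limit energy is known to be positive. *)

Definition spow a y : R := Num.sg y * `|y| `^ a.

Lemma spow0 a : spow a 0 = 0. Proof. by rewrite /spow sgr0 mul0r. Qed.

Lemma gt0_spow a y : 0 < y -> spow a y = y `^ a.
Proof. by move=> y0; rewrite /spow gtr0_sg// mul1r gtr0_norm. Qed.

Lemma lt0_spow a y : y < 0 -> spow a y = - (- y) `^ a.
Proof. by move=> y0; rewrite /spow ltr0_sg// mulN1r ltr0_norm. Qed.

Lemma ge0_spow a y : a != 0 -> 0 <= y -> spow a y = y `^ a.
Proof.
move=> a0; rewrite le_eqVlt => /predU1P[<-|]; first by rewrite spow0 powR0.
exact: gt0_spow.
Qed.

Lemma norm_spow a y : a != 0 -> `|spow a y| = `|y| `^ a.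
Proof.
move=> a0; rewrite /spow normrM normr_sg ger0_norm ?powR_ge0//.
by case: eqVneq => [->|_]; rewrite /= ?mul1r// normr0 powR0// mulr0.
Qed.

Lemma sg_spow a y : Num.sg (spow a y) = Num.sg y.
Proof.
rewrite /spow sgrM sgr_id.
have [->|y0] := eqVneq y 0; first by rewrite sgr0 mul0r.
by rewrite (gtr0_sg (powR_gt0 _ _)) ?normr_gt0// mulr1.
Qed.

Lemma spowM a b y : a != 0 -> spow b (spow a y) = spow (a * b) y.
Proof. by move=> a0; rewrite /spow -/(spow a y) sg_spow norm_spow// powRrM. Qed.

Lemma spow1 y : spow 1 y = y.
Proof. by rewrite /spow powRr1// -numEsg. Qed.

(** For [a = p - 1] this inverts the flux: the slope is recovered from the flux by
    [spow (p - 1)^-1]. *)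
Lemma spowK a : a != 0 -> cancel (spow a) (spow a^-1).
Proof. by move=> a0 y; rewrite spowM// mulfV// spow1. Qed.

Lemma mulr_spow p y : 0 < p -> y * spow (p - 1) y = `|y| `^ p.
Proof.
by move=> p0; rewrite /spow mulrA [y * _]mulrC -normrEsg mulr_powRB1.
Qed.

Lemma normr_continuous_powR a y : 0 < a ->
  {for y, continuous (fun y : R => `|y| `^ a)}.
Proof.
move=> a0; have [->|y0] := eqVneq y 0; last first.
  apply: (@continuous_comp _ _ _ (fun y => `|y|) (fun z => z `^ a)).
    exact: norm_continuous.
  apply/differentiable_continuous/derivable1_diffP.
  by apply: derivable_powR; rewrite in_itv/= andbT normr_gt0.
apply/cvgrPdist_le => e e0.
rewrite normr0 powR0 ?gt_eqF//; near=> z.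
rewrite sub0r normrN ger0_norm ?powR_ge0//.
have -> : e = (e `^ a^-1) `^ a.
  by rewrite -powRrM mulVf ?gt_eqF// powRr1 ?ltW.
apply: ge0_ler_powR; rewrite ?nnegrE ?powR_ge0//; first exact: ltW.
near: z; apply: (@nbhs0_le _ R); exact: powR_gt0.
Unshelve. all: by end_near. Qed.

Lemma near_eq_continuous_at (f g : R -> R) y : (\forall z \near y, f z = g z) ->
  {for y, continuous g} -> {for y, continuous f}.
Proof.
move=> fg; rewrite /prop_for /continuous_at (nbhs_singleton fg).
apply: cvg_trans; apply: near_eq_cvg.
by apply: filterS fg => ? ->.
Qed.

Lemma continuous_spow a y : 0 < a -> {for y, continuous (spow a)}.
Proof.
move=> a0; have [->|y0] := eqVneq y 0.
  have := @normr_continuous_powR a 0 a0.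
  rewrite /prop_for /continuous_at normr0 powR0 ?gt_eqF// spow0 => h.
  apply/norm_cvg0P; apply: cvg_trans h.
  by apply: near_eq_cvg; apply: nearW => z; rewrite norm_spow ?gt_eqF.
have [y1|y1] := ltrP 0 y.
  apply: (@near_eq_continuous_at _ (fun y => `|y| `^ a)).
    near=> z; have z0 : 0 < z by near: z; exact: lt_nbhsr.
    by rewrite gt0_spow ?gtr0_norm.
  exact: normr_continuous_powR.
have {y1}y1 : y < 0 by rewrite lt_neqAle y0.
apply: (@near_eq_continuous_at _ (fun y => - `|y| `^ a)).
  near=> z; have z0 : z < 0 by near: z; exact: lt_nbhsl.
  by rewrite lt0_spow ?ltr0_norm.
by apply: cvgN; exact: normr_continuous_powR.
Unshelve. all: by end_near. Qed.

Lemma is_derive_near y (f g : R -> R) l : (\forall z \near y, f z = g z) ->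
  is_derive y 1 f l -> is_derive y 1 g l.
Proof.
move=> fg [df <-]; split; first exact: near_eq_derivable df.
by apply/esym; apply: near_eq_derive.
Qed.

(** The difference quotient of [f] at the origin is [g] itself. Away from the origin each sign
    reduces to [powR], and this joins the two sides. *)
Lemma is_derive_at0 (f g : R -> R) : f 0 = 0 -> {for 0, continuous g} ->
  g 0 = 0 -> (forall h, f h = h * g h) -> is_derive (0 : R) 1 f 0.
Proof.
move=> f0 cg g0 fg.
have h : h^-1 *: (f (h *: (1 : R) + 0) - f 0) @[h --> 0^'] --> (0 : R).
  have : g x @[x --> 0^'] --> (0 : R).
    by apply: cvg_within_filter; move: cg; rewrite /prop_for /continuous_at g0.
  apply: cvg_trans; apply: near_eq_cvg; near=> h.
  rewrite f0 subr0 addr0 scaler1 fg /GRing.scale/= mulrA mulVf ?mul1r//.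
  by near: h; exact: nbhs_dnbhs_neq.
split; last by apply: cvg_lim => //.
by apply/cvg_ex; exists 0.
Unshelve. all: by end_near. Qed.

Lemma is_derive_normr_powR p y : 1 < p ->
  is_derive y 1 (fun z => `|z| `^ p) (p * spow (p - 1) y).
Proof.
move=> p1; have [y0|y0|->] := ltgtP y 0.
- rewrite lt0_spow//.
  apply: (@is_derive_near _ (fun z => (- z) `^ p)).
    near=> z; have z0 : z < 0 by near: z; exact: lt_nbhsl.
    by rewrite ltr0_norm.
  have Hy : 0 < - y by lra.
  have D : is_derive (- y) 1 (fun z : R => z `^ p) (p * (- y) `^ (p - 1)).
    exact: (is_derive1_powR _ _).
  have -> : p * - (- y) `^ (p - 1) = (p * (- y) `^ (p - 1)) *: (-1).
    by rewrite /GRing.scale/= mulrN1 mulrN.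
  exact: (@is_derive1_comp _ (fun z : R => z `^ p) (-%R)).
- rewrite gt0_spow//.
  apply: (@is_derive_near _ (fun z => z `^ p)).
    near=> z; have z0 : 0 < z by near: z; exact: lt_nbhsr.
    by rewrite gtr0_norm.
  exact: (is_derive1_powR _ _).
- rewrite spow0 mulr0.
  apply: (@is_derive_at0 _ (spow (p - 1))).
  + by rewrite normr0 powR0// gt_eqF//; lra.
  + by apply: continuous_spow; lra.
  + by rewrite spow0.
  + by move=> h; rewrite mulr_spow//; lra.
Unshelve. all: by end_near. Qed.

Lemma is_derive_spow a y : 1 < a ->
  is_derive y 1 (spow a) (a * `|y| `^ (a - 1)).
Proof.
move=> p1; have [y0|y0|->] := ltgtP y 0.
- rewrite ltr0_norm//.
  apply: (@is_derive_near _ (fun z => - (- z) `^ a)).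
    near=> z; have z0 : z < 0 by near: z; exact: lt_nbhsl.
    by rewrite lt0_spow.
  have Hy : 0 < - y by lra.
  have D : is_derive (- y) 1 (fun z : R => z `^ a) (a * (- y) `^ (a - 1)).
    exact: (is_derive1_powR _ _).
  have -> : a * (- y) `^ (a - 1) = - ((a * (- y) `^ (a - 1)) *: (-1)).
    by rewrite /GRing.scale/= mulrN1 opprK.
  apply: is_deriveN.
  exact: (@is_derive1_comp _ (fun z : R => z `^ a) (-%R)).
- rewrite gtr0_norm//.
  apply: (@is_derive_near _ (fun z => z `^ a)).
    near=> z; have z0 : 0 < z by near: z; exact: lt_nbhsr.
    by rewrite gt0_spow.
  exact: (is_derive1_powR _ _).
- rewrite normr0 powR0 ?mulr0; last by rewrite gt_eqF//; lra.
  apply: (@is_derive_at0 _ (fun h => `|h| `^ (a - 1))).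
  + by rewrite spow0.
  + by apply: normr_continuous_powR; lra.
  + by rewrite normr0 powR0// gt_eqF//; lra.
  + move=> h; rewrite /spow -[in LHS](@mulr_powRB1 _ `|h| a) ?normr_ge0//; last lra.
    by rewrite mulrA -numEsg.
Unshelve. all: by end_near. Qed.

(** Convexity of [|y|^p] in supporting-line form, from Young's inequality for [p] and [p / (p - 1)].
    It is the source of the Jensen inequalities on the grid, on the circle and on a single cell. *)
Lemma powR_tangent p d y : 1 < p ->
  `|d| `^ p + p * spow (p - 1) d * (y - d) <= `|y| `^ p.
Proof.
move=> p1.
have h1 : spow (p - 1) d * d = `|d| `^ p by rewrite mulrC mulr_spow//; lra.
have h2 : spow (p - 1) d * y <= `|y| `^ p / p + `|d| `^ p / (p / (p - 1)).
  apply: (@le_trans _ _ (`|y| * `|d| `^ (p - 1))).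
    rewrite mulrC (le_trans (ler_norm _))// normrM norm_spow//.
    by rewrite gt_eqF//; lra.
  apply: le_trans (@conjugate_powR _ `|y| (`|d| `^ (p - 1)) p (p / (p - 1)) _ _ _ _ _) _.
  - by [].
  - exact: powR_ge0.
  - lra.
  - by rewrite divr_gt0//; lra.
  - by field; lra.
  - rewrite -powRrM; have -> : (p - 1) * (p / (p - 1)) = p by field; lra.
    by [].
have h3 : p * (spow (p - 1) d * y) <= `|y| `^ p + (p - 1) * `|d| `^ p.
  have -> : `|y| `^ p + (p - 1) * `|d| `^ p = p * (`|y| `^ p / p + `|d| `^ p / (p / (p - 1))).
    by field; lra.
  by rewrite ler_pM2l//; lra.
have -> : p * spow (p - 1) d * (y - d) = p * (spow (p - 1) d * y) - p * `|d| `^ p.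
  by rewrite -h1; ring.
lra.
Qed.

Lemma is_derive_powR_comp (G : R -> R) (x l b : R) : 0 < G x -> is_derive x 1 G l ->
  is_derive x 1 (fun t => (G t) `^ b) (b * (G x) `^ (b - 1) * l).
Proof.
move=> G0 dG; apply: (@is_derive1_comp _ (fun z => z `^ b) G) => //.
exact: (is_derive1_powR _ _).
Qed.

End SignedPower.

(** * The normalized integral over the circle *)

Section CircleIntegral.
Variable R : realType.
Local Notation tp := (pi *+ 2 : R).
Local Notation sg := (dsigma R).
Local Notation mu := (@lebesgue_measure R).
Implicit Types f g : R -> R.

Definition integ f := sg.-integrable setT (EFin \o f).
Definition mean f : R := (\int[sg]_x f x)%R.

Lemma ae_imp (P Q : R -> Prop) : (forall x, P x -> Q x) ->
  {ae sg, forall x, P x} -> {ae sg, forall x, Q x}.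
Proof. by move=> PQ; apply: (@filterS _ _ (ae_filter_ringOfSetsType sg)). Qed.

Lemma ae_imp2 (P Q S : R -> Prop) : (forall x, P x -> Q x -> S x) ->
  {ae sg, forall x, P x} -> {ae sg, forall x, Q x} -> {ae sg, forall x, S x}.
Proof. by move=> PQS; apply: (@filterS2 _ _ (ae_filter_ringOfSetsType sg)). Qed.

Lemma ae_circle : {ae sg, forall x, x \in `[0, tp]}.
Proof.
exists (~` [set` `[0, tp]]); split.
- exact: measurableC.
- rewrite /dsigma/= /uniform_prob integral_uniform_pdf setICl integral_set0//.
- by move=> x /=.
Qed.

Lemma ae_dsigma (P : R -> Prop) : {ae mu, forall x, P x} -> {ae sg, forall x, P x}.
Proof.
move=> [A [mA A0 PA]]; exists A; split => //.
by have /null_content_dominatesP := dominates_uniform_prob (twopi_gt0 R); apply.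
Qed.

Lemma integral_dsigma (f : _ -> \bar R) : measurable_fun setT f -> (forall x, 0 <= f x)%E ->
  (\int[sg]_x f x = (tp^-1)%:E * \int[mu]_(x in `[0%R, tp]) f x)%E.
Proof.
by move=> mf f0; rewrite (integral_uniform (twopi_gt0 R)) ?subr0.
Qed.

Lemma integ_meas f : integ f -> measurable_fun setT f.
Proof. by case/integrableP => /measurable_EFinP. Qed.

Lemma integP f : measurable_fun setT f ->
  integ f <-> mu.-integrable `[0%R, tp] (EFin \o f).
Proof.
move=> mf.
have tpi : (0 < (tp^-1)%:E)%E by rewrite lte_fin invr_gt0 twopi_gt0.
have mf' : measurable_fun setT (fun x => `|(EFin \o f) x|%E).
  by apply: measurableT_comp => //; exact/measurable_EFinP.
split=> /integrableP[_ h]; apply/integrableP; split.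
- by apply/measurable_EFinP; exact: measurable_funS mf.
- move: h; rewrite integral_dsigma//.
  by rewrite -lte_pdivlMl ?invr_gt0 ?twopi_gt0// invrK mulry gtr0_sg ?twopi_gt0// mul1e.
- exact/measurable_EFinP.
- rewrite integral_dsigma//.
  by rewrite -lte_pdivlMl ?invr_gt0 ?twopi_gt0// invrK mulry gtr0_sg ?twopi_gt0// mul1e.
Qed.

Lemma mean_leb f : integ f -> mean f = tp^-1 * \int[mu]_(x in `[0, tp]) f x.
Proof.
move=> intf; have mf := integ_meas intf.
have mf' := (measurable_EFinP _ _).2 mf.
have intf' := (integP mf).1 intf.
rewrite /mean /Rintegral integralE [in RHS]integralE.
rewrite !integral_dsigma//; [|exact: measurable_funeneg|exact: measurable_funepos].
have mi : (R.-ocitv.-measurable).-sigma.-measurable `[0%R, tp]%classic by exact: measurable_itv.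
have p1 := integrable_pos_fin_num mi intf'.
have n1 := integrable_neg_fin_num mi intf'.
by rewrite -muleBr// ?fin_num_adde_defr// fineM// fin_numB p1.
Qed.

Lemma integD f g : integ f -> integ g -> integ (fun x => f x + g x).
Proof. by move=> h1 h2; have := integrableD measurableT h1 h2. Qed.
Lemma integB f g : integ f -> integ g -> integ (fun x => f x - g x).
Proof. by move=> h1 h2; have := integrableB measurableT h1 h2. Qed.
Lemma integZ c f : integ f -> integ (fun x => c * f x).
Proof. by move=> h1; have := integrableZl measurableT c h1. Qed.
Lemma integ_cst c : integ (fun=> c).
Proof. by have := @finite_measure_integrable_cst _ _ _ sg setT c measurableT. Qed.
Lemma integ_le f g : measurable_fun setT f -> (forall x, `|f x| <= g x) -> integ g -> integ f.
Proof.
move=> mf fg; apply: le_integrable => //; first exact/measurable_EFinP.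
by move=> x _ /=; rewrite lee_fin (le_trans (fg x))// ler_norm.
Qed.
Lemma integ_norm f : integ f -> integ (fun x => `|f x|).
Proof. exact: integrable_norm. Qed.

Lemma meanD f g : integ f -> integ g -> mean (fun x => f x + g x) = mean f + mean g.
Proof. by move=> h1 h2; exact: RintegralD. Qed.
Lemma meanB f g : integ f -> integ g -> mean (fun x => f x - g x) = mean f - mean g.
Proof. by move=> h1 h2; exact: RintegralB. Qed.
Lemma meanZ c f : integ f -> mean (fun x => c * f x) = c * mean f.
Proof. by move=> h1; exact: RintegralZl. Qed.
Lemma mean_cst c : mean (fun=> c) = c.
Proof. by rewrite /mean Rintegral_cst// -[RHS]mulr1; congr (_ * _); rewrite [X in fine X](@probability_setT _ _ _ sg). Qed.
Lemma mean_ge0 f : (forall x, 0 <= f x) -> 0 <= mean f.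
Proof. by move=> f0; apply: Rintegral_ge0. Qed.

Lemma integ_ae f g : measurable_fun setT g -> {ae sg, forall x, f x = g x} -> integ f -> integ g.
Proof.
move=> mg fg intf; have mf := integ_meas intf.
apply/integrableP; split; first exact/measurable_EFinP.
case/integrableP: intf => _; rewrite (@ae_eq_integral _ _ _ sg setT (fun x => `|(EFin \o g) x|%E))//.
- by apply: measurableT_comp => //; exact/measurable_EFinP.
- by apply: measurableT_comp => //; exact/measurable_EFinP.
- by apply: ae_imp fg => x /= ->.
Qed.

Lemma mean_ae f g : measurable_fun setT f -> measurable_fun setT g ->
  {ae sg, forall x, f x = g x} -> mean f = mean g.
Proof.
move=> mf mg fg; congr fine; apply: ae_eq_integral => //.
- exact/measurable_EFinP.
- exact/measurable_EFinP.
- by apply: ae_imp fg => x /= ->.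
Qed.

(** Replacing [g] by [max f g] turns the almost everywhere inequality into a pointwise one without
    changing the integral. *)
Lemma mean_le f g : integ f -> integ g -> {ae sg, forall x, f x <= g x} -> mean f <= mean g.
Proof.
move=> intf intg fg; have mf := integ_meas intf; have mg := integ_meas intg.
have mm : measurable_fun setT (fun x => Num.max (f x) (g x)) by exact: measurable_maxr.
have e : {ae sg, forall x, g x = Num.max (f x) (g x)}.
  by apply: ae_imp fg => x /max_idPr ->.
rewrite (mean_ae mg mm e); apply: le_Rintegral => //.
  exact: integ_ae intg.
by move=> x _; rewrite le_max lexx.
Qed.

Lemma mean_eq0_ae f : integ f -> (forall x, 0 <= f x) -> mean f = 0 ->
  {ae sg, forall x, f x = 0}.
Proof.
move=> intf f0 m0; have mf := integ_meas intf.
have : (\int[sg]_x `|(f x)%:E| = 0)%E.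
  under eq_integral do rewrite gee0_abs ?lee_fin//.
  rewrite -[LHS]fineK ?[fine _]m0//; exact: integrable_fin_num.
move/(ae_eq_integral_abs sg measurableT ((measurable_EFinP _ _).2 mf)).
by apply: ae_imp => x /(_ Logic.I)[].
Qed.

Lemma mean_norm f : integ f -> `|mean f| <= mean (fun x => `|f x|).
Proof. by move=> h; apply: le_normr_Rintegral. Qed.

Lemma eq_mean f g : (forall x, f x = g x) -> mean f = mean g.
Proof. by move=> /funext ->. Qed.

Lemma continuous_meas f : continuous f -> measurable_fun setT f.
Proof. exact: continuous_measurable_fun. Qed.

(** The truncation of [|f|] at [|M|] is integrable and agrees with [|f|] almost everywhere. *)
Lemma integ_bounded f M : measurable_fun setT f ->
  {ae sg, forall x, `|f x| <= M} -> integ f.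
Proof.
move=> mf fM.
have mh : measurable_fun setT (fun x => Num.min `|f x| `|M|).
  by apply: measurable_minr => //; exact: measurableT_comp.
have : integ (fun x => Num.min `|f x| `|M|).
  apply: (@integ_le _ (fun=> `|M|) mh _ (integ_cst _)) => x.
  by rewrite ger0_norm ?ge_min ?lexx ?orbT// le_min !normr_ge0.
move=> /integ_ae h.
have : integ (fun x => `|f x|).
  apply: h; first exact: measurableT_comp.
  apply: ae_imp fM => x fxM; apply/min_idPl.
  by rewrite (le_trans fxM)// ler_norm.
by apply: integ_le.
Qed.

Lemma integ_continuous f : continuous f -> integ f.
Proof.
move=> cf; apply/integP; first exact: continuous_meas.
apply: continuous_compact_integrable; first exact: segment_compact.
exact: continuous_subspaceT.
Qed.

Lemma integMb f g M : integ f -> measurable_fun setT g -> (forall x, `|g x| <= M) ->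
  integ (fun x => f x * g x).
Proof.
move=> intf mg gM.
apply: (@integ_le _ (fun x => M * `|f x|)).
- by apply: measurable_funM => //; exact: integ_meas.
- by move=> x; rewrite normrM mulrC ler_wpM2r.
- exact/integZ/integ_norm.
Qed.

Lemma is_derive_FTC2 (F f : R -> R) a b : a < b -> {within `[a, b], continuous f} ->
  (forall x, x \in `[a, b] -> is_derive x 1 F (f x)) ->
  \int[mu]_(x in `[a, b]) f x = F b - F a.
Proof.
move=> ab cf dF; rewrite /Rintegral (@continuous_FTC2 _ f F)//.
- have dc x : x \in `[a, b] -> {for x, continuous F}.
    move=> xab; have [h _] := dF x xab.
    exact/differentiable_continuous/derivable1_diffP.
  split.
  + by move=> x xab; have [] := dF x (subset_itv_oo_cc xab).
  + by apply: cvg_at_right_filter; apply: dc; rewrite in_itv/= lexx ltW.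
  + by apply: cvg_at_left_filter; apply: dc; rewrite in_itv/= lexx ltW.
- move=> x xab; rewrite derive1E.
  by have [_ ->] := dF x (subset_itv_oo_cc xab).
Qed.

Lemma mean_FTC2 (F f : R -> R) : continuous f ->
  (forall x, x \in `[0, tp] -> is_derive x 1 F (f x)) ->
  mean f = tp^-1 * (F tp - F 0).
Proof.
move=> cf dF; rewrite mean_leb; last exact: integ_continuous.
rewrite (@is_derive_FTC2 F f)//; first exact: twopi_gt0.
exact: continuous_subspaceT.
Qed.

Lemma Lr_normE r f : Lr_norm r f = (mean (fun x => `|f x| `^ r)) `^ r^-1.
Proof. by rewrite /Lr_norm unlock fine_poweR. Qed.

Lemma Lr_norm_ge0 r f : 0 <= Lr_norm r f.
Proof. by rewrite Lr_normE powR_ge0. Qed.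

Lemma Lr_norm_pow r f : r != 0 -> Lr_norm r f `^ r = mean (fun x => `|f x| `^ r).
Proof.
move=> r0; rewrite Lr_normE -powRrM mulVf// powRr1//.
by apply: mean_ge0 => x; exact: powR_ge0.
Qed.

Lemma Lr_norm_sqr r f : Lr_norm r f ^+ 2 = (mean (fun x => `|f x| `^ r)) `^ (2 / r).
Proof.
rewrite Lr_normE -powR_mulrn ?powR_ge0// -powRrM; congr (_ `^ _); exact: mulrC.
Qed.

Lemma meas_normr_powR r f : measurable_fun setT f ->
  measurable_fun setT (fun x => `|f x| `^ r).
Proof.
move=> mf; apply: (measurableT_comp (measurable_powR r)) => //.
exact: measurableT_comp.
Qed.

Lemma LfunP r f : 1 <= r -> f \in Lfun sg r%:E <->
  measurable_fun setT f /\ integ (fun x => `|f x| `^ r).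
Proof.
move=> r1; have r0 : 0 < r by rewrite (lt_le_trans _ r1).
split.
  move=> /[dup] /Lfun_integrable => /(_ r1) h.
  by rewrite inE => /andP[/[!inE]/= mf _].
move=> [mf /integrableP[_ h]]; rewrite inE/=; apply/andP; split; rewrite inE//=.
rewrite /finite_norm unlock poweR_lty//.
apply: le_lt_trans h; rewrite le_eqVlt; apply/orP; left; apply/eqP.
by apply: eq_integral => x _; rewrite /= [in RHS](@ger0_norm _ (`|f x| `^ r)) ?powR_ge0.
Qed.

Lemma integ_Lfun r f : 1 <= r -> f \in Lfun sg r%:E -> integ f.
Proof.
move=> r1 /(LfunP _ r1)[mf h].
apply: (@integ_le _ (fun x => 1 + `|f x| `^ r)) => //.
  move=> x; have [h1|h1] := lerP `|f x| 1.
    by rewrite (le_trans h1)// lerDl powR_ge0.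
  by rewrite ler_wpDl// le1r_powR// ltW.
exact/integD/h/integ_cst.
Qed.

End CircleIntegral.

(** A cluster point in the compact interval is a limit, because an ultrafilter contains each set or
    its complement. This stands in for the extraction of subsequences. *)
Lemma ultra_bounded_cvg (R : realType) (U : set_system nat) (UF : UltraFilter U)
    (f : nat -> R) C : (\forall n \near U, `|f n| <= C) -> cvg (f n @[n --> U]).
Proof.
move=> fC.
have K : compact (`[- C, C]%classic : set R) by exact: segment_compact.
have FK : (f @ U) `[- C, C]%classic.
  by apply: filterS fC => n /=; rewrite in_itv/= ler_norml.
have [l [_ cl]] := K (f @ U) _ FK.
apply/cvg_ex; exists l => A Al.
have [//|/= UnA] := @in_ultra_setVsetC _ U (f @^-1` A) UF.
by have [z []] := cl (~` A) A UnA Al.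
Qed.

Lemma near_dist (R : realType) (t d : R) : 0 < d -> \forall s \near t, `|s - t| < d.
Proof. by move=> d0; exists d => //= s; rewrite distrC. Qed.

(** * Limits of grid functions along an ultrafilter *)

Section Grid.
Context {R : realType} {U : set_system nat} {UF : UltraFilter U}.
Hypothesis Uoo : \oo `<=` U.
Local Notation tp := (pi *+ 2 : R).
Implicit Types (Y Z : nat -> nat -> R) (t : R).

Definition step n : R := tp / n.+1%:R.
(* Starting at -2 pi puts the period [0, 2 pi] in the interior of the region
   where limits of grid functions are taken. *)
Definition grid n k : R := k%:R * step n - tp.
Definition grid_idx t n := Num.Def.trunc ((t + tp) / step n).

Lemma step_gt0 n : 0 < step n. Proof. by rewrite divr_gt0// twopi_gt0. Qed.

Lemma gridS n k : grid n k.+1 = grid n k + step n.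
Proof. by rewrite /grid -natr1; ring. Qed.

Lemma gridB n j k : grid n k - grid n j = (k%:R - j%:R) * step n.
Proof. by rewrite /grid; ring. Qed.

Lemma grid_le n j k : (j <= k)%N -> grid n j <= grid n k.
Proof.
by move=> jk; rewrite -subr_ge0 gridB mulr_ge0 ?(ltW (step_gt0 _))// subr_ge0 ler_nat.
Qed.

(** [trunc] is 0 on negative numbers, so the index follows [t] only to the right of [- tp]. *)
Lemma grid_idxP t n : - tp <= t ->
  grid n (grid_idx t n) <= t < grid n (grid_idx t n) + step n.
Proof.
move=> tt; have h0 := step_gt0 n.
have : 0 <= (t + tp) / step n by rewrite divr_ge0 ?(ltW h0)//; lra.
move=> /truncn_itv /andP[a b].
rewrite -gridS /grid; apply/andP; split.
  by rewrite lerBlDr -ler_pdivlMr.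
by rewrite ltrBrDr -ltr_pdivrMr.
Qed.

(** One full period of nodes lies to the left of 0, so 0 is itself a node and the indices of the
    period start at [n.+1]. *)
Lemma grid_idx_0 n : grid_idx 0 n = n.+1.
Proof.
have tp0 := twopi_gt0 R.
apply: truncn_def; rewrite add0r /step invfM invrK mulrA mulfV ?gt_eqF// mul1r.
by rewrite lexx/= ltr_nat.
Qed.

Lemma grid_idx_tp n : grid_idx tp n = (n.+1 + n.+1)%N.
Proof.
have tp0 := twopi_gt0 R.
apply: truncn_def; rewrite /step invfM invrK mulrA mulrDl mulfV ?gt_eqF// mulrDl mul1r.
by rewrite -natrD lexx/= ltr_nat.
Qed.

Lemma step_cvg : step n @[n --> U] --> (0 : R).
Proof.
apply: (@cvg_trans _ (step n @[n --> \oo])).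
  by move=> A; exact: Uoo.
rewrite -(mulr0 tp); apply: cvgM; first exact: cvg_cst.
exact: cvg_harmonic.
Qed.

Lemma step_lt e : 0 < e -> \forall n \near U, step n < e.
Proof.
move=> e0; have := cvgr_lt 0 step_cvg e e0.
exact.
Qed.

(* Convergence along this filter is continuous convergence: [Y n k] is close to
   the limit as soon as [grid n k] is close to [t]. *)
Definition gridF t : set_system (nat * nat) :=
  [set A | exists2 d : R, 0 < d &
    \forall n \near U, forall k, `|grid n k - t| < d -> A (n, k)].

Global Instance gridF_filter t : Filter (gridF t).
Proof.
split.
- by exists 1 => //; apply: nearW.
- move=> A B [d d0 dA] [d' d'0 dB]; exists (Num.min d d').
    by rewrite lt_min d0.
  apply: filterS2 dA dB => n hA hB k; rewrite lt_min => /andP[h1 h2].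
  by split; [exact: hA|exact: hB].
- move=> A B AB [d d0 dA]; exists d => //.
  by apply: filterS dA => n hA k /hA /AB.
Qed.

Lemma cvg_grid_idx t : - tp <= t -> (n, grid_idx t n) @[n --> U] --> gridF t.
Proof.
move=> tt A [d d0 dA]; rewrite /nbhs/=.
apply: filterS2 dA (step_lt d0) => n hA hn; apply: hA.
by have /andP[a b] := grid_idxP n tt; rewrite ltr_norml; apply/andP; split; lra.
Qed.

Definition gridcvg Y t y := Y nk.1 nk.2 @[nk --> gridF t] --> (y : R).

Lemma gridcvgP Y t y : gridcvg Y t y <-> forall e : R, 0 < e -> exists2 d : R, 0 < d &
    \forall n \near U, forall k, `|grid n k - t| < d -> `|Y n k - y| < e.
Proof. exact: cvgrPdistC_lt. Qed.

Lemma gridcvg_idx Y t y : - tp <= t -> gridcvg Y t y ->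
  Y n (grid_idx t n) @[n --> U] --> y.
Proof. by move=> tt h; exact: cvg_comp (cvg_grid_idx tt) h. Qed.

Lemma grid_cvg t : gridcvg grid t t.
Proof. by apply/gridcvgP => e e0; exists e => //; apply: nearW. Qed.

(** The Euler-Lagrange equation for the flux at [k] involves the value at the next node, and one
    step is invisible in the limit. *)
Lemma gridcvg_shift Y t y : gridcvg Y t y -> gridcvg (fun n k => Y n k.+1) t y.
Proof.
move=> /gridcvgP h; apply/gridcvgP => e /h[d d0 dA].
have d20 : 0 < d / 2 by rewrite divr_gt0.
exists (d / 2) => //.
apply: filterS2 dA (step_lt d20) => n hA hn k hk; apply: hA; rewrite gridS.
have := step_gt0 n; move: hk; rewrite !ltr_norml => /andP[h1 h2] h3.
by apply/andP; split; lra.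
Qed.

Lemma lipschitz_grid_le Y C n j k : (j <= k)%N ->
  (forall i, (j <= i < k)%N -> `|Y n i.+1 - Y n i| <= C * step n) ->
  `|Y n k - Y n j| <= C * `|grid n k - grid n j|.
Proof.
move=> jk hY; rewrite [X in _ * X]ger0_norm ?subr_ge0 ?grid_le//.
rewrite -(telescope_sumr (Y n) jk) -(telescope_sumr (grid n) jk).
rewrite (le_trans (ler_norm_sum _ _ _))// mulr_sumr.
apply: ler_sum_nat => i ijk; rewrite gridS (le_trans (hY _ ijk))//.
by have -> : grid n i + step n - grid n i = step n by ring.
Qed.

Lemma lipschitz_grid Y C n : (forall k, `|Y n k.+1 - Y n k| <= C * step n) ->
  forall j k, `|Y n k - Y n j| <= C * `|grid n k - grid n j|.
Proof.
move=> hY j k; have [jk|/ltnW jk] := leqP j k; first exact: lipschitz_grid_le.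
by rewrite distrC [X in _ <= _ * X]distrC; exact: lipschitz_grid_le.
Qed.

Definition grid_lim Y t : R := lim (Y n (grid_idx t n) @[n --> U]).

Section Lipschitz.
Variables (Y : nat -> nat -> R) (C : R).
Hypothesis Y0 : \forall n \near U, `|Y n 0| <= C.
Hypothesis Y1 : \forall n \near U, forall k, `|Y n k.+1 - Y n k| <= C * step n.

Let C0 : 0 <= C.
Proof.
have [n h] := filter_ex Y0; exact: le_trans h.
Qed.

Lemma grid_lim_is_cvg t : cvg (Y n (grid_idx t n) @[n --> U]).
Proof.
apply: (@ultra_bounded_cvg _ _ _ _ (C + C * (`|t| + tp))).
apply: filterS2 Y0 Y1 => n h0 h1.
have := lipschitz_grid h1 0 (grid_idx t n).
set y := Y n _; set g := `|grid n _ - _| => h2.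
have h3 : `|y| <= `|Y n 0| + C * g.
  by have := ler_normD (y - Y n 0) (Y n 0); rewrite subrK; lra.
have tp0 : 0 < tp := twopi_gt0 R.
have h4 : g <= `|t| + tp.
  have [tt|tt] := leP (- tp) t.
    have /andP[a _] := grid_idxP n tt.
    rewrite /g ger0_norm ?subr_ge0 ?grid_le//.
    have : grid n 0 = - tp by rewrite /grid mul0r sub0r.
    by have := ler_norm t; lra.
  (* To the left of the first node the truncated quotient is negative, so the index is 0. *)
  rewrite /g (_ : grid_idx t n = 0%N) ?subrr ?normr0; last first.
    apply/truncn0Pn; apply/negP => h.
    have : 0 <= (t + tp) / step n by apply: le_trans h.
    by rewrite pmulr_lge0 ?invr_gt0 ?step_gt0//; lra.
  by have := normr_ge0 t; lra.
by have := ler_wpM2l C0 h4; lra.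
Qed.

Lemma grid_limP t : - tp <= t -> gridcvg Y t (grid_lim Y t).
Proof.
move=> tt; apply/gridcvgP => e e0; have C1 : 0 <= C := C0.
(* Node [k] and the node of index [grid_idx t n] will be at most twice this radius apart, which
   costs at most [e / 2]; [C + 1] avoids dividing by zero. *)
have d0 : 0 < e / 2 / (2 * (C + 1)) by apply: divr_gt0; [lra|apply: mulr_gt0; lra].
exists (e / 2 / (2 * (C + 1))) => //.
have e2 : 0 < e / 2 by rewrite divr_gt0.
have hc : Y n (grid_idx t n) @[n --> U] --> grid_lim Y t by exact: grid_lim_is_cvg.
have h1 : \forall n \near U, `|Y n (grid_idx t n) - grid_lim Y t| < e / 2.
  by move/cvgrPdistC_lt : hc; apply.
apply: filterS3 Y1 (step_lt d0) h1 => n h2 h3 h1 k hk.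
have := lipschitz_grid h2 (grid_idx t n) k => h4.
have /andP[a b] := grid_idxP n tt.
set d := _ / _ in d0 hk h3.
have h5 : `|grid n k - grid n (grid_idx t n)| <= 2 * d.
  move: hk; rewrite ltr_norml ler_norml => /andP[c c']; apply/andP; split; lra.
have h6 : C * (2 * d) <= e / 2.
  have -> : e / 2 = (C + 1) * (2 * d) by rewrite /d; field; lra.
  by apply: ler_wpM2r; lra.
have h7 := ler_wpM2l C0 h5.
have := ler_normD (Y n k - Y n (grid_idx t n)) (Y n (grid_idx t n) - grid_lim Y t).
rewrite /grid_lim in h1 *.
by rewrite addrA subrK; lra.
Qed.

Lemma grid_lim_lipschitz s t : - tp <= s -> - tp <= t ->
  `|grid_lim Y t - grid_lim Y s| <= C * `|t - s|.
Proof.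
move=> hs ht.
have c1 : `|Y n (grid_idx t n) - Y n (grid_idx s n)| @[n --> U] -->
    `|grid_lim Y t - grid_lim Y s|.
  by apply: cvg_norm; apply: cvgB; apply: gridcvg_idx => //; exact: grid_limP.
have c2 : C * `|grid n (grid_idx t n) - grid n (grid_idx s n)| @[n --> U] -->
    C * `|t - s|.
  apply: cvgM; first exact: cvg_cst.
  by apply: cvg_norm; apply: cvgB; apply: gridcvg_idx => //; exact: grid_cvg.
apply: (ler_cvg_to c1 c2).
by apply: filterS Y1 => n h; exact: lipschitz_grid.
Qed.

End Lipschitz.

Lemma is_derive_of_dist (y : R -> R) t z :
  (forall e : R, 0 < e -> exists2 d : R, 0 < d &
     forall s, `|s - t| < d -> `|y s - y t - (s - t) * z| <= e * `|s - t|) ->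
  is_derive t 1 y z.
Proof.
move=> key.
have h : h^-1 *: (y (h *: (1 : R) + t) - y t) @[h --> 0^'] --> z.
  apply/cvgrPdistC_le => /= e e0; have [d d0 hd] := key e e0.
  near=> h.
  have h0 : h != 0 by near: h; exact: nbhs_dnbhs_neq.
  have hh : `|h| < d by near: h; exact: dnbhs0_lt.
  rewrite scaler1; have := hd (h + t); rewrite addrK => /(_ hh) hb.
  have -> : h^-1 *: (y (h + t) - y t) - z = h^-1 * (y (h + t) - y t - h * z).
    by rewrite /GRing.scale/=; field.
  by rewrite normrM normfV ler_pdivrMl ?normr_gt0// [_ * e]mulrC.
split; last by apply: cvg_lim => //.
by apply/cvg_ex; exists z.
Unshelve. all: by end_near. Qed.

(** Subtracting [z] times the grid coordinate from [Y] leaves a grid function whose increments near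
    [t] are at most [e * step n]. The resulting Lipschitz bound passes to the limit, where it says
    that [y] has derivative [z] at [t]. *)
Lemma grid_lim_derive Y Z (y : R -> R) z t r : 0 < r -> - tp < t - r ->
  (forall s, `|s - t| < r -> gridcvg Y s (y s)) -> gridcvg Z t z ->
  (\forall n \near U, forall k, Y n k.+1 - Y n k = step n * Z n k) ->
  is_derive t 1 y z.
Proof.
move=> r0 tt hY /gridcvgP hZ YZ.
have tp_t : - tp <= t by lra.
have ty : gridcvg Y t (y t) by apply: hY; rewrite subrr normr0.
apply: is_derive_of_dist => e e0; have [d d0 dZ] := hZ e e0.
exists (Num.min d r) => [|s]; first by rewrite lt_min d0.
rewrite lt_min => /andP[sd sr].
have ss : - tp <= s by move: sr; rewrite ltr_norml => /andP[]; lra.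
have c1 := gridcvg_idx tp_t ty; have c2 := gridcvg_idx ss (hY s sr).
have g1 := gridcvg_idx tp_t (@grid_cvg t).
have g2 := gridcvg_idx ss (@grid_cvg s).
have c3 : `|Y n (grid_idx s n) - Y n (grid_idx t n) -
    (grid n (grid_idx s n) - grid n (grid_idx t n)) * z| @[n --> U] -->
    `|y s - y t - (s - t) * z|.
  apply: cvg_norm; apply: cvgB; first exact: cvgB.
  by apply: cvgM; [exact: cvgB|exact: cvg_cst].
have c4 : e * `|grid n (grid_idx s n) - grid n (grid_idx t n)| @[n --> U] -->
    e * `|s - t|.
  by apply: cvgM; [exact: cvg_cst|apply: cvg_norm; exact: cvgB].
apply: (ler_cvg_to c3 c4).
have d1 : 0 < d - `|s - t| by rewrite subr_gt0.
apply: filterS3 dZ (step_lt d1) YZ => n hn h1 YZn.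
have /andP[a1 b1] := grid_idxP n tp_t; have /andP[a2 b2] := grid_idxP n ss.
pose W n k := Y n k - grid n k * z.
have WS i : `|grid n i - t| < d -> `|W n i.+1 - W n i| <= e * step n.
  move=> /hn hi; rewrite /W gridS.
  have -> : Y n i.+1 - (grid n i + step n) * z - (Y n i - grid n i * z) =
    step n * (Z n i - z).
    have -> : Y n i.+1 = Y n i + step n * Z n i by rewrite -YZn; ring.
    ring.

  by rewrite normrM gtr0_norm ?step_gt0// mulrC ler_pM2r ?step_gt0// ltW.
have W2 j k : (j <= k)%N -> t - d < grid n j -> grid n k < t + d ->
    `|W n k - W n j| <= e * `|grid n k - grid n j|.
  move=> jk hj hk; apply: lipschitz_grid_le => // i /andP[ji ik]; apply: WS.
  have := grid_le n ji; have := grid_le n (ltnW ik).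
  by move=> ? ?; rewrite ltr_norml; apply/andP; split; lra.
have : t - s <= `|s - t| by rewrite distrC ler_norm.
have : s - t <= `|s - t| by rewrite ler_norm.
move=> l1 l2.
rewrite /=.
have -> : Y n (grid_idx s n) - Y n (grid_idx t n) -
   (grid n (grid_idx s n) - grid n (grid_idx t n)) * z =
   W n (grid_idx s n) - W n (grid_idx t n) by rewrite /W; ring.
have [jk|/ltnW jk] := leqP (grid_idx t n) (grid_idx s n).
  by apply: W2 => //; lra.
by rewrite distrC [X in _ <= _ * X]distrC; apply: W2 => //; lra.
Qed.

(** The scaled partial sums are a discrete primitive of [Z], and their limit is a primitive of [z].
    Convergence of [Z] is asked inside the period only, because the periodic extension of samples
    may jump at its ends; there the uniform bound on [Z] keeps the limit primitive continuous. *)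
Lemma mean_grid_lim Z (z : R -> R) C : continuous z ->
  (forall t, 0 < t < tp -> gridcvg Z t (z t)) ->
  (\forall n \near U, forall k, `|Z n k| <= C) ->
  n.+1%:R^-1 * (\sum_(n.+1 <= i < n.+1 + n.+1) Z n i) @[n --> U] --> mean z.
Proof.
move=> cz hZ ZC.
pose Y n k := step n * \sum_(0 <= i < k) Z n i.
have Y0 : \forall n \near U, `|Y n 0| <= `|C|.
  by apply: nearW => n; rewrite /Y big_nil mulr0 normr0.
have YS n k : Y n k.+1 - Y n k = step n * Z n k.
  by rewrite /Y big_nat_recr//= mulrDr addrC addKr.
have Y1 : \forall n \near U, forall k, `|Y n k.+1 - Y n k| <= `|C| * step n.
  apply: filterS ZC => n ZC k.
  rewrite YS normrM gtr0_norm ?step_gt0// mulrC ler_pM2r ?step_gt0//.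
  by rewrite (le_trans (ZC k))// ler_norm.
have tp0 := twopi_gt0 R.
pose y := grid_lim Y.
have yP t : - tp <= t -> gridcvg Y t (y t) by exact: grid_limP Y0 Y1 t.
have dy t : 0 < t < tp -> is_derive t 1 y (z t).
  move=> /andP[t0 t1]; apply: (@grid_lim_derive Y Z y (z t) t t) => //.
  - lra.
  - by move=> s; rewrite ltr_norml => /andP[? ?]; apply: yP; lra.
  - by apply: hZ; rewrite t0.
  - by apply: nearW.
have ly s t : - tp <= s -> - tp <= t -> `|y t - y s| <= `|C| * `|t - s|.
  exact: grid_lim_lipschitz Y0 Y1 s t.
have cy t : - tp < t -> {for t, continuous y}.
  move=> tt; apply/cvgrPdistC_le => /= e e0; near=> s.
  have ss : - tp < s by near: s; exact: lt_nbhsr.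
  rewrite (le_trans (ly t s _ _)) ?ltW//.
  have : `|s - t| < e / (`|C| + 1).
    by near: s; apply: near_dist; rewrite divr_gt0// ltr_wpDl.
  rewrite ltr_pdivlMr ?ltr_wpDl// => h.
  by have := normr_ge0 (s - t); lra.
have -> : mean z = tp^-1 * (y tp - y 0).
  rewrite mean_leb; last exact: integ_continuous.
  congr (_ * _); rewrite /Rintegral (@continuous_FTC2 _ z y)//.
  - exact: continuous_subspaceT.
  - split.
    + by move=> x; rewrite in_itv/= => /dy [].
    + by apply: cvg_at_right_filter; apply: cy; lra.
    + by apply: cvg_at_left_filter; apply: cy; lra.
  - by move=> x; rewrite in_itv/= => /dy [_ ?]; rewrite derive1E.
have h0 : - tp <= 0 by lra.
have h1 : - tp <= tp by lra.
have : tp^-1 * (Y n (grid_idx tp n) - Y n (grid_idx 0 n)) @[n --> U] -->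
    tp^-1 * (y tp - y 0).
  apply: cvgM; first exact: cvg_cst.
  by apply: cvgB; apply: gridcvg_idx => //; exact: yP.
apply: cvg_trans; apply: near_eq_cvg; apply: nearW => n /=.
rewrite grid_idx_0 grid_idx_tp /Y (@big_cat_nat _ _ _ n.+1 0 (n.+1 + n.+1))//=; last by rewrite leq_addr.
set A := \sum_(0 <= i < n.+1) _; set B := \sum_(_ <= i < _) _.
have -> : step n * (A + B) - step n * A = step n * B by ring.
rewrite mulrA; congr (_ * _).
by rewrite /step mulrA mulVf ?mul1r// gt_eqF.
Unshelve. all: by end_near. Qed.

End Grid.

(** * The discrete functional, its minimizers and their Euler-Lagrange equations *)

Section Discrete.
Variable R : realType.
Implicit Types (n : nat) (p a r s A eps : R).

Lemma is_derive_bigsum n (h : 'I_n -> R -> R) (x : R) (dh : 'I_n -> R) :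
  (forall i, is_derive x 1 (h i) (dh i)) ->
  is_derive x 1 (fun t => \sum_(i < n) h i t) (\sum_(i < n) dh i).
Proof.
move=> H; have := is_derive_sum H.
by rewrite (_ : \sum_(i < n) h i = fun t => \sum_(i < n) h i t)//; apply/funext => t; rewrite fct_sumE.
Qed.

Lemma for_continuousM (T : topologicalType) (f g : T -> R) x :
  {for x, continuous f} -> {for x, continuous g} ->
  {for x, continuous (fun y => f y * g y)}.
Proof. by move=> hf hg; exact: (@continuousM _ _ f g x hf hg). Qed.

Lemma for_continuousD (T : topologicalType) (f g : T -> R) x :
  {for x, continuous f} -> {for x, continuous g} ->
  {for x, continuous (fun y => f y + g y)}.
Proof. by move=> hf hg; exact: (@continuousD _ _ _ f g x hf hg). Qed.

Lemma for_continuousB (T : topologicalType) (f g : T -> R) x :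
  {for x, continuous f} -> {for x, continuous g} ->
  {for x, continuous (fun y => f y - g y)}.
Proof. by move=> hf hg; exact: (@continuousB _ _ _ f g x hf hg). Qed.

Lemma for_continuous_cst (T : topologicalType) (c : R) (x : T) :
  {for x, continuous (fun _ : T => c)}.
Proof. exact: cst_continuous. Qed.

Definition dslope n (f : 'I_n.+1 -> R) i : R := (f (ordS i) - f i) / @step R n.
Definition dmean n (f : 'I_n.+1 -> R) : R := n.+1%:R^-1 * \sum_i f i.
Definition dpow a n (f : 'I_n.+1 -> R) : R := dmean (fun i => `|f i| `^ a).

(* The summand [(dpow s f) ^+ 2] makes the functional coercive, and the linear
   one keeps the limits of its minimizers away from zero. *)
Definition dJ p r s A eps n (f : 'I_n.+1 -> R) : R :=
  (dpow p (dslope f)) `^ (2 / p) +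
  A * ((dpow r f) `^ (2 / r) - (dpow s f) `^ (2 / s)) + (dpow s f) ^+ 2 - eps * dmean f.

Lemma dmean_le n (f g : 'I_n.+1 -> R) : (forall i, f i <= g i) -> dmean f <= dmean g.
Proof.
by move=> fg; rewrite /dmean ler_wpM2l ?invr_ge0//; apply: ler_sum => i _.
Qed.

Lemma dmean_cst n (c : R) : dmean (fun _ : 'I_n.+1 => c) = c.
Proof.
rewrite /dmean sumr_const card_ord -(mulr_natl c) mulrA mulVf ?mul1r//.
Qed.

Lemma dmeanD n (f g : 'I_n.+1 -> R) : dmean (fun i => f i + g i) = dmean f + dmean g.
Proof. by rewrite /dmean big_split mulrDr. Qed.

Lemma dmean_ge0 n (f : 'I_n.+1 -> R) : (forall i, 0 <= f i) -> 0 <= dmean f.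
Proof. by move=> f0; rewrite -(dmean_cst n 0); exact: dmean_le. Qed.

Lemma dpow_ge0 a n (f : 'I_n.+1 -> R) : 0 <= dpow a f.
Proof. by apply: dmean_ge0 => i; exact: powR_ge0. Qed.

Lemma dmean_term_le n (f : 'I_n.+1 -> R) i : (forall i, 0 <= f i) ->
  f i <= n.+1%:R * dmean f.
Proof.
move=> f0; rewrite /dmean mulrA mulfV ?mul1r// (bigD1 i)//= lerDl.
by apply: sumr_ge0.
Qed.

Lemma le_norm_1powR a (x : R) : 1 <= a -> `|x| <= 1 + `|x| `^ a.
Proof.
move=> a1; have [h1|h1] := lerP `|x| 1.
  by rewrite (le_trans h1)// lerDl powR_ge0.
by rewrite ler_wpDl// le1r_powR// ltW.
Qed.

Lemma powR_le1D a (x : R) : 0 <= a <= 1 -> 0 <= x -> x `^ a <= 1 + x.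
Proof.
move=> /andP[a0 a1] x0; have [h1|h1] := lerP x 1.
  apply: (@le_trans _ _ 1); last by rewrite lerDl.
  by have := @ge0_ler_powR R a a0 x 1; rewrite powR1 !nnegrE; apply.
by rewrite (le_trans (ler1_powR (ltW h1) a1))// ler_wpDl.
Qed.

Lemma dmean_le1 a n (f : 'I_n.+1 -> R) : 1 <= a -> dmean f <= 1 + dpow a f.
Proof.
move=> a1; rewrite -[in leRHS](dmean_cst n 1) /dpow -dmeanD.
by apply: dmean_le => i; rewrite (le_trans (ler_norm _))// le_norm_1powR.
Qed.

Lemma dpow_abs a n (f : 'I_n.+1 -> R) : dpow a (fun i => `|f i|) = dpow a f.
Proof. by congr (_ * _); apply: eq_bigr => i _; rewrite normr_id. Qed.

Lemma dslope_abs p n (f : 'I_n.+1 -> R) : 0 <= p ->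
  dpow p (dslope (fun i => `|f i|)) <= dpow p (dslope f).
Proof.
move=> p0; apply: dmean_le => i; apply: ge0_ler_powR; rewrite ?nnegrE//.
by rewrite /dslope !normrM ler_wpM2r// ler_dist_dist.
Qed.

Section Coercive.
Variables (p r s A eps : R).
Local Notation J := (dJ p r s A eps).

Lemma dJ_abs n (f : 'I_n.+1 -> R) : 1 < p -> 0 <= eps -> J (fun i => `|f i|) <= J f.
Proof.
move=> p1 eps0.
have h1 : (dpow p (dslope (fun i => `|f i|))) `^ (2 / p) <= (dpow p (dslope f)) `^ (2 / p).
  apply: ge0_ler_powR; rewrite ?nnegrE ?dpow_ge0//; first by rewrite divr_ge0//; lra.
  by apply: dslope_abs; lra.
have h2 : dmean f <= dmean (fun i => `|f i|) by apply: dmean_le => i; exact: ler_norm.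
rewrite /dJ !dpow_abs; apply: lerB; last exact: ler_wpM2l.
by rewrite !lerD2r.
Qed.

Lemma dJ_ge n (f : 'I_n.+1 -> R) : 2 < s -> 0 <= A -> 0 <= eps ->
  (dpow p (dslope f)) `^ (2 / p) + (dpow s f) ^+ 2 - (A + eps) * (1 + dpow s f) <= J f.
Proof.
move=> s2 A0 eps0; have P0 := dpow_ge0 s f.
have h1 : (dpow s f) `^ (2 / s) <= 1 + dpow s f.
  by apply: powR_le1D => //; rewrite divr_ge0 ?ler_pdivrMr/=; lra.
have h2 : dmean f <= 1 + dpow s f by apply: dmean_le1; lra.
have h3 : 0 <= (dpow r f) `^ (2 / r) := powR_ge0 _ _.
have := ler_wpM2l eps0 h2; have := ler_wpM2l A0 h1; have := mulr_ge0 A0 h3.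
rewrite /dJ; move: (_ `^ (2 / p)) (_ `^ (2 / r)) (_ `^ (2 / s)) (dmean f) => x y z w.
move: (dpow s f) => P; lra.
Qed.

Lemma dJ_le0_bound n (f : 'I_n.+1 -> R) : 2 < s -> 0 <= A -> 0 <= eps -> J f <= 0 ->
  dpow s f <= A + eps + 1 /\
  (dpow p (dslope f)) `^ (2 / p) <= (A + eps) * (A + eps + 2).
Proof.
move=> s2 A0 eps0 J0; have := dJ_ge f s2 A0 eps0; have P0 := dpow_ge0 s f.
have E0 : 0 <= (dpow p (dslope f)) `^ (2 / p) := powR_ge0 _ _.
set P := dpow s f in P0 *; set E := _ `^ _ in E0 * => h.
have c0 : 0 <= A + eps by lra.
(* If [P] exceeded [A + eps + 1], then [P ^ 2] would exceed [(A + eps) * (1 + P)]. *)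
have PK : P <= A + eps + 1 by have [//|h'] := leP P (A + eps + 1); nra.
by split=> //; nra.
Qed.

Lemma continuous_rV_sum m n (g : 'I_m -> 'rV[R]_n -> R) (x : 'rV[R]_n) :
  (forall i, {for x, continuous (g i)}) -> {for x, continuous (fun y => \sum_(i < m) g i y)}.
Proof.
move=> h; rewrite (_ : (fun y => _) = \sum_(i < m) g i); last first.
  by apply/funext => t; rewrite fct_sumE.
elim/big_ind: _ => //.
- by apply: cst_continuous.
- by move=> f1 f2 h1 h2; exact: continuousD.
Qed.

Lemma continuous_dpow a m n (g : 'I_m.+1 -> 'rV[R]_n -> R) (x : 'rV[R]_n) b : 0 < a -> 0 < b ->
  (forall i, {for x, continuous (g i)}) ->
  {for x, continuous (fun y => (dpow a (g ^~ y)) `^ b)}.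
Proof.
move=> a0 b0 h.
have -> : (fun y => (dpow a (g ^~ y)) `^ b) = (fun y => `|dpow a (g ^~ y)| `^ b).
  by apply/funext => y; rewrite ger0_norm ?dpow_ge0.
apply: (@continuous_comp _ _ _ (fun y => dpow a (g ^~ y)) (fun z : R => `|z| `^ b)); last first.
  exact: normr_continuous_powR.
apply: for_continuousM; first exact: for_continuous_cst.
apply: (@continuous_rV_sum _ _ (fun i y => `|g i y| `^ a)) => i.
apply: (@continuous_comp _ _ _ (g i) (fun z : R => `|z| `^ a)) => //.
exact: normr_continuous_powR.
Qed.

Lemma continuous_dJ n (x : 'rV[R]_n.+1) : 1 < p -> 1 < r -> 2 < s ->
  {for x, continuous (fun x : 'rV[R]_n.+1 => J (x 0))}.
Proof.
move=> p1 r1 s2.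
have hc i : {for x, continuous (fun y : 'rV[R]_n.+1 => y 0 i)} by exact: coord_continuous.
have hd i : {for x, continuous (fun y : 'rV[R]_n.+1 => dslope (y 0) i)}.
  by apply: for_continuousM; [apply: for_continuousB; exact: hc|exact: for_continuous_cst].
have cE := @continuous_dpow p _ _ _ x (2 / p) _ _ hd.
have cr := @continuous_dpow r _ _ _ x (2 / r) _ _ hc.
have cs := @continuous_dpow s _ _ _ x (2 / s) _ _ hc.
have c1 := @continuous_dpow s _ _ _ x 1 _ _ hc.
have pos a : 1 < a -> 0 < 2 / a by move=> a1; rewrite divr_gt0//; lra.
apply: for_continuousB; [apply: for_continuousD; [apply: for_continuousD|]|].
- by apply: cE; [lra|exact: pos].
- apply: for_continuousM; first exact: for_continuous_cst.
  by apply: for_continuousB; [apply: cr|apply: cs]; rewrite ?pos//; lra.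
- have c2 : {for x, continuous (fun y : 'rV[R]_n.+1 => dpow s (y 0))}.
    have -> : (fun y : 'rV[R]_n.+1 => dpow s (y 0)) = (fun y => (dpow s (y 0)) `^ 1).
      by apply/funext => y; rewrite powRr1 ?dpow_ge0.
    by apply: c1; lra.
  by apply: for_continuousM; exact: c2.
- apply: for_continuousM; first exact: for_continuous_cst.
  apply: for_continuousM; first exact: for_continuous_cst.
  by apply: (@continuous_rV_sum _ _ (fun i y => y 0 i)) => i; exact: hc.
Qed.

(** The box [K] contains every grid function with [J <= 0], and [J] vanishes at zero, so the minimum
    over the box is global. Taking absolute values makes the minimizer nonnegative without raising
    [J]. *)
Lemma dJ_min n : 1 < p -> 1 < r -> 2 < s -> 0 <= A -> 0 <= eps ->
  exists2 f : 'I_n.+1 -> R, forall i, 0 <= f i & forall g : 'I_n.+1 -> R, J f <= J g.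
Proof.
move=> p1 r1 s2 A0 eps0.
(* A value is at most 1 plus its power [s], and that power is at most [n.+1] times the mean bounded
   by [dJ_le0_bound]. *)
set B := 1 + n.+1%:R * (A + eps + 1).
have B0 : 0 <= B by rewrite addr_ge0// mulr_ge0//; lra.
pose K := [set v : 'rV[R]_n.+1 | forall i, `[- B, B]%classic (v ord0 i)].
have cK : compact K by apply: (@rV_compact R _ (fun=> `[- B, B]%classic)) => i; exact: segment_compact.
have K0 : K 0 by move=> i /=; rewrite mxE in_itv/= oppr_le0 B0.
have J0 : J (fun _ : 'I_n.+1 => 0) = 0.
  have z a : 1 < a -> dpow a (fun _ : 'I_n.+1 => (0 : R)) = 0.
    move=> a1; rewrite /dpow -[RHS](dmean_cst n 0); congr (_ * _).
    by apply: eq_bigr => i _; rewrite normr0 powR0// gt_eqF//; lra.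
  have z2 a : 1 < a -> (0 : R) `^ (2 / a) = 0.
    by move=> a1; rewrite powR0// gt_eqF// divr_gt0//; lra.
  rewrite /dJ.
  have -> : dslope (fun _ : 'I_n.+1 => (0 : R)) = fun=> 0.
    by apply/funext => i; rewrite /dslope subrr mul0r.
  rewrite !z ?z2 ?dmean_cst//; try lra.
have [c _ cmin] := EVT_min_rV (ex_intro _ _ K0) cK (continuous_subspaceT (fun x => @continuous_dJ n x p1 r1 s2)).
have Jc0 : J (c 0) <= 0.
  have := cmin 0; rewrite inE => /(_ K0); rewrite -J0; congr (_ <= J _).
  by apply/funext => i; rewrite mxE.
exists (fun i => `|c 0 i|) => // g.
rewrite (le_trans (dJ_abs _ p1 eps0))//.
have [gpos|g0] := ltP 0 (J g); first exact: le_trans Jc0 (ltW gpos).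
have [gs _] := dJ_le0_bound s2 A0 eps0 g0.
have Kg : K (\row_i g i).
  move=> i /=; rewrite mxE in_itv/= -ler_norml.
  rewrite (le_trans (@le_norm_1powR s _ _))//; first lra.
  rewrite lerD2l (le_trans (@dmean_term_le _ (fun i => `|g i| `^ s) i _))//.
  by rewrite ler_pM2l.
have := cmin (\row_i g i); rewrite inE => /(_ Kg); congr (_ <= J _).
by apply/funext => i; rewrite mxE.
Qed.

Lemma is_derive_dpow a n (g : 'I_n.+1 -> R -> R) (dg : 'I_n.+1 -> R) : 1 < a ->
  (forall i, is_derive (0 : R) 1 (g i) (dg i)) ->
  is_derive (0 : R) 1 (fun t => dpow a (g ^~ t))
    (dmean (fun i => a * spow (a - 1) (g i 0) * dg i)).
Proof.
move=> a1 h.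
apply: (@is_deriveZ _ _ _ (fun t => \sum_i `|g i t| `^ a) n.+1%:R^-1).
apply: (@is_derive_bigsum _ (fun i t => `|g i t| `^ a)) => i.
apply: (@is_derive1_comp _ (fun z => `|z| `^ a) (g i)).
exact: is_derive_normr_powR.
Qed.

Lemma is_derive_affine (c e : R) : is_derive (0 : R) 1 (fun t => c + t * e) e.
Proof.
apply: (@is_derive_of_dist _ _ 0 e) => d d0; exists 1 => // t _.
by rewrite mul0r addr0 subr0 [c + _]addrC addrK subrr normr0 mulr_ge0// ltW.
Qed.

Lemma is_derive_min0 (F : R -> R) l : is_derive (0 : R) 1 F l ->
  (forall t, F 0 <= F t) -> l = 0.
Proof.
move=> [/cvg_ex[l' hl'] dl] Fmin.
have hl : h^-1 *: (F (h *: (1 : R) + 0) - F 0) @[h --> 0^'] --> l.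
  by rewrite -dl; apply/cvg_ex; exists l'.
apply/eqP/negPn/negP => l0.
have nl : 0 < `|l| by rewrite normr_gt0.
have [d /= d0 hd] : \forall h \near 0^', `|h^-1 *: (F (h *: (1 : R) + 0) - F 0) - l| < `|l|.
  by move/cvgrPdistC_lt : hl; apply.
(* The increment goes against the sign of [l], where a nonzero slope would make [F] decrease. *)
pose h := - Num.sg l * (d / 2).
have hd2 : `|h| = d / 2.
  by rewrite normrM normrN normr_sg l0 mul1r ger0_norm// ltW// divr_gt0.
have h0 : h != 0 by rewrite -normr_gt0 hd2 divr_gt0.
have := hd h; rewrite /= sub0r normrN hd2 => /(_ _ h0).
rewrite ltr_pdivrMr// ltr_pMr// ltr1n => /(_ isT).
rewrite scaler1 addr0 /GRing.scale/=.
have := Fmin h; rewrite -subr_ge0; set D := F h - F 0 => D0.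
suff : `|l| <= `|h^-1 * D - l| by rewrite leNgt => /negP.
have hs : h^-1 = - Num.sg l * (d / 2)^-1.
  rewrite /h invfM; congr (_ * _).
  have [l1|l1|/eqP] := ltgtP l 0; last by rewrite (negbTE l0).
    by rewrite ltr0_sg// opprK invr1.
  by rewrite gtr0_sg// invrN invr1.
have -> : h^-1 * D - l = - (Num.sg l * ((d / 2)^-1 * D + `|l|)).
  by rewrite hs {2}(numEsg l); ring.
rewrite normrN normrM normr_sg l0 mul1r ger0_norm ?lerDr ?mulr_ge0//.
- by rewrite invr_ge0 divr_ge0// ltW.
- by rewrite addr_ge0// mulr_ge0// invr_ge0 divr_ge0// ltW.
Qed.

Lemma dmean_delta n (c : 'I_n.+1 -> R) j :
  dmean (fun i => c i * (i == j)%:R) = n.+1%:R^-1 * c j.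
Proof.
rewrite /dmean (bigD1 j)//= eqxx mulr1 big1 ?addr0// => i /negbTE ->.
by rewrite mulr0.
Qed.

(** A grid function with a nonzero slope is not zero. This keeps the bases of the powers [2 / r] and
    [2 / s] in [dJ] away from the origin, where these powers need not be differentiable. *)
Lemma dpow_gt0 a n (f : 'I_n.+1 -> R) : 0 < dpow p (dslope f) -> p != 0 -> a != 0 ->
  0 < dpow a f.
Proof.
move=> E0 p0 a0; rewrite lt_neqAle dpow_ge0 andbT eq_sym; apply/eqP => P0.
have f0 i : f i = 0.
  have := @dmean_term_le _ (fun i => `|f i| `^ a) i (fun j => powR_ge0 _ _).
  rewrite -/(dpow a f) P0 mulr0 => h.
  have : `|f i| `^ a = 0 by apply/eqP; rewrite eq_le h powR_ge0.
  by move=> /powR_eq0_eq0/eqP; rewrite normr_eq0 => /eqP.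
suff : dpow p (dslope f) = 0 by move=> h; rewrite h ltxx in E0.
rewrite /dpow -[RHS](dmean_cst n 0); congr (_ * _); apply: eq_bigr => i _.
by rewrite /dslope !f0 subrr mul0r normr0 powR0.
Qed.

Lemma is_derive_dJ_combination (a b c q m : R -> R) (da db dc dq dm x : R) :
  is_derive x 1 a da -> is_derive x 1 b db -> is_derive x 1 c dc ->
  is_derive x 1 q dq -> is_derive x 1 m dm ->
  is_derive x 1 (fun t => a t + A * (b t - c t) + q t ^+ 2 - eps * m t)
    (da + A * (db - dc) + 2 * q x * dq - eps * dm).
Proof.
move=> ha hb hc hq hm.
have -> : (fun t => a t + A * (b t - c t) + q t ^+ 2 - eps * m t) =
    a + A *: (b - c) + q * q - eps *: m.
  by apply/funext => t; rewrite /= -expr2.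
have h1 : is_derive x 1 (A *: (b - c)) (A *: (db - dc)).
  by apply: is_deriveZ; exact: is_deriveB.
have h2 : is_derive x 1 (a + A *: (b - c) + q * q)
    (da + A *: (db - dc) + (q x *: dq + q x *: dq)).
  have hq2 : is_derive x 1 (q * q) (q x *: dq + q x *: dq).
    exact: (is_deriveM hq hq).
  by exact: (is_deriveD (is_deriveD ha h1) hq2).
have h3 : is_derive x 1 (eps *: m) (eps *: dm) by exact: is_deriveZ.
have h4 : is_derive x 1 (a + A *: (b - c) + q * q - eps *: m)
    (da + A *: (db - dc) + (q x *: dq + q x *: dq) - eps *: dm) by exact: is_deriveB.
apply: (is_derive_eq h4).
by rewrite /GRing.scale/=; ring.
Qed.

(** The partial derivative of [J] at one node. The energy to the power [2 / p - 1], which multiplies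
    the flux difference, is moved to the other side; there its exponent [1 - 2 / p] is positive once
    [p > 2], and the limit can be taken without a lower bound on the energy. *)
Lemma dJ_euler n (f : 'I_n.+1 -> R) : 1 < p -> 1 < r -> 2 < s ->
  (forall i, 0 <= f i) -> (forall g : 'I_n.+1 -> R, J f <= J g) ->
  0 < dpow p (dslope f) -> forall i,
  spow (p - 1) (dslope f (ordS i)) - spow (p - 1) (dslope f i) =
  @step R n * ((dpow p (dslope f)) `^ (1 - 2 / p) *
    (A * (dpow r f) `^ (2 / r - 1) * (f (ordS i)) `^ (r - 1) -
     (A * (dpow s f) `^ (2 / s - 1) - s * dpow s f) * (f (ordS i)) `^ (s - 1) - eps / 2)).
Proof.
move=> p1 r1 s2 f0 fmin E0 j0; set j := ordS j0.
have [p0 r0 s0] : [/\ p != 0, r != 0 & s != 0] by split; rewrite gt_eqF//; lra.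
pose e k : R := (k == j)%:R.
pose g k t := f k + t * e k.
have dg k : is_derive (0 : R) 1 (g k) (e k) by exact: is_derive_affine.
have g0 k : g k 0 = f k by rewrite /g mul0r addr0.
pose h k t := dslope f k + t * dslope e k.
have hg t : dslope (g ^~ t) = h ^~ t.
  by apply/funext => k; rewrite /dslope /g /h /dslope; ring.
have dh k : is_derive (0 : R) 1 (h k) (dslope e k) by exact: is_derive_affine.
have h0 k : h k 0 = dslope f k by rewrite /h mul0r addr0.
have h0' : h ^~ 0 = dslope f by apply/funext.
have g0' : g ^~ 0 = f by apply/funext.
have Pr0 : 0 < dpow r f by exact: dpow_gt0.
have Ps0 : 0 < dpow s f by exact: dpow_gt0.
have DE := is_derive_dpow p1 dh.
have DPr := is_derive_dpow r1 dg.
have s1 : 1 < s by lra.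
have DPs := is_derive_dpow s1 dg.
have DE2 := @is_derive_powR_comp _ (fun t => dpow p (h ^~ t)) 0 _ (2 / p) _ DE.
have DPr2 := @is_derive_powR_comp _ (fun t => dpow r (g ^~ t)) 0 _ (2 / r) _ DPr.
have DPs2 := @is_derive_powR_comp _ (fun t => dpow s (g ^~ t)) 0 _ (2 / s) _ DPs.
rewrite h0' in DE2; rewrite g0' in DPr2 DPs2.
have {}DE2 := DE2 E0; have {}DPr2 := DPr2 Pr0; have {}DPs2 := DPs2 Ps0.
have DM : is_derive (0 : R) 1 (fun t => dmean (g ^~ t)) (dmean e).
  apply: (@is_deriveZ _ _ _ (fun t => \sum_i g i t) n.+1%:R^-1).
  exact: is_derive_bigsum.
have := is_derive_dJ_combination DE2 DPr2 DPs2 DPs DM.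
have -> : (fun t => dpow p (h^~ t) `^ (2 / p) +
     A * (dpow r (g^~ t) `^ (2 / r) - dpow s (g^~ t) `^ (2 / s)) +
     dpow s (g^~ t) ^+ 2 - eps * dmean (g^~ t)) = fun t => J (g ^~ t).
  by apply/funext => t; rewrite /dJ hg.
move=> /is_derive_min0; rewrite g0' => /(_ (fun t => fmin _)).
have -> : dmean (fun i => p * spow (p - 1) (h i 0) * dslope e i) = n.+1%:R^-1 *
    (p * (spow (p - 1) (dslope f j0) - spow (p - 1) (dslope f j)) / @step R n).
  (* Node [j] is the right end of the slope at [j0] and the left end of the slope at [j]. *)
  have -> : (fun i => p * spow (p - 1) (h i 0) * dslope e i) = (fun i =>
      (p * spow (p - 1) (dslope f i) / @step R n) * (i == j0)%:R +
      (- (p * spow (p - 1) (dslope f i) / @step R n)) * (i == j)%:R).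
    apply/funext => i; rewrite h0 /dslope /e.
    have -> : (ordS i == j) = (i == j0) by rewrite /j (inj_eq (can_inj (@ordSK _))).
    by ring.
  by rewrite dmeanD !dmean_delta; ring.
have dgE a : (fun i => a * spow (a - 1) (g i 0) * e i) =
    (fun i => (a * spow (a - 1) (f i)) * (i == j)%:R).
  by apply/funext => i; rewrite g0.
rewrite !dgE !dmean_delta.
have -> : dmean e = n.+1%:R^-1.
  have := dmean_delta (fun=> 1) j; rewrite mulr1 => <-.
  by congr dmean; apply/funext => i; rewrite mul1r.
rewrite !(@ge0_spow _ _ (f j))//; [|by rewrite gt_eqF//; lra|by rewrite gt_eqF//; lra].
have E1 : dpow p (dslope f) `^ (1 - 2 / p) * dpow p (dslope f) `^ (2 / p - 1) = 1.
  rewrite -powRD; last by rewrite (gt_eqF E0)/= implybT.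
  by rewrite (_ : _ + _ = 0) ?powRr0//; ring.
move: E1; set E' := _ `^ (1 - 2 / p); set E'' := _ `^ (2 / p - 1).
set Pr := _ `^ (2 / r - 1); set Ps := _ `^ (2 / s - 1).
set w0 := spow _ (dslope f j0); set w1 := spow _ (dslope f j).
set X := _ `^ (r - 1); set Y := _ `^ (s - 1).
set P := dpow s f => E1 eq0.
have hn : n.+1%:R != 0 :> R by rewrite pnatr_eq0.
have hh : @step R n != 0 by rewrite gt_eqF ?step_gt0.
have eq1 : E'' * (w1 - w0) / @step R n = A * Pr * X - (A * Ps - s * P) * Y - eps / 2.
  (* The common factor of the derivative: 2 from the exponents and from the square, [n.+1] from the
     mean. This is why [eps] appears halved. *)
  apply: (@mulfI _ (2 / n.+1%:R)); first by rewrite mulf_neq0 ?invr_eq0// pnatr_eq0.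
  apply/eqP; rewrite -subr_eq0 -oppr_eq0 -eq0; apply/eqP; field.
  by rewrite hh p0 r0 s0 nat1r hn.
rewrite -eq1; transitivity ((E' * E'') * (w1 - w0)); first by rewrite E1 mul1r.
by field.
Qed.

End Coercive.
End Discrete.

(** * Periodic extension of grid functions and discrete inequalities *)

Section PeriodicSequence.
Variable R : realType.
Implicit Types (n k : nat).

(** Indexed by all naturals because the grid starts one period to the left of 0 and the limit is
    taken on more than one period. *)
Definition seqof n (f : 'I_n.+1 -> R) k : R := f (inord (k %% n.+1)).

Lemma seqofS n (f : 'I_n.+1 -> R) k : seqof f k.+1 = f (ordS (inord (k %% n.+1))).
Proof.
congr f; apply/val_inj => /=; rewrite !inordK ?ltn_pmod//.
by rewrite -addn1 -[in RHS]addn1 modnDml.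
Qed.

Lemma seqof_dslope n (f : 'I_n.+1 -> R) k :
  seqof f k.+1 - seqof f k = @step R n * seqof (dslope f) k.
Proof.
by rewrite seqofS /seqof /dslope mulrC divfK// gt_eqF// step_gt0.
Qed.

Lemma seqof_period n (f : 'I_n.+1 -> R) k : seqof f (k + n.+1) = seqof f k.
Proof. by rewrite /seqof modnDr. Qed.

Lemma seqof_ord n (f : 'I_n.+1 -> R) (i : 'I_n.+1) : seqof f i = f i.
Proof. by rewrite /seqof modn_small// inord_val. Qed.

Lemma seqof_sum n (f : 'I_n.+1 -> R) :
  \sum_(n.+1 <= i < n.+1 + n.+1) seqof f i = \sum_i f i.
Proof.
rewrite -{1}[n.+1]add0n big_addn addnK big_mkord; apply: eq_bigr => i _.
by rewrite seqof_period seqof_ord.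
Qed.

Lemma dmean_seqof n (f : 'I_n.+1 -> R) (g : R -> R) :
  n.+1%:R^-1 * \sum_(n.+1 <= i < n.+1 + n.+1) g (seqof f i) = dmean (fun i => g (f i)).
Proof. by rewrite /dmean -(seqof_sum (fun i => g (f i))). Qed.

Lemma dmean_jensen a n (f : 'I_n.+1 -> R) : 1 < a -> `|dmean f| `^ a <= dpow a f.
Proof.
move=> a1.
have : dmean (fun i => (`|dmean f| `^ a - a * spow (a - 1) (dmean f) * dmean f) +
    a * spow (a - 1) (dmean f) * f i) <= dpow a f.
  apply: dmean_le => i; apply: le_trans (powR_tangent (dmean f) (f i) a1).
  by rewrite mulrBr; set x := _ `^ _; set y := a * _; lra.
rewrite dmeanD dmean_cst.
have -> : dmean (fun i => a * spow (a - 1) (dmean f) * f i) = a * spow (a - 1) (dmean f) * dmean f.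
  by rewrite {1}/dmean -mulr_sumr mulrCA.
by rewrite subrK.
Qed.

Lemma dmean_exists_le n (f : 'I_n.+1 -> R) : exists i, f i <= dmean f.
Proof.
apply: contrapT => h0.
have h i : dmean f < f i.
  by rewrite ltNge; apply/negP => ?; apply: h0; exists i.
have : dmean f * n.+1%:R = \sum_i f i by rewrite /dmean mulrC mulrA mulfV ?mul1r.
have : \sum_(i < n.+1) dmean f < \sum_i f i.
  apply: ltr_sum; first by apply/hasP; exists ord0; rewrite ?mem_index_enum.
  by [].
by rewrite sumr_const card_ord -(mulr_natr (dmean f)) => /[swap] ->; rewrite ltxx.
Qed.

Lemma dslope_sum0 n (f : 'I_n.+1 -> R) : dmean (dslope f) = 0.
Proof.
rewrite /dmean /dslope -mulr_suml sumrB.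
have -> : \sum_(i < n.+1) f (ordS i) = \sum_i f i.
  by rewrite [RHS](reindex_inj (can_inj (@ordSK _))).
by rewrite subrr mul0r mulr0.
Qed.

(** A discrete Sobolev inequality: telescope between the two nodes, and let the step turn the sum of
    the slopes into their mean. *)
Lemma seqof_osc n (f : 'I_n.+1 -> R) (j k : 'I_n.+1) :
  `|f k - f j| <= pi *+ 2 * dmean (fun i => `|dslope f i|).
Proof.
wlog jk : j k / (j <= k)%N.
  move=> H; have [/H//|/ltnW/H] := leqP j k.
  by rewrite distrC.
rewrite -(seqof_ord f k) -(seqof_ord f j) -(telescope_sumr (seqof f) jk).
rewrite (le_trans (ler_norm_sum _ _ _))//.
have -> : pi *+ 2 * dmean (fun i => `|dslope f i|) =
    \sum_(0 <= i < n.+1) @step R n * `|seqof (dslope f) i|.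
  rewrite -mulr_sumr big_mkord /dmean /step mulrA; congr (_ * _).
  by apply: eq_bigr => i _; rewrite seqof_ord.
rewrite (@big_cat_nat _ _ _ j 0 n.+1)//=; last exact/ltnW.
rewrite (@big_cat_nat _ _ _ k j n.+1)//=; last exact/ltnW.
have pos a b : 0 <= \sum_(a <= i < b) @step R n * `|seqof (dslope f) i|.
  by apply: sumr_ge0 => i _; rewrite mulr_ge0// ltW// step_gt0.
have -> : \sum_(j <= i < k) `|seqof f i.+1 - seqof f i| =
    \sum_(j <= i < k) @step R n * `|seqof (dslope f) i|.
  by apply: eq_bigr => i _; rewrite seqof_dslope normrM gtr0_norm// step_gt0.
by have := pos 0%N (j : nat); have := pos (k : nat) n.+1; lra.
Qed.

(** On constants the homogeneous terms cancel, since both norms equal [|c|], and only the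
    perturbations remain. *)
Lemma dJ_cst p r s A eps n (c : R) : 0 < p -> 0 < r -> 0 < s -> 
  dJ p r s A eps (fun _ : 'I_n.+1 => c) = `|c| `^ s ^+ 2 - eps * c.
Proof.
move=> p0 r0 s0; rewrite /dJ.
have -> : dslope (fun _ : 'I_n.+1 => c) = (fun=> 0).
  by apply/funext => i; rewrite /dslope subrr mul0r.
rewrite /dpow !dmean_cst normr0 powR0 ?gt_eqF// powR0 ?gt_eqF ?divr_gt0//.
have e a : 0 < a -> (`|c| `^ a) `^ (2 / a) = `|c| `^ 2.
  by move=> a0; rewrite -powRrM mulrC divfK// gt_eqF.
by rewrite !e//; ring.
Qed.

Lemma dslope0_cst p n (f : 'I_n.+1 -> R) : dpow p (dslope f) = 0 ->
  forall i, f i = f ord0.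
Proof.
move=> E0.
have d0 i : dslope f i = 0.
  have := @dmean_term_le _ _ (fun i => `|dslope f i| `^ p) i (fun j => powR_ge0 _ _).
  rewrite -/(dpow p (dslope f)) E0 mulr0 => h.
  have : `|dslope f i| `^ p = 0 by apply/eqP; rewrite eq_le h powR_ge0.
  by move=> /powR_eq0_eq0/eqP; rewrite normr_eq0 => /eqP.
move=> i; apply/eqP; rewrite -subr_eq0 -normr_le0.
have -> : 0 = pi *+ 2 * dmean (fun i => `|dslope f i|) :> R; last exact: seqof_osc.
rewrite (_ : (fun i => _) = fun=> 0) ?dmean_cst ?mulr0//.
by apply/funext => j; rewrite d0 normr0.
Qed.

End PeriodicSequence.

(** * Uniform bounds and the continuum limit of the minimizers *)

Section DiscreteLimit.
Variable R : realType.
Implicit Types (p r s A eps eta : R).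

Lemma powR2K (a y : R) : a != 0 -> 0 <= y -> (y `^ (2 / a)) `^ (a / 2) = y.
Proof.
move=> a0 y0; rewrite -powRrM (_ : 2 / a * (a / 2) = 1) ?powRr1//.
by field.
Qed.

Lemma mean_pow_le_sup n (f : 'I_n.+1 -> R) a C : 0 <= a -> 0 <= C ->
  (forall i, `|f i| <= C) -> dpow a f <= C `^ a.
Proof.
move=> a0 C0 fC; rewrite -(dmean_cst n (C `^ a)); apply: dmean_le => i.
by apply: ge0_ler_powR; rewrite ?nnegrE.
Qed.

(** Transfers a lower bound from the exponent [s] to the smaller exponent [r]. *)
Lemma dpow_lower n (f : 'I_n.+1 -> R) r s C : 0 < r -> r < s -> 0 < C ->
  (forall i, `|f i| <= C) -> dpow s f / C `^ (s - r) <= dpow r f.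
Proof.
move=> r0 rs C0 fC; rewrite ler_pdivrMr ?powR_gt0// mulrC.
have -> : C `^ (s - r) * dpow r f = dmean (fun i => C `^ (s - r) * `|f i| `^ r).
  by rewrite /dpow /dmean -mulr_sumr mulrCA.
apply: dmean_le => i.
have [->|fi0] := eqVneq (f i) 0.
  by rewrite normr0 !powR0 ?mulr0// gt_eqF//; lra.
have -> : `|f i| `^ s = `|f i| `^ (s - r) * `|f i| `^ r.
  by rewrite -powRD ?subrK// normr_eq0 fi0 implybT.
by rewrite ler_wpM2r ?powR_ge0//; apply: ge0_ler_powR; rewrite ?nnegrE//; lra.
Qed.

(** By the assumption on [c], constants stay above the level [- eta] by the margin [eta / 2]. Hence
    a grid function at that level has a nonzero slope; and since Jensen's inequality compares the
    perturbations with those of the mean of [f], the margin keeps [dpow s f] away from 0 uniformly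
    in [n]. *)
Lemma dJ_neg_bounds p r s A eps eta : 2 < p -> 1 < r -> r < s -> 2 < s ->
  0 < A -> 0 <= eps -> 0 < eta ->
  (forall c : R, - (eta / 2) <= (`|c| `^ s) ^+ 2 - eps * c) ->
  exists C d : R, [/\ 0 < C, 0 < d & forall n (f : 'I_n.+1 -> R),
    dJ p r s A eps f <= - eta ->
    [/\ 0 < dpow p (dslope f), dpow p (dslope f) <= C,
        d <= dpow r f <= C, d <= dpow s f <= C & forall i, `|f i| <= C]].
Proof.
move=> p2 r1 rs s2 A0 eps0 eta0 Hc.
(* The two bounds of [dJ_le0_bound]. *)
set K := A + eps + 1; set K2 := (A + eps) * (A + eps + 2).
have K2p : 0 <= K2 by apply: mulr_ge0; lra.
set KE := K2 `^ (p / 2).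
have KE0 : 0 <= KE := powR_ge0 _ _.
(* The size of [f] at a node where [|f|^s] is at most its mean, plus the oscillation given by
   [seqof_osc]. *)
set C := 1 + K + pi *+ 2 * (1 + KE).
have tp0 := twopi_gt0 R.
have C0 : 0 < C.
  have : 0 <= pi *+ 2 * (1 + KE) by rewrite mulr_ge0 ?(ltW tp0)//; lra.
  by rewrite /C /K; move: (pi *+ 2 * _) => z; lra.
(* Solves [A * d^(2/s) = eta / 2]: the only negative homogeneous term has to supply what the
   perturbations cannot. *)
set d := (eta / 2 / A) `^ (s / 2).
have d0 : 0 < d by rewrite powR_gt0// !divr_gt0.
set d' := d / C `^ (s - r).
have d'0 : 0 < d' by rewrite divr_gt0// powR_gt0.
set C' := C + KE + K + C `^ r.
have Cr0 := powR_ge0 C r.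
exists C', (Num.min d d'); split.
- by rewrite /C' /K; move: (C `^ r) Cr0 => z z0; lra.
- by rewrite lt_min d0.
move=> n f Jf.
have [s0 r0 p0] : [/\ 0 < s, 0 < r & 0 < p] by split; lra.
have A0' : 0 <= A by lra.
have J0 : dJ p r s A eps f <= 0 by lra.
have [Ps KE2] := dJ_le0_bound s2 A0' eps0 J0.
have Ps0 := dpow_ge0 s f; have E0 := dpow_ge0 p (dslope f).
have EK : dpow p (dslope f) <= KE.
  have -> : dpow p (dslope f) = (dpow p (dslope f) `^ (2 / p)) `^ (p / 2).
    by rewrite powR2K// gt_eqF.
  by apply: ge0_ler_powR; rewrite ?nnegrE ?powR_ge0// divr_ge0// ltW.
have E1 : 0 < dpow p (dslope f).
  rewrite lt_neqAle E0 andbT eq_sym; apply/eqP => Ez.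
  have fc : f = fun=> f ord0 by apply/funext => i; exact: dslope0_cst Ez i.
  have := Jf; rewrite fc dJ_cst//.
  by have := Hc (f ord0); lra.
have Pd : d <= dpow s f.
  have s1 : 1 < s by lra.
  have h1 := dmean_jensen f s1.
  have h2 : (`|dmean f| `^ s) ^+ 2 <= (dpow s f) ^+ 2.
    by rewrite ler_sqr ?nnegrE ?powR_ge0.
  have h3 := Hc (dmean f).
  have h4 : eta / 2 <= A * (dpow s f) `^ (2 / s).
    have h5 : 0 <= A * dpow r f `^ (2 / r) by rewrite mulr_ge0// powR_ge0.
    have h6 : 0 <= dpow p (dslope f) `^ (2 / p) := powR_ge0 _ _.
    move: Jf h2 h3 h5 h6; rewrite /dJ.
    move: (_ `^ (2 / p)) (_ `^ (2 / r)) (_ `^ (2 / s)) (dmean f) => a b c m.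
    by move: (dpow s f) (_ `^ s) => P Q; lra.
  have -> : dpow s f = (dpow s f `^ (2 / s)) `^ (s / 2).
    by rewrite powR2K// gt_eqF.
  apply: ge0_ler_powR; rewrite ?nnegrE ?powR_ge0//; first by rewrite divr_ge0// ltW.
    by rewrite !divr_ge0// ltW.
  by rewrite ler_pdivrMr// [_ * A]mulrC.
have fC i : `|f i| <= C.
  have [i0 hi0] := dmean_exists_le (fun i => `|f i| `^ s).
  have h1 : `|f i0| <= 1 + K.
    apply: (le_trans (@le_norm_1powR _ s _ _)); first lra.
    by rewrite lerD2l (le_trans hi0).
  have h2 : `|f i - f i0| <= pi *+ 2 * (1 + KE).
    apply: (le_trans (seqof_osc f i0 i)); rewrite ler_pM2l//.
    rewrite (le_trans (@dmean_le1 _ p _ (fun i => `|dslope f i|) _))//; first lra.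
    by rewrite dpow_abs lerD2l.
  have := ler_normD (f i0) (f i - f i0); rewrite addrC subrK.
  by rewrite /C; move: (pi *+ 2 * _) h2 => z h2; lra.
have Prd : d' <= dpow r f.
  apply: le_trans (dpow_lower r0 rs C0 fC).
  by rewrite /d' ler_wpM2r// invr_ge0 powR_ge0.
have PrC : dpow r f <= C `^ r by apply: mean_pow_le_sup; rewrite ?ltW.
have K0 : 0 <= K by rewrite /K; lra.
split=> //.
- by rewrite /C'; move: (C `^ r) Cr0 => z z0; lra.
- rewrite ge_min Prd orbT/= (le_trans PrC)// /C'; move: (C `^ r) Cr0 => z z0.
  lra.
- have PsK : dpow s f <= K by [].
  by rewrite ge_min Pd/= /C'; move: (C `^ r) Cr0 => z z0; lra.
- by move=> i; have := fC i; rewrite /C'; move: (C `^ r) Cr0 => z z0; lra.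
Qed.

Lemma continuous_powR_pos a (y : R) : 0 < y -> {for y, continuous (fun z : R => z `^ a)}.
Proof.
move=> y0; apply/differentiable_continuous/derivable1_diffP.
by apply: derivable_powR; rewrite in_itv/= y0.
Qed.

Lemma cvg_powR_pos (U : set_system nat) (UU : Filter U) (a : R) (e : nat -> R) (y : R) : 0 < y ->
  e n @[n --> U] --> y -> (e n) `^ a @[n --> U] --> y `^ a.
Proof.
move=> y0 h.
exact: (@cvg_comp _ _ _ e (fun z => z `^ a) _ _ _ h (continuous_powR_pos y0)).
Qed.

Lemma cvg_powR_ge0 (U : set_system nat) (UU : ProperFilter U) (a : R) (e : nat -> R) (y : R) : 0 < a ->
  (forall n, 0 <= e n) ->
  e n @[n --> U] --> y -> (e n) `^ a @[n --> U] --> y `^ a.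
Proof.
move=> a0 e0 h.
have y0 : 0 <= y by apply: (cvgr_to_ge h); exact: nearW.
have := @cvg_comp _ _ _ e (fun z => `|z| `^ a) _ _ _ h (normr_continuous_powR (y := y) a0).
rewrite (ger0_norm y0); apply: cvg_trans; apply: near_eq_cvg; apply: nearW => n /=.
by rewrite ger0_norm.
Qed.

Lemma cvg_bounded_near (U : set_system nat) (UU : Filter U) (e : nat -> R) (y : R) :
  e n @[n --> U] --> y -> \forall n \near U, `|e n| <= `|y| + 1.
Proof.
move=> /cvgrPdistC_lt /(_ 1 ltr01); apply: filterS => n h.
by have := ler_normD (e n - y) y; rewrite subrK; lra.
Qed.

Lemma gridcvg_cst (U : set_system nat) (UU : Filter U) (e : nat -> R) t y :
  e n @[n --> U] --> y -> @gridcvg R U (fun n _ => e n) t y.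
Proof.
move=> h A Ay; have := h A Ay; rewrite /nbhs/= => H.
by exists 1 => //; apply: filterS H.
Qed.

Lemma ler_dist_max (a x y : R) : `|Num.max x a - Num.max y a| <= `|x - y|.
Proof.
have [h1|h1] := leP x a; have [h2|h2] := leP y a; rewrite ?subrr ?normr0//.
- by rewrite !ler0_norm; lra.
- by rewrite !ger0_norm; lra.
Qed.

Section GridSolution.
Context {U : set_system nat} {UF : UltraFilter U}.
Hypothesis Uoo : \oo `<=` U.
Local Notation tp := (pi *+ 2 : R).

(* Extended by a constant to the left of -2 pi, so as to be continuous on the whole line. *)
Definition glim (Y : nat -> nat -> R) (x : R) : R := @grid_lim R U Y (Num.max x (- tp)).

Lemma glimP Y C : (\forall n \near U, `|Y n 0%N| <= C) ->
  (\forall n \near U, forall k, `|Y n k.+1 - Y n k| <= C * @step R n) ->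
  (forall t, - tp <= t -> @gridcvg R U Y t (glim Y t)) /\ continuous (glim Y).
Proof.
move=> Y0 Y1; split.
  by move=> t tt; rewrite /glim max_l//; exact: grid_limP Y0 Y1 _ tt.
have C0 : 0 <= C by have [n h] := filter_ex Y0; exact: le_trans h.
have C1 : 0 < C + 1 by rewrite ltr_wpDl.
move=> t; apply/cvgrPdistC_le => /= e e0; near=> s.
have lip : `|glim Y s - glim Y t| <= C * `|s - t|.
  apply: (@le_trans _ _ (C * `|Num.max s (- tp) - Num.max t (- tp)|)).
    by apply: (grid_lim_lipschitz Uoo Y0 Y1); rewrite le_max lexx orbT.
  by rewrite ler_wpM2l// ler_dist_max.
rewrite (le_trans lip)//.
have : `|s - t| < e / (C + 1) by near: s; apply: near_dist; rewrite divr_gt0.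
rewrite ltr_pdivlMr// => /ltW; apply: le_trans.
by rewrite mulrC ler_wpM2l// lerDl.
Unshelve. all: by end_near. Qed.

Lemma glim_derive (Y Z : nat -> nat -> R) C (z t : R) : - tp < t ->
  (\forall n \near U, `|Y n 0%N| <= C) ->
  (\forall n \near U, forall k, `|Y n k.+1 - Y n k| <= C * @step R n) ->
  @gridcvg R U Z t z ->
  (\forall n \near U, forall k, Y n k.+1 - Y n k = @step R n * Z n k) ->
  is_derive t 1 (glim Y) z.
Proof.
move=> tt Y0 Y1 hZ YZ; have [cY _] := glimP Y0 Y1.
apply: (@grid_lim_derive R U _ Uoo Y Z (glim Y) z t ((t + tp) / 2)) => //.
- by rewrite divr_gt0//; lra.
- lra.
- by move=> s; rewrite ltr_norml => /andP[h1 h2]; apply: cY; lra.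
Qed.

(** The indices of 0 and [tp] differ by exactly one period, so the two sequences agree before any
    limit is taken. *)
Lemma glim_period (f : forall n, 'I_n.+1 -> R) :
  glim (fun n => seqof (f n)) 0 = glim (fun n => seqof (f n)) tp.
Proof.
have tp0 := twopi_gt0 R.
rewrite /glim !max_l; [|lra|lra].
rewrite /grid_lim; suff -> : (fun n => seqof (f n) (grid_idx (0 : R) n)) =
  (fun n => seqof (f n) (grid_idx tp n)) by [].
by apply/funext => n; rewrite grid_idx_0 grid_idx_tp seqof_period.
Qed.

Lemma cvg_dmean (f : forall n, 'I_n.+1 -> R) (g : R -> R) (y : R -> R) C :
  continuous g -> continuous y ->
  (forall t, - tp <= t -> @gridcvg R U (fun n => seqof (f n)) t (y t)) ->
  (\forall n \near U, forall i, `|g (f n i)| <= C) ->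
  dmean (fun i => g (f n i)) @[n --> U] --> mean (fun x => g (y x)).
Proof.
move=> cg cy hy hC.
have -> : (fun n => dmean (fun i => g (f n i))) =
    (fun n => n.+1%:R^-1 * \sum_(n.+1 <= i < n.+1 + n.+1) g (seqof (f n) i)).
  by apply/funext => n; rewrite dmean_seqof.
apply: (@mean_grid_lim R U _ Uoo (fun n k => g (seqof (f n) k)) (fun x => g (y x)) C).
- by move=> x; apply: continuous_comp; [exact: cy|exact: cg].
- move=> t /andP[t0 _]; have tp0 := twopi_gt0 R.
  have tt : - tp <= t by lra.
  by apply: (@cvg_comp _ _ _ _ g _ _ _ (hy t tt)); exact: cg.
- by apply: filterS hC => n h k; exact: h.
Qed.

(** The discrete equation bounds the increments of the flux, a change of sign bounds the flux
    itself, and inverting the signed power bounds the slopes. The numbers [E], [Pr] and [Ps] are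
    first limits of discrete means along the ultrafilter, and are identified with the integrals of
    the limit functions afterwards. *)
Lemma discrete_limit p r s A eps eta :
  2 < p -> 1 < r -> r < s -> 2 < s -> 0 < A -> 0 <= eps -> 0 < eta ->
  (forall c : R, - (eta / 2) <= (`|c| `^ s) ^+ 2 - eps * c) ->
  (\forall n \near U, exists f : 'I_n.+1 -> R, dJ p r s A eps f <= - eta) ->
  exists u w : R -> R,
  let E := mean (fun x => `|spow (p - 1)^-1 (w x)| `^ p) in
  let Pr := mean (fun x => `|u x| `^ r) in
  let Ps := mean (fun x => `|u x| `^ s) in
  [/\ continuous u, continuous w & forall x, 0 <= u x] /\
  [/\ u 0 = u tp, w 0 = w tp, 0 < E, 0 < Pr & 0 < Ps] /\
  (forall x, - tp < x -> is_derive x 1 u (spow (p - 1)^-1 (w x))) /\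
  (forall x, - tp < x -> is_derive x 1 w (E `^ (1 - 2 / p) *
    (A * Pr `^ (2 / r - 1) * (u x) `^ (r - 1) -
     (A * Ps `^ (2 / s - 1) - s * Ps) * (u x) `^ (s - 1) - eps / 2))).
Proof.
move=> p2 r1 rs s2 A0 eps0 eta0 Hc Hneg.
have [C [d [C0 d0 hb]]] := dJ_neg_bounds p2 r1 rs s2 A0 eps0 eta0 Hc.
have p1 : 1 < p by lra.
have A0' : 0 <= A by lra.
have tp0 := twopi_gt0 R.
have [[r0 s0] p0] : (0 < r /\ 0 < s) /\ 0 < p by split; [split|]; lra.
pose f n := sval (cid2 (@dJ_min R p r s A eps n p1 r1 s2 A0' eps0)).
have f0 n i : 0 <= f n i by rewrite /f; case: cid2.
have fmin n (g : 'I_n.+1 -> R) : dJ p r s A eps (f n) <= dJ p r s A eps g by rewrite /f; case: cid2.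
pose En n := dpow p (dslope (f n)).
pose Prn n := dpow r (f n).
pose Psn n := dpow s (f n).
have Jn : \forall n \near U, dJ p r s A eps (f n) <= - eta.
  by apply: filterS Hneg => n [g hg]; exact: le_trans (fmin _ _) hg.
have Hb : \forall n \near U, [/\ 0 < En n, En n <= C,
    d <= Prn n <= C, d <= Psn n <= C & forall i, `|f n i| <= C].
  by apply: filterS Jn => n; exact: hb.
have cE : cvg (En n @[n --> U]).
  apply: (@ultra_bounded_cvg _ _ _ _ C); apply: filterS Hb => n [h1 h2 _ _ _].
  by rewrite gtr0_norm.
have cPr : cvg (Prn n @[n --> U]).
  apply: (@ultra_bounded_cvg _ _ _ _ C); apply: filterS Hb => n [_ _ /andP[h1 h2] _ _].
  by rewrite ger0_norm// dpow_ge0.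
have cPs : cvg (Psn n @[n --> U]).
  apply: (@ultra_bounded_cvg _ _ _ _ C); apply: filterS Hb => n [_ _ _ /andP[h1 h2] _].
  by rewrite ger0_norm// dpow_ge0.
set E := lim (En n @[n --> U]) in cE.
set Pr := lim (Prn n @[n --> U]) in cPr.
set Ps := lim (Psn n @[n --> U]) in cPs.
have Pr0 : 0 < Pr.
  apply: (lt_le_trans d0); apply: (cvgr_to_ge cPr).
  by apply: filterS Hb => n [_ _ /andP[]].
have Ps0 : 0 < Ps.
  apply: (lt_le_trans d0); apply: (cvgr_to_ge cPs).
  by apply: filterS Hb => n [_ _ _ /andP[]].
pose c1 n := En n `^ (1 - 2 / p) * (A * Prn n `^ (2 / r - 1)).
pose c2 n := En n `^ (1 - 2 / p) * (A * Psn n `^ (2 / s - 1) - s * Psn n).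
pose c3 n := En n `^ (1 - 2 / p) * (eps / 2).
(* The power is thus continuous at 0 too, so it converges although a vanishing limit energy is
   excluded only later. *)
have p2' : 0 < 1 - 2 / p by rewrite subr_gt0 ltr_pdivrMr//; lra.
have cE' : En n `^ (1 - 2 / p) @[n --> U] --> E `^ (1 - 2 / p).
  by apply: (cvg_powR_ge0 _ p2' _ cE) => n; exact: dpow_ge0.
have cc1 : c1 n @[n --> U] --> E `^ (1 - 2 / p) * (A * Pr `^ (2 / r - 1)).
  apply: cvgM; first exact: cE'.
  by apply: cvgM; [exact: cvg_cst|exact: cvg_powR_pos].
have cc2 : c2 n @[n --> U] --> E `^ (1 - 2 / p) * (A * Ps `^ (2 / s - 1) - s * Ps).
  apply: cvgM; first exact: cE'.
  apply: cvgB; last by apply: cvgM; [exact: cvg_cst|exact: cPs].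
  by apply: cvgM; [exact: cvg_cst|exact: cvg_powR_pos].
have cc3 : c3 n @[n --> U] --> E `^ (1 - 2 / p) * (eps / 2).
  by apply: cvgM; [exact: cE'|exact: cvg_cst].
pose X n := seqof (f n).
pose D n := seqof (dslope (f n)).
pose W n := seqof (fun i => spow (p - 1) (dslope (f n) i)).
pose Z n k := c1 n * (X n k.+1) `^ (r - 1) - c2 n * (X n k.+1) `^ (s - 1) - c3 n.
have X0 n k : 0 <= X n k by exact: f0.
have WS : \forall n \near U, forall k, W n k.+1 - W n k = @step R n * Z n k.
  apply: filterS Hb => n [E0 _ _ _ _] k.
  rewrite /W seqofS /seqof (dJ_euler p1 r1 s2 (f0 n) (fmin n) E0); congr (_ * _).
  rewrite /Z /c1 /c2 /c3 /En /Prn /Psn /X seqofS.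
  move: (_ `^ (1 - 2 / p)) (_ `^ (2 / r - 1)) (_ `^ (2 / s - 1)) => a1 a2 a3.
  move: (dpow s (f n)) (_ `^ (r - 1)) (_ `^ (s - 1)) => a4 a5 a6.
  by clear; ring.
have DW n k : D n k = spow (p - 1)^-1 (W n k).
  by rewrite /D /W /seqof spowK// gt_eqF//; lra.
have XS n k : X n k.+1 - X n k = @step R n * D n k by exact: seqof_dslope.
set B := (`|E `^ (1 - 2 / p) * (A * Pr `^ (2 / r - 1))| + 1) * C `^ (r - 1) +
  (`|E `^ (1 - 2 / p) * (A * Ps `^ (2 / s - 1) - s * Ps)| + 1) * C `^ (s - 1) +
  (`|E `^ (1 - 2 / p) * (eps / 2)| + 1).
have ZB : \forall n \near U, forall k, `|Z n k| <= B.
  have UU : Filter U by exact: _.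
  have b1 := cvg_bounded_near UU cc1; have b2 := cvg_bounded_near UU cc2.
  have b3 := cvg_bounded_near UU cc3.
  near=> n => k.
  have h1 : `|c1 n| <= `|E `^ (1 - 2 / p) * (A * Pr `^ (2 / r - 1))| + 1 by near: n.
  have h2 : `|c2 n| <= `|E `^ (1 - 2 / p) * (A * Ps `^ (2 / s - 1) - s * Ps)| + 1 by near: n.
  have h3 : `|c3 n| <= `|E `^ (1 - 2 / p) * (eps / 2)| + 1 by near: n.
  have [_ _ _ _ hf] : [/\ 0 < En n, En n <= C, d <= Prn n <= C, d <= Psn n <= C &
     forall i, `|f n i| <= C] by near: n.
  have XC a : 0 < a -> `|(X n k.+1) `^ a| <= C `^ a.
    move=> a0; rewrite ger0_norm ?powR_ge0//.
    apply: ge0_ler_powR; rewrite ?nnegrE ?(ltW a0) ?(ltW C0) ?X0//.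
    by apply: le_trans (hf _); exact: ler_norm.
  rewrite /Z /B (le_trans (ler_normB _ _))//; apply: lerD => //.
  have nm (x y x' y' : R) : `|x| <= x' -> `|y| <= y' -> `|x * y| <= x' * y'.
    by move=> ? ?; rewrite normrM; exact: ler_pM.
  rewrite (le_trans (ler_normB _ _))//; apply: lerD; apply: nm => //; apply: XC.
    by clear -r1; lra.
  by clear -s2; lra.
have B0 : 0 <= B by have [n h] := filter_ex ZB; exact: le_trans (h 0%N).
have WB : \forall n \near U, forall k, `|W n k| <= tp * B.
  apply: filterS2 ZB WS => n hZ hW.
  pose g i := spow (p - 1) (dslope (f n) i).
  have gB i : `|dslope g i| <= B.
    have h0 : step n != 0 :> R by rewrite gt_eqF// step_gt0.
    have := hW i; rewrite /W seqofS -/g /seqof modn_small// inord_val => e.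
    by rewrite /dslope e mulrAC mulfV// mul1r.
  have osc i j : `|g i - g j| <= tp * B.
    apply: (le_trans (seqof_osc g j i)); rewrite ler_pM2l//.
    by rewrite -[leRHS](dmean_cst n B); exact: dmean_le.
  (* The slopes of a periodic function have mean zero, so one is nonpositive and one nonnegative.
     The flux has the same signs there, and its oscillation then bounds it. *)
  have [i0 hi0] := dmean_exists_le (dslope (f n)).
  have [i1 hi1] := dmean_exists_le (fun i => - dslope (f n) i).
  rewrite dslope_sum0 in hi0.
  have hi1' : 0 <= dslope (f n) i1.
    rewrite -oppr_le0 (le_trans hi1)//.
    have -> : dmean (fun i => - dslope (f n) i) = - dmean (dslope (f n)).
      by rewrite /dmean sumrN mulrN.
    by rewrite dslope_sum0 oppr0.
  have g0 : g i0 <= 0 by rewrite -sgr_le0 sg_spow sgr_le0.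
  have g1 : 0 <= g i1 by rewrite -sgr_ge0 sg_spow sgr_ge0.
  move=> k; rewrite /W /seqof; set i := inord _; rewrite -[spow _ _]/(g i).
  have := osc i i0; have := osc i i1; rewrite !ler_norml.
  by move: (tp * B) (g i) (g i0) (g i1) g0 g1 => z a b c ? ? /andP[? ?] /andP[? ?]; apply/andP; split; lra.
set CD := (tp * B) `^ (p - 1)^-1.
have DB : \forall n \near U, forall k, `|D n k| <= CD.
  apply: filterS WB => n h k; rewrite DW norm_spow; last by rewrite invr_eq0 gt_eqF//; lra.
  apply: ge0_ler_powR; rewrite ?nnegrE ?mulr_ge0 ?(ltW tp0)//.
  by rewrite invr_ge0; lra.
set C2 := C + CD + tp * B + B.
have CD0 : 0 <= CD := powR_ge0 _ _.
have tB0 : 0 <= tp * B by rewrite mulr_ge0// ltW.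
have Xa : \forall n \near U, `|X n 0%N| <= C2.
  apply: filterS Hb => n [_ _ _ _ h]; apply: (le_trans (h _)).
  by rewrite /C2; move: (tp * B) tB0 => z z0; lra.
have Xb : \forall n \near U, forall k, `|X n k.+1 - X n k| <= C2 * @step R n.
  apply: filterS DB => n h k; rewrite XS normrM gtr0_norm ?step_gt0// mulrC.
  rewrite ler_pM2r ?step_gt0// (le_trans (h k))//.
  by rewrite /C2; move: (tp * B) tB0 => z z0; lra.
have Wa : \forall n \near U, `|W n 0%N| <= C2.
  apply: filterS WB => n h; apply: (le_trans (h _)).
  by rewrite /C2; move: (tp * B) tB0 => z z0; lra.
have Wb : \forall n \near U, forall k, `|W n k.+1 - W n k| <= C2 * @step R n.
  apply: filterS2 WS ZB => n hW h k; rewrite hW normrM gtr0_norm ?step_gt0// mulrC.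
  rewrite ler_pM2r ?step_gt0// (le_trans (h k))//.
  by rewrite /C2; move: (tp * B) tB0 => z z0; lra.
pose u := glim X; pose w := glim W.
have [uP cu] := glimP Xa Xb.
have [wP cw] := glimP Wa Wb.
have ip0 : 0 < (p - 1)^-1 by rewrite invr_gt0 subr_gt0.
pose du x := spow (p - 1)^-1 (w x).
have cdu : continuous du.
  by move=> x; apply: (@continuous_comp _ _ _ w (spow (p - 1)^-1)); [exact: cw|exact: continuous_spow].
have DP t : - tp <= t -> @gridcvg R U D t (du t).
  move=> tt; have -> : D = fun n k => spow (p - 1)^-1 (W n k).
    by apply/funext => n; apply/funext => k; rewrite DW.
  by apply: (@cvg_comp _ _ _ _ (spow (p - 1)^-1) _ _ _ (wP t tt)); exact: continuous_spow.
have u0 x : 0 <= u x.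
  have hy : - tp <= Num.max x (- tp) by rewrite le_max lexx orbT.
  have -> : u x = u (Num.max x (- tp)) by rewrite /u /glim -maxA maxxx.
  have l : X n (grid_idx (Num.max x (- tp)) n) @[n --> U] --> u (Num.max x (- tp)).
    by apply: gridcvg_idx => //; exact: uP.
  by apply: (cvgr_to_ge l); exact: nearW.
have XP a t : 0 < a -> - tp <= t ->
    @gridcvg R U (fun n k => (X n k.+1) `^ a) t ((u t) `^ a).
  move=> a0 tt; have -> : (fun n k => (X n k.+1) `^ a) = (fun n k => `|X n k.+1| `^ a).
    by apply/funext => n; apply/funext => k; rewrite ger0_norm.
  rewrite -{1}(ger0_norm (u0 t)).
  apply: (@cvg_comp _ _ _ _ (fun z : R => `|z| `^ a) _ _ _ (gridcvg_shift Uoo (uP t tt))).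
  exact: normr_continuous_powR.
have ZP t : - tp <= t -> @gridcvg R U Z t (E `^ (1 - 2 / p) *
    (A * Pr `^ (2 / r - 1) * (u t) `^ (r - 1) -
     (A * Ps `^ (2 / s - 1) - s * Ps) * (u t) `^ (s - 1) - eps / 2)).
  move=> tt.
  have -> : E `^ (1 - 2 / p) * (A * Pr `^ (2 / r - 1) * (u t) `^ (r - 1) -
     (A * Ps `^ (2 / s - 1) - s * Ps) * (u t) `^ (s - 1) - eps / 2) =
     E `^ (1 - 2 / p) * (A * Pr `^ (2 / r - 1)) * (u t) `^ (r - 1) -
     E `^ (1 - 2 / p) * (A * Ps `^ (2 / s - 1) - s * Ps) * (u t) `^ (s - 1) -
     E `^ (1 - 2 / p) * (eps / 2).
    move: (_ `^ (1 - 2 / p)) (_ `^ (2 / r - 1)) (_ `^ (2 / s - 1)) => a1 a2 a3.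
    move: (_ `^ (r - 1)) (_ `^ (s - 1)) (Ps) => a5 a6 a4.
    by clear; ring.
  have X1 : 0 < r - 1 by rewrite subr_gt0.
  have X2 : 0 < s - 1 by rewrite subr_gt0 (lt_trans r1).
  apply: cvgB; last exact: gridcvg_cst.
  by apply: cvgB; apply: cvgM; [exact: gridcvg_cst|exact: XP|exact: gridcvg_cst|exact: XP].
have du1 x : - tp < x -> is_derive x 1 u (du x).
  move=> xx; apply: (glim_derive xx Xa Xb (DP _ (ltW xx))).
  exact: nearW.
have dw1 x : - tp < x -> is_derive x 1 w (E `^ (1 - 2 / p) *
    (A * Pr `^ (2 / r - 1) * (u x) `^ (r - 1) -
     (A * Ps `^ (2 / s - 1) - s * Ps) * (u x) `^ (s - 1) - eps / 2)).
  by move=> xx; apply: (glim_derive xx Wa Wb (ZP _ (ltW xx))).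
have cpow a : 0 < a -> continuous (fun z : R => `|z| `^ a).
  by move=> a0 z; exact: normr_continuous_powR.
have mPr : Pr = mean (fun x => `|u x| `^ r).
  apply: cvg_lim => //.
  apply: (@cvg_dmean f (fun z => `|z| `^ r) u (C `^ r)) => //; first exact: cpow.
  apply: filterS Hb => n [_ _ _ _ h] i; rewrite ger0_norm ?powR_ge0//.
  by apply: ge0_ler_powR; rewrite ?nnegrE ?(ltW r0) ?(ltW C0).
have mPs : Ps = mean (fun x => `|u x| `^ s).
  apply: cvg_lim => //.
  apply: (@cvg_dmean f (fun z => `|z| `^ s) u (C `^ s)) => //; first exact: cpow.
  apply: filterS Hb => n [_ _ _ _ h] i; rewrite ger0_norm ?powR_ge0//.
  by apply: ge0_ler_powR; rewrite ?nnegrE ?(ltW s0) ?(ltW C0).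
have mE : E = mean (fun x => `|du x| `^ p).
  apply: cvg_lim => //.
  apply: (@cvg_dmean (fun n => dslope (f n)) (fun z => `|z| `^ p) du (CD `^ p)) => //.
    exact: cpow.
  apply: filterS DB => n h i; rewrite ger0_norm ?powR_ge0//.
  apply: ge0_ler_powR; rewrite ?nnegrE ?(ltW p0)//.
  by have := h (i : nat); rewrite /D seqof_ord.
have mM : dmean (f n) @[n --> U] --> mean u.
  apply: (@cvg_dmean f id u C) => //; first by move=> z; exact: cvg_id.
  by apply: filterS Hb => n [_ _ _ _ h].
(* If the energy tended to 0, so would the oscillation; [u] would be constant and [J] would tend to
   its value on that constant, at least [- eta / 2], although it stays below [- eta]. *)
have E0 : 0 < E.
  have Ege : 0 <= E by apply: (cvgr_to_ge cE); apply: nearW => n; exact: dpow_ge0.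
  rewrite lt_neqAle Ege andbT eq_sym; apply/eqP => Ez.
  have ip : 0 < p^-1 by rewrite invr_gt0.
  have uc t : - tp <= t -> u t = u 0.
    move=> tt; apply/eqP; rewrite -subr_eq0 -normr_le0.
    have t0 : - tp <= 0 by rewrite oppr_le0 ltW// twopi_gt0.
    have l1 : `|X n (grid_idx t n) - X n (grid_idx (0 : R) n)| @[n --> U] --> `|u t - u 0|.
      by apply: cvg_norm; apply: cvgB; apply: gridcvg_idx => //; exact: uP.
    have l2 : tp * En n `^ p^-1 @[n --> U] --> tp * E `^ p^-1.
      apply: cvgM; first exact: cvg_cst.
      by apply: (cvg_powR_ge0 _ ip _ cE) => n; exact: dpow_ge0.
    rewrite Ez powR0 ?gt_eqF// mulr0 in l2.
    apply: (ler_cvg_to l1 l2); apply: nearW => n.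
    rewrite (le_trans (seqof_osc _ _ _))// ler_pM2l//.
    have := dmean_jensen (fun i => `|dslope (f n) i|) p1.
    rewrite dpow_abs -/(En n) ger0_norm; last by apply: dmean_ge0.
    set m := dmean _ => hm.
    have m0 : 0 <= m by apply: dmean_ge0.
    have -> : m = (m `^ p) `^ p^-1 by rewrite -powRrM mulfV ?powRr1// gt_eqF.
    by apply: ge0_ler_powR; rewrite ?nnegrE ?powR_ge0 ?dpow_ge0// ltW.
  have ucst : u = fun=> u 0.
    apply/funext => t; have -> : u t = u (Num.max t (- tp)).
      by rewrite /u /glim -maxA maxxx.
    by apply: uc; rewrite le_max lexx orbT.
  have JE : dJ p r s A eps (f n) @[n --> U] -->
      E `^ (2 / p) + A * (Pr `^ (2 / r) - Ps `^ (2 / s)) + Ps ^+ 2 - eps * mean u.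
    apply: cvgB; last by apply: cvgM; [exact: cvg_cst|exact: mM].
    apply: cvgD; last by apply: cvgM; exact: cPs.
    apply: cvgD.
      have p20 : 0 < 2 / p by rewrite divr_gt0.
      by apply: (cvg_powR_ge0 _ p20 _ cE) => n; exact: dpow_ge0.
    apply: cvgM; first exact: cvg_cst.
    by apply: cvgB; exact: cvg_powR_pos.
  have JL : E `^ (2 / p) + A * (Pr `^ (2 / r) - Ps `^ (2 / s)) + Ps ^+ 2 -
      eps * mean u <= - eta by exact: (cvgr_to_le JE Jn).
  move: JL (Hc (u 0)) => {JE Jn}.
  rewrite mPr mPs ucst !mean_cst Ez powR0; last by rewrite gt_eqF// divr_gt0.
  rewrite -!powRrM !(mulrC _ (2 / _)) !divfK ?gt_eqF// subrr mulr0.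
  move: (_ `^ s ^+ 2) (eps * u 0) eta0 => z y h.
  by clear -h; lra.
exists u, w; split; first by split.
rewrite /= -/du -mE -mPr -mPs; split; last by split.
by split; [exact: (glim_period f)|exact: (glim_period (fun n i => spow (p - 1) (dslope (f n) i)))|exact: E0|exact: Pr0|exact: Ps0].
Unshelve. all: by end_near. Qed.

End GridSolution.
End DiscreteLimit.

(** * Primitives of integrable functions *)

Section Primitive.
Variable R : realType.
Local Notation tp := (pi *+ 2 : R).
Local Notation sg := (dsigma R).
Local Notation mu := (@lebesgue_measure R).
Implicit Types f g h : R -> R.

Lemma mem_itv (i : interval R) y : (y \in [set` i]) = (y \in i).
Proof. by apply/idP/idP; rewrite inE. Qed.

(** The Lebesgue integral of [h] over the part of the period to the left of [x]. The cut-off form is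
    defined on the whole line and suits Fubini's theorem; [tp] undoes the normalization of the
    measure. *)
Definition prim h x : R := tp * mean (fun y => h y * (y <= x)%R%:R).

Lemma meas_cut (x : R) : measurable_fun setT (fun y : R => (y <= x)%R%:R : R).
Proof.
have -> : (fun y : R => (y <= x)%R%:R : R) = \1_(`]-oo, x]).
  by apply/funext => y; rewrite indicE mem_itv in_itv.
exact: measurable_indic.
Qed.

Lemma integ_cut h (x : R) : integ h -> integ (fun y => h y * (y <= x)%R%:R).
Proof.
move=> ih; apply: (@integMb _ _ _ 1) => //; first exact: meas_cut.
by move=> y; case: (y <= x); rewrite /= ?normr1 ?normr0.
Qed.

Lemma prim_leb h x : integ h ->
  prim h x = \int[mu]_(y in `]-oo, x]) (h \_ `[0, tp]) y.
Proof.
move=> ih; have tp0 := twopi_gt0 R.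
rewrite /prim mean_leb; last exact: integ_cut.
rewrite mulVKf ?gt_eqF// Rintegral_mkcond [RHS]Rintegral_mkcond.
apply: eq_Rintegral => y _; rewrite !patchE !mem_itv !in_itv/=.
by case: (y <= x); case: ifP; rewrite ?mulr1 ?mulr0.
Qed.

Lemma integ_restrict h : integ h -> mu.-integrable setT (EFin \o (h \_ `[0, tp])).
Proof.
move=> ih; rewrite -restrict_EFin; apply/integrable_restrict => //=.
by rewrite setTI; apply/integP => //; exact: integ_meas.
Qed.

Lemma primB h x y : integ h ->
  prim h y - prim h x = tp * mean (fun z => h z * ((z <= y)%R%:R - (z <= x)%R%:R)).
Proof.
move=> ih; rewrite /prim -mulrBr -meanB; [|exact: integ_cut|exact: integ_cut].
by congr (_ * _); apply: eq_mean => z; rewrite mulrBr.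
Qed.

Lemma prim0 h x : integ h -> x <= 0 -> prim h x = 0.
Proof.
move=> ih x0; rewrite prim_leb// -Rintegral_itv_bndo_bndc; last first.
  by apply: integrableS (integ_restrict ih).
rewrite (@eq_Rintegral _ _ _ _ _ (fun=> 0)); first by rewrite /Rintegral integral0.
move=> y; rewrite mem_itv in_itv/= => yx; rewrite patchE mem_itv in_itv/= ifF//.
by apply/negbTE; rewrite negb_and -ltNge (lt_le_trans yx).
Qed.

Lemma prim_tp h x : integ h -> tp <= x -> prim h x = tp * mean h.
Proof.
move=> ih x0; rewrite /prim; congr (_ * _); apply: mean_ae.
- by apply: integ_meas; exact: integ_cut.
- exact: integ_meas.
apply: ae_imp (ae_circle R) => y; rewrite in_itv/= => /andP[_ y1].
by rewrite (le_trans y1)// mulr1.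
Qed.

Lemma prim_continuous h : integ h -> continuous (prim h).
Proof.
move=> ih x; have tp0 := twopi_gt0 R.
apply/cvgrPdist_lt => /= e e0.
have [d [d0 hd]] := integral_normr_continuous (integ_restrict ih) e0.
(* The interval [A] of this radius around [x] has length [d / 2 < d] and contains the support of the
   difference of the two cut-offs. *)
exists (d / 4) => /=; first by rewrite divr_gt0.
move=> y /= xy; pose A := `[x - d / 4, x + d / 4]%classic.
have mA : measurable A by exact: measurable_itv.
have lA : (mu A < d%:E)%E.
  rewrite /A lebesgue_measure_itv/= lte_fin ifT; last by lra.
  by rewrite lte_fin; lra.
apply: le_lt_trans (hd A mA lA).
rewrite distrC in xy; rewrite distrC primB// normrM gtr0_norm//.
have ih2 : integ (fun z => h z * ((z <= y)%R%:R - (z <= x)%R%:R)).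
  rewrite (_ : (fun z => _) = fun z => h z * (z <= y)%R%:R - h z * (z <= x)%R%:R).
    by apply: integB; exact: integ_cut.
  by apply/funext => z; rewrite mulrBr.
have ih3 : integ (fun z => `|h z| * \1_A z).
  apply: (@integMb _ _ _ 1); [exact: integ_norm|exact: measurable_indic|].
  by move=> z; rewrite indicE; case: (z \in A); rewrite /= ?normr1 ?normr0.
have -> : \int[mu]_(z in A) `|(h \_ `[0, tp]) z| = tp * mean (fun z => `|h z| * \1_A z).
  rewrite mean_leb// mulVKf ?gt_eqF// Rintegral_mkcond [RHS]Rintegral_mkcond.
  apply: eq_Rintegral => z _; rewrite !patchE indicE.
  by case: (z \in A); case: ifP; rewrite ?mulr1 ?mulr0 ?normr0.
rewrite ler_pM2l// (le_trans (mean_norm ih2))//.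
apply: mean_le => //; first exact: integ_norm.
apply: aeW => z; rewrite normrM ler_wpM2l// indicE mem_itv in_itv/=.
move: xy; rewrite ltr_distl => /andP[].
by case: (lerP z y); case: (lerP z x); case: (lerP (x - d / 4) z); case: (lerP z (x + d / 4)) => //=;
  rewrite ?subrr ?subr0 ?sub0r ?normrN ?normr1 ?normr0//; lra.
Qed.

Lemma prim_ae_derive h : integ h ->
  {ae mu, forall x, 0 < x < tp -> is_derive x 1 (prim h) (h x)}.
Proof.
move=> ih; have ir := integ_restrict ih.
have lr : locally_integrable setT (h \_ `[0, tp]).
  by apply: open_integrable_locally => //; exact: openT.
have iy y : mu.-integrable `]-oo, y] (EFin \o (h \_ `[0, tp])).
  by apply: integrableS ir.
have := FTC1Ny iy lr.
have -> : (fun x => \int[mu]_(t in `]-oo, x]) (h \_ `[0, tp]) t) = prim h.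
  by apply/funext => x; rewrite prim_leb.
move=> /=; apply: (@filterS _ _ (ae_filter_ringOfSetsType mu)) => x [d1 d2] x01.
split; first exact: d1.
rewrite -derive1E d2 patchE mem_itv ifT// in_itv/=.
by move: x01 => /andP[/ltW -> /ltW ->].
Qed.

(** The dominating [g] gives integrability on the product by Tonelli's theorem, and Fubini's theorem
    applies. *)
Lemma mean_swap (F : R -> R -> R) g : measurable_fun setT (fun z : R * R => F z.1 z.2) ->
  (forall x, integ (F x)) -> (forall y, integ (F ^~ y)) -> integ g ->
  (forall y, mean (fun x => `|F x y|) <= g y) ->
  mean (fun x => mean (F x)) = mean (fun y => mean (F ^~ y)) /\
  measurable_fun setT (fun y => mean (F ^~ y)).
Proof.
move=> mF i1 i2 ig hg.
have m1 x : (mean (F x))%:E = (\int[sg]_y (F x y)%:E)%E.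
  by rewrite /mean /Rintegral fineK//; apply: integrable_fin_num => //; exact: i1.
have m2 y : (mean (F ^~ y))%:E = (\int[sg]_x (F x y)%:E)%E.
  by rewrite /mean /Rintegral fineK//; apply: integrable_fin_num => //; exact: i2.
have mF' : measurable_fun setT (fun z : R * R => (F z.1 z.2)%:E) by exact/measurable_EFinP.
suff iF : (sg \x sg)%E.-integrable setT (fun z : R * R => (F z.1 z.2)%:E).
  split.
    rewrite [LHS]/mean [RHS]/mean /Rintegral.
    under eq_integral do rewrite m1.
    under [in RHS]eq_integral do rewrite m2.
    by congr fine; exact: (Fubini iF).
  apply/measurable_EFinP; have := measurable_fubini_G iF; congr (measurable_fun _ _).
  by apply/funext => y /=; rewrite m2.
apply/integrable21ltyP => //.
have /integrableP[_] := ig; apply: le_lt_trans; apply: ge0_le_integral => //.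
- by move=> y _; apply: integral_ge0.
- apply: (@measurable_fun_fubini_tonelli_G _ _ _ _ _ sg (fun z => `|(F z.1 z.2)%:E|%E)) => //.
  exact: measurableT_comp.
- by apply: measurableT_comp => //; apply/measurable_EFinP; exact: integ_meas.
- move=> y _ /=; have -> : (\int[sg]_x `|F x y|%:E)%E = (mean (fun x => `|F x y|))%:E.
    by rewrite /mean /Rintegral fineK//; apply: integrable_fin_num => //; apply: integ_norm.
  by rewrite lee_fin (le_trans (hg y))// ler_norm.
Qed.

Lemma continuous_le_circle f : continuous f ->
  exists M : R, forall x, x \in `[0, tp] -> `|f x| <= M.
Proof.
move=> cf.
have cn : {within `[0, tp], continuous (fun x => `|f x|)}.
  by apply: continuous_subspaceT => x; apply: cvg_norm; exact: cf.
have [c _ hc] := EVT_max (ltW (twopi_gt0 R)) cn.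
by exists `|f c|.
Qed.

(** Continuity bounds [f] on the period alone, so [f] is clipped at that bound, which changes it
    only on a null set. *)
Lemma integMc h f : integ h -> continuous f -> integ (fun x => h x * f x).
Proof.
move=> ih cf; have [M hM] := continuous_le_circle cf.
have tp0 := twopi_gt0 R.
have mf := continuous_meas cf.
have h1 : integ (fun x => h x * Num.max (- M) (Num.min M (f x))).
  apply: (@integMb _ _ _ `|M|) => //.
    by apply: measurable_maxr => //; exact: measurable_minr.
  move=> x; rewrite ler_norml; have := ler_norm M; have := ler_norm (- M); rewrite normrN.
  move=> a b; rewrite le_max ge_max ge_min b a/= andbT.
  by case: (lerP M (f x)) => _; lra.
apply: integ_ae h1.
  by apply: measurable_funM => //; exact: integ_meas.
apply: ae_imp (ae_circle R) => x /hM; rewrite ler_norml => /andP[a b].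
by rewrite min_r// max_r.
Qed.

Lemma mean_cut (y : R) (phi dphi : R -> R) : continuous dphi ->
  (forall x : R, is_derive x 1 phi (dphi x)) -> 0 <= y <= tp ->
  tp * mean (fun x => dphi x * (y <= x)%R%:R) = phi tp - phi y.
Proof.
move=> cd dp /andP[y0 y1]; have tp0 := twopi_gt0 R.
have mc : measurable_fun setT (fun x : R => (y <= x)%R%:R : R).
  rewrite (_ : (fun x => _) = \1_(`[y, +oo[)); first exact: measurable_indic.
  by apply/funext => x; rewrite indicE mem_itv in_itv/= andbT.
have ic : integ (fun x => dphi x * (y <= x)%R%:R).
  apply: (@integMb _ _ _ 1) => //; first exact: integ_continuous.
  by move=> x; case: (y <= x); rewrite /= ?normr1 ?normr0.
rewrite mean_leb// mulVKf ?gt_eqF//.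
have -> : \int[mu]_(x in `[0, tp]) (dphi x * (y <= x)%R%:R) = \int[mu]_(x in `[y, tp]) dphi x.
  rewrite Rintegral_mkcond [RHS]Rintegral_mkcond.
  apply: eq_Rintegral => x _; rewrite !patchE !mem_itv !in_itv/=.
  have [yx|yx] := lerP y x; last by rewrite mulr0 if_same.
  by rewrite (le_trans y0 yx) mulr1.
move: y1; rewrite le_eqVlt => /orP[/eqP ->|y1].
  by rewrite set_itv1 Rintegral_set1 subrr.
rewrite (@is_derive_FTC2 _ phi)//; exact: continuous_subspaceT.
Qed.

(* Fubini on [y <= x], since the product rule is not available for the merely
   absolutely continuous [prim h]. *)
Lemma prim_parts h (phi dphi : R -> R) : integ h -> continuous dphi ->
  (forall x : R, is_derive x 1 phi (dphi x)) ->
  mean (fun x => prim h x * dphi x) = mean h * phi tp - mean (fun x => h x * phi x).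
Proof.
move=> ih cd dp; have tp0 := twopi_gt0 R.
have cphi : continuous phi.
  by move=> x; apply/differentiable_continuous/derivable1_diffP; case: (dp x).
have id := integ_continuous cd.
have ihphi := integMc ih cphi.
have i1 x : integ (fun y => tp * (h y * (y <= x)%R%:R * dphi x)).
  apply: integZ; rewrite (_ : (fun y => _) = fun y => dphi x * (h y * (y <= x)%R%:R)).
    by apply: integZ; exact: integ_cut.
  by apply/funext => y; rewrite mulrC.
have mc (y : R) : measurable_fun setT (fun x : R => (y <= x)%R%:R : R).
  rewrite (_ : (fun x => _) = \1_(`[y, +oo[)); first exact: measurable_indic.
  by apply/funext => x; rewrite indicE mem_itv in_itv/= andbT.
have i3 y : integ (fun x => dphi x * (y <= x)%R%:R).
  apply: (@integMb _ _ _ 1) => //.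
  by move=> x; case: (y <= x); rewrite /= ?normr1 ?normr0.
have E2 y x : tp * (h y * (y <= x)%R%:R * dphi x) = (h y * tp) * (dphi x * (y <= x)%R%:R).
  by move: (_%:R) => z; ring.
have i2 y : integ (fun x => tp * (h y * (y <= x)%R%:R * dphi x)).
  by under [X in integ X]eq_fun do rewrite E2; exact: integZ.
transitivity (mean (fun x => mean (fun y => tp * (h y * (y <= x)%R%:R * dphi x)))).
  apply: eq_mean => x; rewrite /prim.
  rewrite (_ : (fun y => tp * _) = fun y => (tp * dphi x) * (h y * (y <= x)%R%:R)); last first.
    by apply/funext => y; move: (_%:R) => z; ring.
  by rewrite meanZ; [rewrite mulrAC|exact: integ_cut].
have [|||-> iG] := @mean_swap (fun x y => tp * (h y * (y <= x)%R%:R * dphi x))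
  (fun y => (tp * mean (fun x => `|dphi x|)) * `|h y|) _ i1 i2 _ _.
- apply: measurable_funM => //; apply: measurable_funM; last first.
    by apply: measurableT_comp => //; exact: integ_meas.
  apply: measurable_funM; first by apply: measurableT_comp => //; exact: integ_meas.
  rewrite (_ : (fun z => _) = fun z : R * R => if z.2 <= z.1 then 1 else 0); last first.
    by apply/funext => z; case: (z.2 <= z.1).
  apply: measurable_fun_ifT => //.
  exact: measurable_fun_ler.
- by apply: integZ; exact: integ_norm.
- move=> y; under [X in mean X]eq_fun do rewrite E2 normrM.
  rewrite meanZ; last exact: integ_norm.
  rewrite (normrM (h y)) (gtr0_norm tp0) (mulrC (`|h y|)) mulrAC ler_wpM2r//.
  apply: ler_wpM2l; first exact: ltW.
  apply: mean_le; [exact: integ_norm|exact: integ_norm|].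
  apply: aeW => x; rewrite normrM; case: (y <= x); rewrite /= ?normr1 ?normr0 ?mulr1 ?mulr0//.
- rewrite (@mean_ae _ _ (fun y => phi tp * h y - h y * phi y)).
  + by rewrite meanB// ?meanZ// 1?mulrC//; exact: integZ.
  + exact: iG.
  + apply: measurable_funB; last exact: integ_meas.
    by apply: integ_meas; exact: integZ.
  + apply: ae_imp (ae_circle R) => y; rewrite in_itv/= => y01.
    under [X in mean X]eq_fun do rewrite E2.
    by rewrite meanZ// -mulrA (@mean_cut _ phi)// mulrBr mulrC.
Qed.

End Primitive.

(** * Uniqueness of Fourier coefficients for continuous functions *)

Section Trigonometric.
Variable R : realType.
Local Notation tp := (pi *+ 2 : R).
Implicit Types f g h : R -> R.

Lemma cos_le_cos (d y : R) : 0 <= d <= pi -> d <= `|y| <= tp - d -> cos y <= cos d.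
Proof.
move=> d01 /andP[y1 y2]; rewrite -(cos_norm y).
have [ypi|ypi] := lerP `|y| pi.
  rewrite le_eqVlt; have [->|n] := eqVneq `|y| d; first by rewrite eqxx.
  apply/orP; right; rewrite ltr_cos ?in_itv//=; last by rewrite normr_ge0 ypi.
  by rewrite lt_neqAle eq_sym n.
have -> : cos `|y| = cos (tp - `|y|) by rewrite cosB cos2pi sin2pi mul1r mul0r addr0.
have h : d <= tp - `|y| by lra.
have [->//|n] := eqVneq (tp - `|y|) d.
apply: ltW; rewrite ltr_cos ?in_itv//=; first by rewrite lt_neqAle eq_sym n.
have -> : tp = pi + pi :> R by rewrite mulr2n.
by apply/andP; split; rewrite mulr2n in y2; lra.
Qed.

Lemma mulr_cos (a b : R) : cos a * cos b = (cos (a + b) + cos (a - b)) / 2.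
Proof. by rewrite cosD cosB; field. Qed.

Let lincomb (f c a b a1 a2 y : R) : a * b = (a1 + a2) / 2 ->
  f * (a * ((c + b) * y)) = c * (f * (a * y)) + (2^-1 * (f * (a1 * y)) + 2^-1 * (f * (a2 * y))).
Proof.
move=> h; have -> : f * (a * ((c + b) * y)) = c * (f * (a * y)) + f * (a * b) * y by ring.
by rewrite h; field.
Qed.

Lemma is_derive_sinl (k t x : R) :
  is_derive x 1 (fun y : R => sin (k * y + t)) (k * cos (k * x + t)).
Proof. by apply: is_derive_eq; rewrite /GRing.scale/= !(mulr1, mulr0, addr0) mulrC. Qed.

Lemma is_derive_cosl (k t x : R) :
  is_derive x 1 (fun y : R => cos (k * y + t)) (- (k * sin (k * x + t))).
Proof. by apply: is_derive_eq; rewrite /GRing.scale/= !(mulr1, mulr0, addr0) mulNr mulrC. Qed.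

Lemma continuous_cosl (k t : R) : continuous (fun x : R => cos (k * x + t)).
Proof.
move=> x; apply: (@continuous_comp _ _ _ (fun x => k * x + t) cos); last exact: continuous_cos.
by apply: cvgD; [apply: cvgM; [exact: cvg_cst|exact: cvg_id]|exact: cvg_cst].
Qed.

Let continuous_kernel (c x0 : R) n : continuous (fun x : R => (c + cos (x - x0)) ^+ n).
Proof.
move=> x; apply: (@continuous_comp _ _ _ (fun x => c + cos (x - x0)) (fun y => y ^+ n)); last first.
  exact: exprn_continuous.
apply: cvgD; first exact: cvg_cst.
have := @continuous_cosl 1 (- x0) x; under eq_fun do rewrite mul1r.
by move=> h; exact: h.
Qed.

(** The product formula turns a factor [cos (x - x0)] into the neighbouring frequencies [k + 1] and
    [k - 1]. Orthogonality for all frequencies and phases is therefore stable under raising [n]. *)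
Lemma mean_cos_pow f (x0 c : R) : continuous f ->
  (forall k t, mean (fun x => f x * cos (k.+1%:R * x + t)) = 0) -> mean f = 0 ->
  forall n k t, mean (fun x => f x * (cos (k%:R * x + t) * (c + cos (x - x0)) ^+ n)) = 0.
Proof.
move=> cf f1 f0.
have cQ n k t : continuous (fun x : R => f x * (cos (k%:R * x + t) * (c + cos (x - x0)) ^+ n)).
  by move=> x; apply: cvgM; [exact: cf|apply: cvgM; [exact: continuous_cosl|exact: continuous_kernel]].
elim=> [|n IH] k t.
  under [X in mean X]eq_fun do rewrite expr0 mulr1.
  case: k => [|k]; last exact: f1.
  under [X in mean X]eq_fun do rewrite mul0r add0r mulrC.
  by rewrite meanZ ?f0 ?mulr0//; exact: integ_continuous.
have E x : f x * (cos (k%:R * x + t) * (c + cos (x - x0)) ^+ n.+1) =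
  c * (f x * (cos (k%:R * x + t) * (c + cos (x - x0)) ^+ n)) +
  (2^-1 * (f x * (cos (k.+1%:R * x + (t - x0)) * (c + cos (x - x0)) ^+ n)) +
   2^-1 * (f x * (cos (k%:R * x + t - (x - x0)) * (c + cos (x - x0)) ^+ n))).
  have -> : k.+1%:R * x + (t - x0) = k%:R * x + t + (x - x0) by rewrite -natr1; ring.
  rewrite exprS; have := mulr_cos (k%:R * x + t) (x - x0).
  exact: lincomb.
under [X in mean X]eq_fun do rewrite E.
have h3 : mean (fun x => f x * (cos (k%:R * x + t - (x - x0)) * (c + cos (x - x0)) ^+ n)) = 0.
  (* For [k = 0] the frequency [- 1] is folded onto 1 by the evenness of the cosine. *)
  case: k {E} => [|k].
    rewrite -(IH 1%N (- t - x0)); apply: eq_mean => x; congr (_ * (_ * _)).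
    by rewrite -cosN; congr cos; ring.
  rewrite -(IH k (t + x0)); apply: eq_mean => x; congr (_ * (cos _ * _)).
  by rewrite -natr1; ring.
have i n' k' t' := integ_continuous (cQ n' k' t').
have i3 : integ (fun x => f x * (cos (k%:R * x + t - (x - x0)) * (c + cos (x - x0)) ^+ n)).
  apply: integ_continuous => x; apply: cvgM; first exact: cf.
  apply: cvgM; last exact: continuous_kernel.
  have := @continuous_cosl (k%:R - 1) (t + x0) x.
  rewrite /continuous_at; have e y : k%:R * y + t - (y - x0) = (k%:R - 1) * y + (t + x0) by ring.
  by under [X in X @ _ --> _ -> _]eq_fun do rewrite -e; rewrite -e.
rewrite meanD; [|exact: integZ|by apply: integD; exact: integZ].
rewrite meanD; [|exact: integZ|exact: integZ].
by rewrite !meanZ// h3 !IH !mulr0 !addr0.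
Qed.

Lemma integ_indic (a b : R) : integ (\1_(`[a, b]) : R -> R).
Proof.
apply: (@integ_le _ _ (fun=> 1)); [exact: measurable_indic| |exact: integ_cst].
by move=> x; rewrite indicE; case: (x \in _); rewrite /= ?normr1 ?normr0.
Qed.

Lemma mean_indic_pos (a b : R) : 0 <= a -> a < b -> b <= tp ->
  0 < mean (\1_(`[a, b])).
Proof.
move=> a0 ab b1; have tp0 := twopi_gt0 R.
have i := integ_indic a b.
rewrite mean_leb// mulr_gt0 ?invr_gt0// /Rintegral integral_indic//.
rewrite setIidl; last by apply: subset_itv; rewrite bnd_simp.
have := lebesgue_measure_itv `[a, b]; rewrite /= lte_fin ab => h.
by rewrite [X in fine X]h /= subr_gt0.
Qed.

Lemma bernoulli (x : R) n : 1 <= x -> 1 + n%:R * (x - 1) <= x ^+ n.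
Proof.
move=> x1; elim: n => [|n IH]; first by rewrite mul0r addr0 expr0.
rewrite exprS -natr1; apply: le_trans (ler_wpM2l _ IH); last by lra.
have : 0 <= n%:R * (x - 1) ^+ 2 by rewrite mulr_ge0// sqr_ge0.
by nra.
Qed.

(** For [c = 1 - cos d] the powers of [c + cos (x - x0)] concentrate at [x0]: the base is at most 1
    in absolute value farther than [d] from [x0], at least 1 within [d], and at least [rho > 1]
    within [d / 2]. The part near [x0], where [f] is positive, grows without bound, while the rest
    stays above [- M]. *)
Lemma mean_kernel_pos f (x0 : R) : continuous f -> 0 < x0 < tp -> 0 < f x0 ->
  (forall c n, mean (fun x => f x * (c + cos (x - x0)) ^+ n) = 0) -> False.
Proof.
move=> cf /andP[x00 x01] fx0 hm; have tp0 := twopi_gt0 R.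
have [M hM] := continuous_le_circle cf.
have pi0 := pi_gt0 R.
have [d [d0 dpi dx0 dx1 hd]] : exists d, [/\ 0 < d, d < pi, d < x0, d < tp - x0 &
    forall x, `|x - x0| <= d -> f x0 / 2 <= f x].
  have /cvgrPdist_lt/(_ (f x0 / 2)) h := cf x0.
  have [|e /= e0 he] := h _; first by rewrite divr_gt0.
  (* [d < pi] serves the monotonicity of the cosine. The last two bounds keep the neighbourhood
     inside the period, so points outside it are at distance at least [d] also modulo [2 pi]. *)
  exists (Num.min (e / 2) (Num.min (pi / 2) (Num.min (x0 / 2) ((tp - x0) / 2)))).
  rewrite !lt_min !gt_min; split.
  - by rewrite !divr_gt0// subr_gt0.
  - by apply/orP; right; apply/orP; left; lra.
  - by apply/orP; right; apply/orP; right; apply/orP; left; lra.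
  - by apply/orP; right; apply/orP; right; apply/orP; right; lra.
  - move=> x; rewrite le_min => /andP[h1 _].
    have /= := he x; rewrite distrC => /(_ _)/wrap[]; first by lra.
    by rewrite ltr_distl => /andP[]; lra.
pose c : R := 1 - cos d.
pose rho := c + cos (d / 2).
have rho1 : 1 < rho.
  rewrite /rho /c; suff : cos d < cos (d / 2) by lra.
  by rewrite ltr_cos ?in_itv/=; lra.
pose J := `[x0 - d / 2, x0 + d / 2]%classic.
have m0 : 0 < mean (\1_J) by apply: mean_indic_pos; lra.
have iJ : integ (\1_J : R -> R) := integ_indic _ _.
have M0 : 0 <= M by apply: le_trans (hM 0 _); rewrite ?normr_ge0 ?in_itv/= ?lexx ?(ltW tp0).
have key n : (f x0 / 2 * rho ^+ n) * mean (\1_J) - M <= 0.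
  rewrite -(hm c n) -meanZ// -[X in _ - X](mean_cst M) -meanB; last 2 first.
  - exact: integZ.
  - exact: integ_cst.
  apply: mean_le.
  - by apply: integB; [exact: integZ|exact: integ_cst].
  - by apply: integ_continuous => x; apply: cvgM; [exact: cf|exact: continuous_kernel].
  apply: ae_imp (ae_circle R) => x x01'.
  have fM := hM x x01'; move: x01'; rewrite in_itv/= => /andP[xa xb].
  set Q := c + cos (x - x0).
  have [xd|xd] := lerP `|x - x0| d.
    have fx := hd x xd.
    have Q1 : 1 <= Q.
      rewrite /Q /c; suff : cos d <= cos (x - x0) by lra.
      rewrite -(cos_norm (x - x0)); have [->//|n0] := eqVneq `|x - x0| d.
      apply: ltW; rewrite ltr_cos ?in_itv/= ?normr_ge0/=; last 2 first.
      + lra.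
      + lra.
      by rewrite lt_neqAle n0.
    rewrite indicE /J mem_itv in_itv/=; case: (boolP (_ && _)) => [/andP[j1 j2]|_].
      have Qr : rho <= Q.
        rewrite /rho /Q; suff : cos (d / 2) <= cos (x - x0) by lra.
        have xd2 : `|x - x0| <= d / 2 by rewrite ler_norml; lra.
        rewrite -(cos_norm (x - x0)); have [->//|n0] := eqVneq `|x - x0| (d / 2).
        apply: ltW; rewrite ltr_cos ?in_itv/= ?normr_ge0/=; last 2 first.
        + lra.
        + lra.
        by rewrite lt_neqAle n0.
      have Qn : rho ^+ n <= Q ^+ n by apply: lerXn2r; rewrite ?nnegrE//; lra.
      rewrite mulr1.
      have Qn0 : 0 <= Q ^+ n by apply: exprn_ge0; lra.
      have r0 : 0 <= rho ^+ n by apply: exprn_ge0; lra.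
      have := ler_pM (ltW (divr_gt0 fx0 (ltr0Sn R 1))) r0 fx Qn.
      by move: (_ * _ ^+ n) (_ * _ ^+ n) => u v; lra.
    rewrite mulr0 sub0r; apply: (@le_trans _ _ 0); first by lra.
    by rewrite mulr_ge0//; [lra|apply: exprn_ge0; lra].
  rewrite indicE /J mem_itv in_itv/=; case: (boolP (_ && _)) => [/andP[j1 j2]|_].
    by move: xd; rewrite ltNge ler_norml; lra.
  rewrite mulr0 sub0r.
  have Q1 : `|Q| <= 1.
    have h1 : cos (x - x0) <= cos d.
      apply: cos_le_cos; first by lra.
      rewrite (ltW xd)/= ler_norml; lra.
    rewrite ler_norml /Q /c.
    by have := cos_geN1 (x - x0); have := cos_le1 d; lra.
  have h : `|f x * Q ^+ n| <= M.
    rewrite normrM normrX -[M]mulr1 ler_pM//.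
    by apply: exprn_ile1.
  by move: h; rewrite ler_norml => /andP[].
pose K := f x0 / 2 * mean (\1_J).
have K0 : 0 < K by rewrite mulr_gt0// divr_gt0.
(* By Bernoulli's inequality this exponent already gives [K * rho ^ n > M]. *)
pose n := (Num.truncn (M / (K * (rho - 1)))).+1.
have := key n.
have h1 := @bernoulli rho n (ltW rho1).
have h2 : M / (K * (rho - 1)) < n%:R by exact: truncnS_gt.
have r1 : 0 < K * (rho - 1) by rewrite mulr_gt0// subr_gt0.
rewrite ltr_pdivrMr// in h2.
rewrite mulrAC -/K; have := ler_wpM2l (ltW K0) h1.
rewrite mulrDr mulr1 mulrCA; move: h2 K0.
by clear; move: (n%:R * _) (K * rho ^+ n) => y z; lra.
Qed.

Lemma mean_cosl k (t : R) : mean (fun x : R => cos (k.+1%:R * x + t)) = 0.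
Proof.
have dF (x : R) : x \in `[0, tp] ->
    is_derive x 1 (fun x => k.+1%:R^-1 * sin (k.+1%:R * x + t)) (cos (k.+1%:R * x + t)).
  move=> _; have k0 : (k.+1%:R : R) != 0 by rewrite pnatr_eq0.
  have := is_deriveZ (k.+1%:R^-1) (is_derive_sinl k.+1%:R t x).
  by rewrite scalerA mulVf// scale1r.
rewrite (mean_FTC2 (@continuous_cosl _ _) dF).
have e : sin (k.+1%:R * tp + t) = sin t.
  by rewrite mulr_natl addrC (periodicn (@sinD2pi R)).
by rewrite e mulr0 add0r subrr mulr0.
Qed.

(** The kernel argument for [f - mean f] and for its opposite. Arbitrary phases [t] include the
    sines. *)
Lemma fourier_unique f : continuous f ->
  (forall k t, mean (fun x => f x * cos (k.+1%:R * x + t)) = 0) ->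
  forall x, 0 < x < tp -> f x = mean f.
Proof.
move=> cf f1 x0 x01.
have mc k t := mean_cosl k t.
have main (g : R -> R) : continuous g -> mean g = 0 ->
    (forall k t, mean (fun x => g x * cos (k.+1%:R * x + t)) = 0) -> g x0 <= 0.
  move=> cg g0 g1; rewrite leNgt; apply/negP => gx0.
  apply: (mean_kernel_pos cg x01 gx0) => c n.
  rewrite -(@mean_cos_pow g x0 c cg g1 g0 n 0 0).
  by apply: eq_mean => x; rewrite mul0r add0r cos0 mul1r.
have ic k t := integ_continuous (@continuous_cosl k t).
have ifc k t : integ (fun x => f x * cos (k * x + t)).
  by apply: integ_continuous => x; apply: cvgM; [exact: cf|exact: continuous_cosl].
have icf := integ_continuous cf.
have ha : f x0 - mean f <= 0.
  apply: (main (fun x => f x - mean f)).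
  - by move=> x; apply: cvgB; [exact: cf|exact: cvg_cst].
  - by rewrite meanB// ?mean_cst ?subrr//; exact: integ_cst.
  - move=> k t; under [X in mean X]eq_fun do rewrite mulrBl.
    by rewrite meanB// ?meanZ// ?mc ?f1 ?mulr0 ?subr0//; exact: integZ.
have hb : mean f - f x0 <= 0.
  apply: (main (fun x => mean f - f x)).
  - by move=> x; apply: cvgB; [exact: cvg_cst|exact: cf].
  - by rewrite meanB// ?mean_cst ?subrr//; exact: integ_cst.
  - move=> k t; under [X in mean X]eq_fun do rewrite mulrBl.
    by rewrite meanB// ?meanZ// ?mc ?f1 ?mulr0 ?subr0//; exact: integZ.
by lra.
Qed.

End Trigonometric.

(** * Sobolev functions on the circle and Rayleigh quotients *)

Section Sobolev.
Variable R : realType.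
Local Notation tp := (pi *+ 2 : R).
Local Notation sg := (dsigma R).
Implicit Types f g h u v du dv : R -> R.

(** Differentiation stays inside this family, shifting the phase by [pi / 2], which settles all
    orders by one induction. *)
Lemma test_cosl (c : R) k (t : R) : circle_test_function (fun x => c * cos (k%:R * x + t)).
Proof.
split.
  move=> x; congr (_ * _).
  have -> : k%:R * (x + tp) + t = k%:R * x + t + tp *+ k.
    by rewrite mulrDr [k%:R * tp]mulr_natl addrAC.
  by rewrite (periodicn (@cosD2pi R)).
have D (c' t' x : R) : is_derive x 1 (fun x : R => c' * cos (k%:R * x + t'))
    (c' * k%:R * cos (k%:R * x + (t' + pi / 2))).
  have -> : c' * k%:R * cos (k%:R * x + (t' + pi / 2)) =
      c' *: (- (k%:R * sin (k%:R * x + t'))) :> R.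
    by rewrite addrA cosDpihalf /GRing.scale/= !mulrN mulrA.
  exact: (is_deriveZ c' (is_derive_cosl k%:R t' x)).
move=> n x; have [c' [t' ->]] : exists c' t',
    derive1n n (fun x => c * cos (k%:R * x + t)) = fun x => c' * cos (k%:R * x + t').
  elim: n => [|n [c' [t' IH]]]; first by exists c, t.
  exists (c' * k%:R), (t' + pi / 2); rewrite derive1nS IH.
  by apply/funext => y; rewrite derive1E; have [_ ->] := D c' t' y.
by have [] := D c' t' x.
Qed.

Lemma test_is_derive (phi : R -> R) (x : R) : circle_test_function phi ->
  is_derive x 1 phi (derive1 phi x).
Proof. by move=> [_ h]; split; [exact: (h 0%N)|rewrite derive1E]. Qed.

Lemma test_continuous (phi : R -> R) : circle_test_function phi -> continuous (derive1 phi).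
Proof.
by move=> [_ h] x; apply/differentiable_continuous/derivable1_diffP; exact: (h 1%N).
Qed.

Lemma derivable_continuous (phi dphi : R -> R) :
  (forall x : R, is_derive x 1 phi (dphi x)) -> continuous phi.
Proof.
by move=> d x; apply/differentiable_continuous/derivable1_diffP; case: (d x).
Qed.

Lemma ae_circle_open : {ae sg, forall x : R, 0 < x < tp}.
Proof.
have h (y : R) : {ae sg, forall x, x != y}.
  apply: ae_dsigma; exists [set y]; split => //; first exact: lebesgue_measure_set1.
  by move=> x /= /negP; rewrite negbK => /eqP.
have h0 : {ae sg, forall x, 0 < x <= tp}.
  apply: ae_imp2 (ae_circle R) (h 0) => x; rewrite in_itv/= => /andP[a b] n.
  by rewrite lt_neqAle eq_sym n a.
apply: ae_imp2 h0 (h tp) => x /andP[a b] n.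
by rewrite a lt_neqAle n.
Qed.

(** The difference [g] between [u] and its candidate is orthogonal to all positive frequencies but
    merely integrable. Uniqueness is therefore applied to the continuous [prim g], and its constancy
    gives [g = 0] almost everywhere by Lebesgue differentiation. *)
Lemma weak_prim u du : integ u -> integ du -> weak_derivative u du ->
  mean du = 0 /\ exists c, {ae sg, forall x, u x = c + prim du x}.
Proof.
move=> iu id wd; have tp0 := twopi_gt0 R.
have md : mean du = 0.
  (* Testing with a constant shows that a weak derivative has mean zero, so [prim du] is
     periodic. *)
  have tc : circle_test_function (fun=> 1 : R).
    have := test_cosl 1 0 0; congr circle_test_function.
    by apply/funext => x; rewrite mul0r addr0 cos0 mul1r.
  have := wd _ tc; rewrite -/(mean _) -/(mean _).
  have -> : (fun x => u x * derive1 (fun=> (1:R)) x) = fun=> 0.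
    by apply/funext => x; rewrite derive1_cst mulr0.
  rewrite mean_cst; under [X in mean X]eq_fun do rewrite mulr1.
  by move=> /esym/eqP; rewrite oppr_eq0 => /eqP.
split=> //.
have cV := prim_continuous id; have iV := integ_continuous cV.
have iuV := integB iu iV.
set c := mean (fun x => u x - prim du x).
exists c.
pose g x := u x - prim du x - c.
have ig : integ g by apply: integB => //; exact: integ_cst.
have mg : mean g = 0 by rewrite /g meanB ?mean_cst ?subrr//; exact: integ_cst.
have gsin k (t : R) : mean (fun x => g x * sin (k.+1%:R * x + t)) = 0.
  have K0 : (k.+1%:R : R) != 0 by rewrite pnatr_eq0.
  pose phi (x : R) := - k.+1%:R^-1 * cos (k.+1%:R * x + t).
  have dphi (x : R) : is_derive x 1 phi (sin (k.+1%:R * x + t)).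
    have := is_deriveZ (- k.+1%:R^-1) (is_derive_cosl k.+1%:R t x).
    by rewrite /GRing.scale/= mulrNN mulrA mulVf// mul1r.
  have cs : continuous (fun x : R => sin (k.+1%:R * x + t)).
    exact: (derivable_continuous (is_derive_sinl k.+1%:R t)).
  have tphi : circle_test_function phi by exact: test_cosl.
  have := wd _ tphi; rewrite -/(mean _) -/(mean _).
  have -> : (fun x => u x * derive1 phi x) = fun x => u x * sin (k.+1%:R * x + t).
    by apply/funext => x; rewrite derive1E; have [_ ->] := dphi x.
  have := prim_parts id cs dphi; rewrite md mul0r sub0r => h1 h2.
  have i1 := integMc iu cs; have i2 := integMc iV cs.
  have i3 := integZ c (integ_continuous cs).
  under [X in mean X]eq_fun do rewrite /g !mulrBl.
  rewrite meanB//; last exact: integB.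
  rewrite meanB// h1 h2 subrr sub0r meanZ; last exact: integ_continuous.
  have -> : (fun x : R => sin (k.+1%:R * x + t)) = fun x => cos (k.+1%:R * x + (t - pi / 2)).
    by apply/funext => x; rewrite addrA cosBpihalf.
  by rewrite mean_cosl mulr0 oppr0.
have Gc : forall x, 0 < x < tp -> prim g x = mean (prim g).
  apply: fourier_unique; first exact: prim_continuous.
  move=> k t; have K0 : (k.+1%:R : R) != 0 by rewrite pnatr_eq0.
  have dphi (x : R) : is_derive x 1 (fun x => k.+1%:R^-1 * sin (k.+1%:R * x + t))
      (cos (k.+1%:R * x + t)).
    have := is_deriveZ (k.+1%:R^-1) (is_derive_sinl k.+1%:R t x).
    by rewrite /GRing.scale/= mulrA mulVf// mul1r.
  rewrite (prim_parts ig _ dphi) ?mg ?mul0r ?sub0r; last exact: continuous_cosl.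
  under [X in mean X]eq_fun do rewrite mulrCA.
  rewrite meanZ ?gsin ?mulr0 ?oppr0//.
  apply: integMc => //; exact: (derivable_continuous (is_derive_sinl k.+1%:R t)).
apply: ae_imp2 ae_circle_open (ae_dsigma (prim_ae_derive ig)) => x x01 /(_ x01) Gx.
suff : g x = 0 by rewrite /g; lra.
have : is_derive x 1 (fun=> mean (prim g)) (g x).
  apply: is_derive_near Gx; near=> y; apply: Gc.
  have : y \in `]0, tp[ by near: y; apply: near_in_itvoo; rewrite in_itv.
  by rewrite in_itv.
move=> [_ <-].
by have [_ ->] := is_derive_cst (mean (prim g)) x (1 : R).
Unshelve. all: by end_near. Qed.

Lemma mean_jensen p h : 1 < p -> integ h -> integ (fun x => `|h x| `^ p) ->
  (mean (fun x => `|h x|)) `^ p <= mean (fun x => `|h x| `^ p).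
Proof.
move=> p1 ih ihp; set d := mean _.
have d0 : 0 <= d by apply: mean_ge0.
have inh := integ_norm ih.
have i2 : integ (fun x => p * spow (p - 1) d * (`|h x| - d)).
  by apply: integZ; apply: integB => //; exact: integ_cst.
have -> : d `^ p = mean (fun x => `|d| `^ p + p * spow (p - 1) d * (`|h x| - d)).
  rewrite meanD//; last exact: integ_cst.
  rewrite mean_cst meanZ; last by apply: integB => //; exact: integ_cst.
  rewrite meanB//; last exact: integ_cst.
  by rewrite mean_cst subrr mulr0 addr0 ger0_norm.
apply: mean_le => //; first by apply: integD => //; exact: integ_cst.
by apply: aeW => x; rewrite -{2}(normr_id (h x)); exact: powR_tangent.
Qed.

Lemma mean_norm_le_Lr p h : 1 < p -> integ h -> integ (fun x => `|h x| `^ p) ->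
  mean (fun x => `|h x|) <= Lr_norm p h.
Proof.
move=> p1 ih ihp; have p0 : 0 < p by lra.
have m0 : 0 <= mean (fun x => `|h x|) by apply: mean_ge0.
rewrite Lr_normE -[leLHS]powRr1// -(mulfV (lt0r_neq0 p0)) powRrM.
apply: ge0_ler_powR; rewrite ?nnegrE ?powR_ge0 ?invr_ge0 ?(ltW p0)//.
  by apply: mean_ge0 => x; exact: powR_ge0.
exact: mean_jensen.
Qed.

Lemma W1p_integ p u du : 1 <= p -> W1p p u du ->
  [/\ integ u, integ du & integ (fun x => `|du x| `^ p)].
Proof.
move=> p1 [/(integ_Lfun p1) iu hd _]; split => //; first exact: integ_Lfun hd.
by have [] := (LfunP du p1).1 hd.
Qed.

Lemma W1p_repr p u du : 1 <= p -> W1p p u du ->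
  mean du = 0 /\ exists c, {ae sg, forall x, u x = c + prim du x}.
Proof.
by move=> p1 H; have [iu id _] := W1p_integ p1 H; case: H => _ _; exact: weak_prim.
Qed.

Lemma prim_dist h x y : integ h -> `|prim h y - prim h x| <= tp * mean (fun z => `|h z|).
Proof.
move=> ih; have tp0 := twopi_gt0 R.
have i2 : integ (fun z => h z * ((z <= y)%R%:R - (z <= x)%R%:R)).
  under [X in integ X]eq_fun do rewrite mulrBr.
  by apply: integB; exact: integ_cut.
rewrite primB// normrM gtr0_norm// ler_pM2l// (le_trans (mean_norm i2))//.
apply: mean_le; [exact: integ_norm|exact: integ_norm|].
apply: aeW => z; rewrite normrM -[leRHS]mulr1 ler_wpM2l//.
by case: (z <= y); case: (z <= x); rewrite /= ?subrr ?subr0 ?sub0r ?normrN ?normr1 ?normr0.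
Qed.

(** A function of mean zero is, at [x], the average over [y] of [v x - v y], and each such
    difference is at most [tp] times the mean of [|dv|]. *)
Lemma sobolev_sup p v dv : 1 < p -> W1p p v dv -> mean v = 0 ->
  {ae sg, forall x, `|v x| <= tp * Lr_norm p dv}.
Proof.
move=> p1 H mv; have p1' := ltW p1; have tp0 := twopi_gt0 R.
have [iv id idp] := W1p_integ p1' H.
have [_ [c hc]] := W1p_repr p1' H.
have iV := integ_continuous (prim_continuous id).
have mc : c = - mean (prim dv).
  have : mean v = mean (fun x => c + prim dv x).
    apply: mean_ae hc; first exact: integ_meas.
    by apply: integ_meas; apply: integD => //; exact: integ_cst.
  by rewrite mv meanD ?mean_cst//; [lra|exact: integ_cst].
apply: ae_imp hc => x ->; rewrite mc addrC.
have -> : prim dv x - mean (prim dv) = mean (fun y => prim dv x - prim dv y).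
  by rewrite meanB ?mean_cst//; exact: integ_cst.
have i2 : integ (fun y => prim dv x - prim dv y) by apply: integB => //; exact: integ_cst.
apply: (le_trans (mean_norm i2)).
apply: (@le_trans _ _ (tp * mean (fun z => `|dv z|))).
  rewrite -[leRHS]mean_cst; apply: mean_le; [exact: integ_norm|exact: integ_cst|].
  by apply: aeW => y; exact: prim_dist.
by rewrite ler_pM2l//; exact: mean_norm_le_Lr.
Qed.

Lemma ae_bound_integ_powR r M f : 0 < r -> measurable_fun setT f ->
  {ae sg, forall x, `|f x| <= M} -> integ (fun x => `|f x| `^ r).
Proof.
move=> r0 mf h; apply: (@integ_bounded _ _ (M `^ r)); first exact: meas_normr_powR.
apply: ae_imp h => x h; rewrite ger0_norm ?powR_ge0//.
by apply: ge0_ler_powR; rewrite ?nnegrE ?(ltW r0) ?(le_trans _ h).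
Qed.

Lemma poincare p r v dv : 1 < p -> 0 < r -> W1p p v dv -> mean v = 0 ->
  Lr_norm r v <= tp * Lr_norm p dv.
Proof.
move=> p1 r0 H mv; have b := sobolev_sup p1 H mv.
have [iv _ _] := W1p_integ (ltW p1) H.
have mv' := integ_meas iv.
set M := tp * _ in b *.
have M0 : 0 <= M by rewrite mulr_ge0 ?Lr_norm_ge0// ltW// twopi_gt0.
have -> : M = (M `^ r) `^ r^-1 by rewrite -powRrM mulfV ?powRr1// gt_eqF.
rewrite Lr_normE; apply: ge0_ler_powR; rewrite ?nnegrE ?powR_ge0 ?invr_ge0 ?(ltW r0)//.
  by apply: mean_ge0 => x; exact: powR_ge0.
rewrite -[leRHS](mean_cst (M `^ r)); apply: mean_le.
- exact: ae_bound_integ_powR b.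
- exact: integ_cst.
- apply: ae_imp b => x h; apply: ge0_ler_powR; rewrite ?nnegrE ?(ltW r0)//.
Qed.

Lemma W1p_bounded p u du : 1 <= p -> W1p p u du ->
  exists M, {ae sg, forall x, `|u x| <= M}.
Proof.
move=> p1 H; have [iu id _] := W1p_integ p1 H; have [_ [c hc]] := W1p_repr p1 H.
exists (`|c| + tp * mean (fun z => `|du z|)).
apply: ae_imp hc => x ->; apply: (le_trans (ler_normD _ _)); rewrite lerD2l.
by rewrite -[prim du x]subr0 -(@prim0 _ du 0 id (lexx _)) prim_dist.
Qed.

Lemma W1p_integ_powR p r u du : 1 <= p -> 0 < r -> W1p p u du -> integ (fun x => `|u x| `^ r).
Proof.
move=> p1 r0 H; have [iu id _] := W1p_integ p1 H; have [M hM] := W1p_bounded p1 H.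
exact: ae_bound_integ_powR r0 (integ_meas iu) hM.
Qed.

(** Integration by parts on the closed period; [u 0 = u tp] and the periodicity of the test function
    cancel the boundary terms. *)
Lemma W1p_classical p u du : 1 <= p -> continuous u -> continuous du -> u 0 = u tp ->
  (forall x, x \in `[0, tp] -> is_derive x 1 u (du x)) -> W1p p u du.
Proof.
move=> p1 cu cdu u0 d.
have p0 : 0 < p by lra.
have i f : continuous f -> f \in Lfun sg p%:E.
  move=> cf; apply/LfunP => //; split; first exact: continuous_meas.
  have [M hM] := continuous_le_circle cf.
  apply: (ae_bound_integ_powR p0 (continuous_meas cf)).
  by apply: ae_imp (ae_circle R); exact: hM.
split; [exact: i|exact: i|] => phi tphi.
have dphi (x : R) := test_is_derive x tphi.
have cphi := derivable_continuous dphi.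
have cdphi := test_continuous tphi.
have c1 : continuous (fun x => u x * derive1 phi x).
  by move=> x; apply: cvgM; [exact: cu|exact: cdphi].
have c2 : continuous (fun x => du x * phi x).
  by move=> x; apply: cvgM; [exact: cdu|exact: cphi].
apply/eqP; rewrite -subr_eq0 opprK -/(mean _) -/(mean _) -meanD; last 2 first.
- exact: integ_continuous.
- exact: integ_continuous.
have dF (x : R) : x \in `[0, tp] -> is_derive x 1 (fun x => u x * phi x)
    (u x * derive1 phi x + du x * phi x).
  move=> x01; have := is_deriveM (d x x01) (dphi x).
  by rewrite /GRing.scale/= [phi x * _]mulrC.
rewrite (mean_FTC2 _ dF).
  by case: tphi => /(_ 0); rewrite add0r => -> _; rewrite u0 subrr mulr0.
by move=> x; apply: cvgD; [exact: c1|exact: c2].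
Qed.

Lemma W1p_affine p (a t : R) v dv : 1 <= p -> W1p p v dv ->
  W1p p (fun x => a + t * v x) (fun x => t * dv x).
Proof.
move=> p1 H; have p0 : 0 < p by lra.
have [iv id idp] := W1p_integ p1 H; have [M hM] := W1p_bounded p1 H.
have iav : integ (fun x => a + t * v x).
  by apply: integD; [exact: integ_cst|exact: integZ].
split.
- apply/LfunP => //; split; first exact: integ_meas.
  apply: (@ae_bound_integ_powR _ (`|a| + `|t| * M)) => //; first exact: integ_meas.
  apply: ae_imp hM => x h; apply: (le_trans (ler_normD _ _)).
  by rewrite lerD2l normrM ler_wpM2l.
- apply/LfunP => //; split; first by apply: integ_meas; exact: integZ.
  under [X in integ X]eq_fun do rewrite normrM powRM//.
  exact: integZ.
- move=> phi tphi; have dphi (x : R) := test_is_derive x tphi.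
  have cphi := derivable_continuous dphi.
  have cdphi := test_continuous tphi.
  have := H => -[_ _] /(_ _ tphi); rewrite -!/(mean _) => h.
  under [X in mean X]eq_fun do rewrite mulrDl -mulrA.
  under [in RHS]eq_fun do rewrite -mulrA.
  rewrite meanD; last 2 first.
  + by apply: integZ; exact: integ_continuous.
  + by apply: integZ; exact: integMc.
  rewrite !meanZ; last 3 first.
  + exact: integMc.
  + exact: integMc.
  + exact: integ_continuous.
  rewrite h mulrN (mean_FTC2 cdphi (fun x _ => dphi x)).
  by case: tphi => /(_ 0); rewrite add0r => -> _; rewrite subrr !mulr0 add0r.
Qed.

(** Makes the sets of Rayleigh quotients nonempty; on an empty set [inf] would be a default
    value. *)
Lemma calW1_cos p : 1 <= p -> calW1 p (fun x : R => cos x) (fun x => - sin x).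
Proof.
move=> p1.
have d (x : R) : is_derive x 1 (fun x : R => cos x) (- sin x).
  have := @is_derive_cosl R 1 0 x; rewrite !mul1r addr0.
  by congr is_derive; apply/funext => y; rewrite mul1r addr0.
have mc k : mean (fun x : R => cos (k.+1%:R * x)) = 0.
  by rewrite -(mean_cosl k 0); apply: eq_mean => x; rewrite addr0.
split.
- apply: W1p_classical => //.
  + exact: continuous_cos.
  + by move=> x; apply: cvgN; exact: continuous_sin.
  + by rewrite cos0 cos2pi.
- move=> h.
  have : mean (fun x : R => cos x ^+ 2) = 0.
    rewrite (@mean_ae _ _ (fun=> 0)) ?mean_cst//.
      by apply: continuous_meas => x; apply: cvgM; exact: continuous_cos.
    by apply: ae_imp h => x ->; rewrite expr0n.
  have -> : (fun x : R => cos x ^+ 2) = fun x => 2^-1 + 2^-1 * cos (2%:R * x).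
    by apply/funext => x; rewrite mulr_natl cos_mulr2n mulr2n; field.
  have ic : integ (fun x : R => cos (2%:R * x)).
    apply: integ_continuous => x; have := @continuous_cosl R 2 0 x.
    by rewrite /continuous_at; under eq_fun do rewrite addr0; rewrite addr0.
  rewrite meanD; [|exact: integ_cst|exact: integZ].
  by rewrite mean_cst meanZ// mc; lra.
- rewrite -/(mean _); rewrite -(mc 0%N); apply: eq_mean => x; by rewrite mul1r.
Qed.

Lemma nonzero_Lr_norm_gt0 p r v dv : 1 <= p -> 0 < r -> W1p p v dv -> nonzero v ->
  0 < Lr_norm r v.
Proof.
move=> p1 r0 H nz; rewrite lt_neqAle Lr_norm_ge0 andbT; apply/eqP => h; apply: nz.
have i := W1p_integ_powR p1 r0 H.
have m0 : mean (fun x => `|v x| `^ r) = 0.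
  by rewrite -Lr_norm_pow ?gt_eqF// -h powR0// gt_eqF.
have := mean_eq0_ae i (fun x => powR_ge0 _ _) m0.
apply: ae_imp => x /eqP; rewrite powR_eq0 normr_eq0 => /andP[/eqP].
by [].
Qed.

Lemma rayleigh_lbound p r v dv : 1 < p -> 0 < r -> calW1 p v dv ->
  tp ^- 2 <= Lr_norm p dv ^+ 2 / Lr_norm r v ^+ 2.
Proof.
move=> p1 r0 [H nz mv]; have N := nonzero_Lr_norm_gt0 (ltW p1) r0 H nz.
have tp0 := twopi_gt0 R.
rewrite ler_pdivlMr ?exprn_gt0// ler_pdivrMl ?exprn_gt0// -exprMn.
by rewrite lerXn2r ?nnegrE ?mulr_ge0 ?Lr_norm_ge0 ?(ltW tp0)//; exact: poincare.
Qed.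

Lemma rayleigh_inf_ge p r t : 1 < p ->
  (forall v dv, calW1 p v dv -> t <= Lr_norm p dv ^+ 2 / Lr_norm r v ^+ 2) ->
  t <= rayleigh_inf p r.
Proof.
move=> p1 h; apply: lb_le_inf.
  by exists (Lr_norm p (fun x : R => - sin x) ^+ 2 / Lr_norm r (fun x : R => cos x) ^+ 2),
    (fun x : R => cos x), (fun x : R => - sin x); split => //; exact/calW1_cos/ltW.
by move=> _ [v [dv [hv ->]]]; exact: h.
Qed.

Lemma rayleigh_inf_gt0 p r : 1 < p -> 0 < r -> 0 < rayleigh_inf p r :> R.
Proof.
move=> p1 r0; apply: (@lt_le_trans _ _ (tp ^- 2)).
  by rewrite invr_gt0 exprn_gt0// twopi_gt0.
by apply: rayleigh_inf_ge => // v dv; exact: rayleigh_lbound.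
Qed.

Lemma rayleigh_inf_le p r v dv : 1 < p -> 0 < r -> calW1 p v dv ->
  rayleigh_inf p r <= Lr_norm p dv ^+ 2 / Lr_norm r v ^+ 2.
Proof.
move=> p1 r0 H; apply: ge_inf; last by exists v, dv.
by exists (tp ^- 2) => _ [v' [dv' [hv ->]]]; exact: rayleigh_lbound.
Qed.

End Sobolev.

(** * Rigidity of positive solutions *)

Section Rigidity.
Variable R : realType.
Local Notation tp := (pi *+ 2 : R).
Local Notation sg := (dsigma R).
Implicit Types f g h u v w : R -> R.

Lemma powR_young (a x y : R) : 0 < a < 1 -> 0 <= x -> 0 <= y ->
  x `^ a * y `^ (1 - a) <= a * x + (1 - a) * y.
Proof.
move=> /andP[a0 a1] x0 y0; have b0 : 0 < 1 - a by rewrite subr_gt0.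
have := @conjugate_powR R (x `^ a) (y `^ (1 - a)) a^-1 (1 - a)^-1 (powR_ge0 _ _) (powR_ge0 _ _).
rewrite !invr_gt0 !invrK -!powRrM !mulfV ?gt_eqF// !powRr1// => h.
by rewrite (mulrC a) (mulrC (1 - a)); apply: h => //; lra.
Qed.

(** Hoelder's inequality with exponents [1 / a] and [1 / (1 - a)], integrated from Young's
    inequality. Positive upper bounds [F] and [G] stand for the two means, so the normalization
    never divides by zero. *)
Lemma mean_hoelder (a F G : R) f g : 0 < a < 1 -> 0 < F -> 0 < G ->
  (forall x, 0 <= f x) -> (forall x, 0 <= g x) -> integ f -> integ g ->
  integ (fun x => f x `^ a * g x `^ (1 - a)) -> mean f <= F -> mean g <= G ->
  mean (fun x => f x `^ a * g x `^ (1 - a)) <= F `^ a * G `^ (1 - a).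
Proof.
move=> a01 F0 G0 f0 g0 fi gi fgi fF gG; set C := F `^ a * G `^ (1 - a).
have C0 : 0 < C by rewrite mulr_gt0 ?powR_gt0.
have i1 := integZ (C * (a / F)) fi; have i2 := integZ (C * ((1 - a) / G)) gi.
apply: (@le_trans _ _ (mean (fun x => C * (a / F) * f x + C * ((1 - a) / G) * g x))).
  apply: mean_le => //; first exact: integD.
  apply: aeW => x; have := powR_young a01 (divr_ge0 (f0 x) (ltW F0)) (divr_ge0 (g0 x) (ltW G0)).
  move=> h; have {1}-> : f x = F * (f x / F) by rewrite mulrCA mulfV ?mulr1// gt_eqF.
  have {1}-> : g x = G * (g x / G) by rewrite mulrCA mulfV ?mulr1// gt_eqF.
  have -> : C * (a / F) * f x + C * ((1 - a) / G) * g x =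
      C * (a * (f x / F) + (1 - a) * (g x / G)) by ring.
  move: (f x / F) (g x / G) (divr_ge0 (f0 x) (ltW F0)) (divr_ge0 (g0 x) (ltW G0)) h.
  move=> y z y0 z0 h; rewrite (powRM _ (ltW F0) y0) (powRM _ (ltW G0) z0) mulrACA -/C.
  by rewrite ler_pM2l.
rewrite meanD// !meanZ//.
have h1 : mean f / F <= 1 by rewrite ler_pdivrMr// mul1r.
have h2 : mean g / G <= 1 by rewrite ler_pdivrMr// mul1r.
have -> : C * (a / F) * mean f + C * ((1 - a) / G) * mean g =
    C * (a * (mean f / F) + (1 - a) * (mean g / G)) by ring.
rewrite -[leRHS]mulr1 ler_pM2l//; case/andP: a01 => a0 a1.
move: (_ / F) (_ / G) h1 h2 => y z y1 z1.
have : a * y <= a by rewrite -[leRHS]mulr1 ler_pM2l.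
have : (1 - a) * z <= 1 - a by rewrite -[leRHS]mulr1 ler_pM2l// subr_gt0.
by clear; move: (a * y) (_ * z) => *; lra.
Qed.

Lemma is_derive_spow_comp (G : R -> R) (x l b : R) : 1 < b -> is_derive x 1 G l ->
  is_derive x 1 (fun t => spow b (G t)) (b * `|G x| `^ (b - 1) * l).
Proof.
move=> b1 dG; apply: (@is_derive1_comp _ (spow b) G) => //.
exact: is_derive_spow.
Qed.

Lemma continuous_powR_comp v (b : R) : continuous v -> (forall x, 0 < v x) ->
  continuous (fun x => v x `^ b).
Proof.
move=> cv v0 x.
apply: (@continuous_comp _ _ _ v (fun z => z `^ b)); first exact: cv.
exact: continuous_powR_pos.
Qed.

(** The function differentiated is [u^(2-p) k w] minus [(q + 1 - p) u^(1-p)] times the primitive of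
    [|w|^r] in [w]. The derivative of [u^(2-p) k] with respect to [u] is [(q + 1 - p) u^(1-p) k - c
    (p - q) + e (q - 1) u^(1-p)], and it is multiplied by [u' w = |w|^r]. The subtracted function
    cancels the first of these terms, whose sign is unknown. *)
Lemma rigidity_derive (p q b c e : R) u w (x : R) : 2 < p -> p - 1 < q -> 0 < u x ->
  let k := b * u x `^ (q - 1) - c * u x `^ (p - 1) - e in
  is_derive x 1 u (spow (p - 1)^-1 (w x)) -> is_derive x 1 w k ->
  let r := p / (p - 1) in
  is_derive x 1
   (fun x => (b * u x `^ (q + 1 - p) - c * u x - e * u x `^ (2 - p)) * w x -
      (q + 1 - p) * (u x `^ (1 - p) * ((r + 1)^-1 * spow (r + 1) (w x))))
   (u x `^ (2 - p) * k ^+ 2 +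
     (q + 1 - p) * (p - 1) * (u x `^ (- p) * (spow (p - 1)^-1 (w x) *
        ((r + 1)^-1 * spow (r + 1) (w x)))) -
     c * (p - q) * `|w x| `^ r + e * (q - 1) * (u x `^ (1 - p) * `|w x| `^ r)).
Proof.
move=> p2 pq u0 k du dw r.
have p10 : 0 < p - 1 by lra.
have r0 : 0 < r by rewrite divr_gt0//; lra.
have r1 : 1 < r + 1 by lra.
have D1 := is_derive_powR_comp (q + 1 - p) u0 du.
have D2 := is_derive_powR_comp (2 - p) u0 du.
have D3 := is_derive_powR_comp (1 - p) u0 du.
have D4 := is_derive_spow_comp r1 dw.
set dpsi := spow (p - 1)^-1 (w x) in du D1 D2 D3 *.
have scE (y z : R) : y *: z = y * z by [].
have gE : w x * dpsi = `|w x| `^ r.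
  rewrite -(mulr_spow _ r0) /dpsi; congr (_ * spow _ _).
  by rewrite /r; field; rewrite gt_eqF.
have D := is_deriveB (is_deriveM (is_deriveB (is_deriveB (is_deriveZ b D1)
  (is_deriveZ c du)) (is_deriveZ e D2)) dw) (is_deriveZ (q + 1 - p)
  (is_deriveM D3 (is_deriveZ (r + 1)^-1 D4))).
apply: (is_derive_eq D); rewrite !fctE /= !scE addrK -gE.
clear D D1 D2 D3 D4 dw du; rewrite {}/k.
(* In terms of [u], [P = u^(p-1)] and [Q = u^(q-1)] all powers become rational, and the identity is
   one of fields. *)
set P := u x `^ (p - 1); have P0 : 0 < P by rewrite powR_gt0.
set Q := u x `^ (q - 1).
have e1 : u x `^ (1 - p) = P^-1.
  by rewrite /P -powRN; congr (_ `^ _); ring.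
have M y z : u x `^ (y + z) = u x `^ y * u x `^ z.
  by rewrite powRD//; apply/implyP => _; rewrite gt_eqF.
have M1 : u x `^ 1 = u x by rewrite powRr1// ltW.
have e2 : u x `^ (2 - p) = u x / P.
  have -> : 2 - p = 1 + (1 - p) by ring.
  by rewrite M M1 e1.
have e3 : u x `^ (- p) = (u x * P)^-1.
  have -> : - p = - 1 + (1 - p) by ring.
  by rewrite M e1 powRN M1 invfM.
have e4 : u x `^ (q + 1 - p) = Q * u x / P.
  have -> : q + 1 - p = (q - 1) + (1 + (1 - p)) by ring.
  by rewrite M (M 1) M1 e1 mulrA.
have e5 : u x `^ (q + 1 - p - 1) = Q / P.
  have -> : q + 1 - p - 1 = (q - 1) + (1 - p) by ring.
  by rewrite M e1.
have e6 : u x `^ (2 - p - 1) = P^-1.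
  by rewrite -e1; congr (_ `^ _); ring.
have e7 : u x `^ (1 - p - 1) = (u x * P)^-1.
  by rewrite -e3; congr (_ `^ _); ring.
rewrite e1 e2 e3 e4 e5 e6 e7.
have r10 : r + 1 != 0 by rewrite gt_eqF//; lra.
move: (u x) u0 (w x) dpsi (spow (r + 1) (w x)) P P0 Q (r + 1) r10 {e1 e2 e3 e4 e5 e6 e7 M M1 gE} => y y0 z d s P P0 Q a a0.
have y1 : y != 0 by rewrite gt_eqF.
have P1 : P != 0 by rewrite gt_eqF.
by clear -a0 y1 P1; field; rewrite a0 y1 P1.
Qed.

(** The exact derivative integrates to zero over the period, and its terms with the factors
    [q + 1 - p] and [e (q - 1)] are nonnegative and dropped. The function [v] extends [u] from the
    period to a positive continuous function, so that negative powers are continuous on the line. *)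
Lemma rigidity (p q b c e : R) u v w : 2 < p -> p - 1 < q -> 0 <= e ->
  continuous v -> continuous w -> (forall x, 0 < v x) ->
  (forall x, x \in `[0, tp] -> u x = v x) -> u 0 = u tp -> w 0 = w tp ->
  let k x := b * v x `^ (q - 1) - c * v x `^ (p - 1) - e in
  (forall x, x \in `[0, tp] -> is_derive x 1 u (spow (p - 1)^-1 (w x))) ->
  (forall x, x \in `[0, tp] -> is_derive x 1 w (k x)) ->
  mean (fun x => v x `^ (2 - p) * k x ^+ 2) <=
  c * (p - q) * mean (fun x => `|w x| `^ (p / (p - 1))).
Proof.
move=> p2 pq e0 cv cw v0 uv u0 w0 k du dw.
set r := p / (p - 1).
have p10 : 0 < p - 1 by lra.
have r0 : 0 < r by rewrite divr_gt0//; lra.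
have cP b' := continuous_powR_comp (b := b') cv v0.
have cwr : continuous (fun x => `|w x| `^ r).
  move=> x; apply: (@continuous_comp _ _ _ w (fun z => `|z| `^ r)); first exact: cw.
  exact: normr_continuous_powR.
have cS a : 0 < a -> continuous (fun x => spow a (w x)).
  move=> a0 x; apply: (@continuous_comp _ _ _ w (spow a)); first exact: cw.
  exact: continuous_spow.
have ck : continuous k.
  move=> x; apply: cvgB; last exact: cvg_cst.
  by apply: cvgB; apply: cvgM; [exact: cvg_cst|exact: cP|exact: cvg_cst|exact: cP].
pose S x := spow (p - 1)^-1 (w x) * ((r + 1)^-1 * spow (r + 1) (w x)).
have ip0 : 0 < (p - 1)^-1 by rewrite invr_gt0.
have r1 : 0 < r + 1 by lra.
have cSS : continuous S.
  move=> x; apply: cvgM; first exact: cS.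
  by apply: cvgM; [exact: cvg_cst|exact: cS].
have S0 x : 0 <= S x.
  rewrite /S mulrCA mulr_ge0 ?invr_ge0 ?(ltW r1)// /spow.
  rewrite mulrACA -expr2 mulr_ge0 ?sqr_ge0// mulr_ge0 ?powR_ge0//.
pose f x := v x `^ (2 - p) * k x ^+ 2 + (q + 1 - p) * (p - 1) * (v x `^ (- p) * S x) -
  c * (p - q) * `|w x| `^ r + e * (q - 1) * (v x `^ (1 - p) * `|w x| `^ r).
have c1 : continuous (fun x => v x `^ (2 - p) * k x ^+ 2).
  by move=> x; apply: cvgM; [exact: cP|apply: cvgM; exact: ck].
have cf : continuous f.
  move=> x; apply: cvgD.
    apply: cvgB; last by apply: cvgM; [exact: cvg_cst|exact: cwr].
    apply: cvgD; first exact: c1.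
    by apply: cvgM; [exact: cvg_cst|apply: cvgM; [exact: cP|exact: cSS]].
  by apply: cvgM; [exact: cvg_cst|apply: cvgM; [exact: cP|exact: cwr]].
have f0 : mean f = 0.
  pose T x := (b * u x `^ (q + 1 - p) - c * u x - e * u x `^ (2 - p)) * w x -
      (q + 1 - p) * (u x `^ (1 - p) * ((r + 1)^-1 * spow (r + 1) (w x))).
  have dT x : x \in `[0, tp] -> is_derive x 1 T (f x).
    move=> x01; have ux0 : 0 < u x by rewrite uv.
    have := @rigidity_derive p q b c e u w x p2 pq ux0.
    by rewrite /f /k -(uv x x01) => h; apply: h; [exact: du|rewrite uv//; exact: dw].
  by rewrite (mean_FTC2 cf dT) /T u0 w0 subrr mulr0.
have i1 := integ_continuous c1.
have i2 := integZ (c * (p - q)) (integ_continuous cwr).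
rewrite -subr_le0 -meanZ; last exact: integ_continuous.
rewrite -meanB// -f0; apply: mean_le.
- exact: integB.
- exact: integ_continuous.
apply: aeW => x; rewrite /f.
have h1 : 0 <= (q + 1 - p) * (p - 1) * (v x `^ (- p) * S x).
  apply: mulr_ge0; first by apply: mulr_ge0; lra.
  by apply: mulr_ge0; [exact: powR_ge0|exact: S0].
have h2 : 0 <= e * (q - 1) * (v x `^ (1 - p) * `|w x| `^ r).
  apply: mulr_ge0; first by apply: mulr_ge0 => //; lra.
  by apply: mulr_ge0; exact: powR_ge0.
suff gen (y1 y2 y3 y4 : R) : 0 <= y1 -> 0 <= y2 -> y3 - y4 <= y3 + y1 - y4 + y2 by exact: gen.
by clear => *; lra.
Qed.

Lemma min_zero_derive u (x l : R) : (forall y, 0 <= u y) -> u x = 0 ->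
  is_derive x 1 u l -> l = 0.
Proof.
move=> u0 ux du; apply: (@is_derive_min0 _ (fun t => u (t + x))).
  have := @is_derive1_comp _ u (fun t => t + x) 0 l 1.
  rewrite add0r mulr1; apply => //.
  by apply: is_derive_eq; rewrite addr0.
by move=> t; rewrite add0r ux.
Qed.

Lemma is_derive_MVT (f df : R -> R) (x y : R) : x < y ->
  (forall z, z \in `[x, y] -> is_derive z 1 f (df z)) ->
  exists2 z, x < z < y & f y - f x = df z * (y - x).
Proof.
move=> xy d; have [|z zxy h] := MVT xy (fun z zxy => d z (subset_itv_oo_cc zxy)).
  apply: derivable_within_continuous => z zxy; by have [] := d z zxy.
by exists z.
Qed.

(** A zero of [u] is a minimum, so [u' = 0] and hence [w = 0] there, while [w' = k 0 = - e]. Just to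
    the right [w], and with it [u'], is negative, and [u] would fall below 0. *)
Lemma solution_pos (p e : R) (k : R -> R) u w : 2 < p -> 0 < e ->
  continuous u -> (forall x, 0 <= u x) -> continuous k -> k 0 = - e ->
  (forall x, - tp < x -> is_derive x 1 u (spow (p - 1)^-1 (w x))) ->
  (forall x, - tp < x -> is_derive x 1 w (k (u x))) ->
  forall x, - tp < x -> 0 < u x.
Proof.
move=> p2 e0 cu u0 ck k0 du dw x tx.
rewrite lt_neqAle u0 andbT eq_sym; apply/eqP => ux.
have ip0 : (p - 1)^-1 != 0 by rewrite invr_eq0; lra.
have wx : w x = 0.
  have := min_zero_derive u0 ux (du x tx).
  by move=> /eqP; rewrite -sgr_eq0 sg_spow sgr_eq0 => /eqP.
have cku : {for x, continuous (fun y => k (u y))}.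
  by apply: continuous_comp; [exact: cu|exact: ck].
have [d d0 hd] : exists2 d, 0 < d & forall y, `|y - x| <= d -> k (u y) < 0.
  have /cvgrPdist_lt/(_ e e0)[d /= d0 hd] := cku.
  exists (d / 2); first by rewrite divr_gt0.
  move=> y yx; have /= := hd y; rewrite distrC ux k0 => /(_ _)/wrap[]; first by lra.
  by rewrite ltr_norml; lra.
have wneg y : x < y <= x + d -> w y < 0.
  move=> /andP[xy yd].
  have [|z /andP[xz zy]] := @is_derive_MVT w (fun z => k (u z)) x y xy.
    by move=> z; rewrite in_itv/= => /andP[xz _]; apply: dw; exact: lt_le_trans xz.
  rewrite wx subr0 => ->; rewrite pmulr_llt0 ?subr_gt0//.
  by apply: hd; rewrite ler_norml; lra.
have xd : x < x + d by rewrite ltrDl.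
have [|z /andP[xz zy]] := @is_derive_MVT u (fun z => spow (p - 1)^-1 (w z)) x (x + d) xd.
  by move=> z; rewrite in_itv/= => /andP[xz _]; apply: du; exact: lt_le_trans xz.
rewrite ux subr0 addrAC subrr add0r => h.
have := u0 (x + d); rewrite h leNgt => /negP; apply.
rewrite pmulr_llt0// -sgr_lt0 sg_spow sgr_lt0.
by apply: wneg; rewrite xz ltW.
Qed.

Lemma lambda1_poincare p u du : 1 < p -> W1p p u du ->
  rayleigh_inf p p * Lr_norm p (fun x => u x - mean u) ^+ 2 <= Lr_norm p du ^+ 2.
Proof.
move=> p1 H; have p0 : 0 < p by lra.
have [iu id _] := W1p_integ (ltW p1) H.
have Hv : W1p p (fun x => u x - mean u) du.
  have := W1p_affine (- mean u) 1 (ltW p1) H.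
  congr W1p; apply/funext => x; last by rewrite mul1r.
  by rewrite mul1r addrC.
have [z|nz] := pselect {ae sg, forall x, u x - mean u = 0}.
  have -> : Lr_norm p (fun x => u x - mean u) = 0.
    rewrite Lr_normE (@mean_ae _ _ (fun=> 0)) ?mean_cst ?powR0 ?invr_eq0 ?gt_eqF//.
      by apply: meas_normr_powR; apply: integ_meas; apply: integB => //; exact: integ_cst.
    by apply: ae_imp z => x ->; rewrite normr0 powR0// gt_eqF.
  by rewrite expr0n mulr0 sqr_ge0.
have N := nonzero_Lr_norm_gt0 (ltW p1) p0 Hv nz.
rewrite -ler_pdivlMr ?exprn_gt0//; apply: rayleigh_inf_le => //; split => //.
rewrite -/(mean _) meanB ?mean_cst ?subrr//; exact: integ_cst.
Qed.

Lemma powR_le_div (p M E lam : R) : 0 < p -> 0 <= M -> 0 <= E -> 0 < lam ->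
  M `^ (2 / p) <= E `^ (2 / p) / lam -> M <= E / lam `^ (p / 2).
Proof.
move=> p0 M0 E0 l0 h.
have pK y : 0 <= y -> (y `^ (2 / p)) `^ (p / 2) = y.
  by move=> y0; rewrite -powRrM mulrA divfK ?gt_eqF// mulfV ?pnatr_eq0// powRr1.
rewrite -(pK M M0) -{1}(pK E E0).
have -> : (E `^ (2 / p)) `^ (p / 2) / lam `^ (p / 2) = (E `^ (2 / p) / lam) `^ (p / 2).
  rewrite powRM ?powR_ge0 ?invr_ge0 ?(ltW l0)//; congr (_ * _).
  by rewrite -[lam^-1]powR_inv1 ?(ltW l0)// -powRrM mulN1r powRN.
by apply: ge0_ler_powR; rewrite ?nnegrE ?powR_ge0 ?divr_ge0 ?powR_ge0 ?(ltW p0) ?(ltW l0).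
Qed.

(** The right side is the square root of [L / lam * E ^ 2]: the powers of [P] cancel and those of
    [E] combine, as the scaling requires. *)
Lemma rigidity_balance (p E P L lam : R) : 0 < p -> 0 < E -> 0 < P -> 0 < L -> 0 < lam ->
  E <= ((E / lam `^ (p / 2)) `^ (2 / p) * P `^ (1 - 2 / p)) `^ 2^-1 *
    (L * E `^ (1 - 2 / p) * P `^ (2 / p - 1) * E) `^ (1 - 2^-1) -> lam <= L.
Proof.
move=> p0 E0 P0 L0 l0; set G := _ * P `^ _; set G1 := _ * E.
have hf : (1 : R) - 2^-1 = 2^-1 by field.
have G0 : 0 <= G by rewrite mulr_ge0 ?powR_ge0.
have G10 : 0 <= G1 by rewrite !mulr_ge0 ?powR_ge0 ?(ltW L0) ?(ltW E0).
rewrite hf -powRM// => hE.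
have GG : G * G1 = L / lam * E ^+ 2.
  have lpow : (lam `^ (p / 2)) `^ (2 / p) = lam.
    by rewrite -powRrM mulrA divfK ?pnatr_eq0// mulfV ?gt_eqF// powRr1// ltW.
  rewrite /G /G1 powRM ?invr_ge0 ?powR_ge0 ?(ltW E0)//.
  rewrite -[(lam `^ (p / 2))^-1]powR_inv1 ?powR_ge0// -powRrM mulN1r powRN lpow.
  have PP : P `^ (1 - 2 / p) * P `^ (2 / p - 1) = 1.
    rewrite -powRD; last by apply/implyP => _; rewrite gt_eqF.
    by rewrite addrC subrKA subrr powRr0.
  have EE2 : E `^ (2 / p) * E `^ (1 - 2 / p) = E.
    rewrite -powRD; last by apply/implyP => _; rewrite gt_eqF.
    by rewrite addrC subrK powRr1// ltW.
  clear -EE2 PP l0; move: (E `^ (2 / p)) (E `^ (1 - 2 / p)) EE2 PP => y z <-.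
  move: (P `^ _) (P `^ _) => s t st.
  transitivity ((s * t) * (L / lam * (y * z) ^+ 2)); last by rewrite [s * t]mulrC st mul1r.
  by field; rewrite gt_eqF.
have sq : (E ^+ 2) `^ 2^-1 = E.
  by rewrite -powR_mulrn ?(ltW E0)// -powRrM mulfV ?pnatr_eq0// powRr1// ltW.
rewrite leNgt; apply/negP => Ll.
have LL : L / lam < 1 by rewrite ltr_pdivrMr// mul1r.
suff : E < E by rewrite ltxx.
rewrite GG in hE; apply: (le_lt_trans hE); rewrite -{2}sq.
apply: gt0_ltr_powR; rewrite ?nnegrE ?sqr_ge0 ?invr_gt0 ?ltr0n//.
  by rewrite mulr_ge0 ?sqr_ge0// divr_ge0// ltW.
by rewrite -[ltRHS]mul1r ltr_pM2r// exprn_gt0.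
Qed.

(* [E] is written as [- mean ((u - m) w')] and estimated by the weighted
   Cauchy-Schwarz inequality against the quantity controlled by [rigidity]. *)
Lemma rigidity_contradiction (p q b c e L : R) u v w : 2 < p -> p - 1 < q -> 0 <= e ->
  continuous v -> continuous w -> (forall x, 0 < v x) -> continuous u ->
  (forall x, x \in `[0, tp] -> u x = v x) -> u 0 = u tp -> w 0 = w tp ->
  let k x := b * v x `^ (q - 1) - c * v x `^ (p - 1) - e in
  (forall x, x \in `[0, tp] -> is_derive x 1 u (spow (p - 1)^-1 (w x))) ->
  (forall x, x \in `[0, tp] -> is_derive x 1 w (k x)) ->
  let E := mean (fun x => `|spow (p - 1)^-1 (w x)| `^ p) in
  let P := mean (fun x => `|u x| `^ p) in
  0 < E -> 0 < P -> 0 < L -> L < rayleigh_inf p p ->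
  c * (p - q) <= L * E `^ (1 - 2 / p) * P `^ (2 / p - 1) -> False.
Proof.
move=> p2 pq e0 cv cw v0 cu uv u0 w0 k du dw E P E0 P0 L0 Ll hc.
have p1 : 1 < p by rewrite (lt_trans _ p2)// ltr1n.
have p0 : 0 < p by rewrite (lt_trans _ p1).
have ip0 : 0 < (p - 1)^-1 by rewrite invr_gt0 subr_gt0.
pose psi x := spow (p - 1)^-1 (w x).
have cpsi : continuous psi.
  move=> x; apply: (@continuous_comp _ _ _ w (spow (p - 1)^-1)); first exact: cw.
  exact: continuous_spow.
have H : W1p p u psi by exact: W1p_classical (ltW p1) cu cpsi u0 du.
have l0 : 0 < rayleigh_inf p p :> R by exact: rayleigh_inf_gt0.
have EE : E = mean (fun x => `|w x| `^ (p / (p - 1))).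
  apply: eq_mean => x; rewrite norm_spow ?gt_eqF// -powRrM; congr (_ `^ _).
  by rewrite mulrC.
have cP b' := continuous_powR_comp (b := b') cv v0.
have ck : continuous k.
  move=> x; apply: cvgB; last exact: cvg_cst.
  by apply: cvgB; apply: cvgM; [exact: cvg_cst|exact: cP|exact: cvg_cst|exact: cP].
have hX : mean (fun x => v x `^ (2 - p) * k x ^+ 2) <= c * (p - q) * E.
  by rewrite EE; exact: rigidity p2 pq e0 cv cw v0 uv u0 w0 du dw.
have hF : mean (fun x => `|u x - mean u| `^ p) <= E / (rayleigh_inf p p) `^ (p / 2).
  have := lambda1_poincare p1 H; rewrite !Lr_norm_sqr -/E mulrC -ler_pdivlMr//.
  have M0 : 0 <= mean (fun x => `|u x - mean u| `^ p).
    by apply: mean_ge0 => x; exact: powR_ge0.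
  by move=> h; exact: (powR_le_div p0 M0 (ltW E0) l0 h).
have PE : mean (fun x => v x `^ p) = P.
  apply: mean_ae.
  + exact: continuous_meas.
  + by apply: meas_normr_powR; exact: continuous_meas.
  + by apply: ae_imp (ae_circle R) => x /uv ->; rewrite gtr0_norm.
clearbody k E P; clear uv H.
move: (rayleigh_inf p p) l0 Ll hF => lam l0 Ll hF.
have {hc}hX : mean (fun x => v x `^ (2 - p) * k x ^+ 2) <=
    L * E `^ (1 - 2 / p) * P `^ (2 / p - 1) * E.
  by apply: (le_trans hX); rewrite ler_pM2r.
set m := mean u in hF; clearbody m.
have F0 : 0 < E / lam `^ (p / 2) by rewrite divr_gt0// powR_gt0.
set F := E / _ in hF F0.
(* Bounds the variance of [u] with weight [v^(p-2)], by Hoelder with the weights [2 / p] and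
   [1 - 2 / p]: the first factor is controlled by [lambda1], the second is the mass [P]. *)
pose G := F `^ (2 / p) * P `^ (1 - 2 / p).
have G0 : 0 < G by rewrite mulr_gt0 ?powR_gt0.
have cum : continuous (fun x => `|u x - m| `^ p).
  move=> x; apply: (@continuous_comp _ _ _ (fun x => u x - m) (fun z => `|z| `^ p)).
    by apply: cvgB; [exact: cu|exact: cvg_cst].
  exact: normr_continuous_powR.
have cg : continuous (fun x => (u x - m) ^+ 2 * v x `^ (p - 2)).
  move=> x; apply: cvgM; last exact: cP.
  by apply: cvgM; (apply: cvgB; [exact: cu|exact: cvg_cst]).
have a1 : 0 < 2 / p < 1 by rewrite divr_gt0//= ltr_pdivrMr// mul1r.
have eG x : (`|u x - m| `^ p) `^ (2 / p) * (v x `^ p) `^ (1 - 2 / p) =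
    (u x - m) ^+ 2 * v x `^ (p - 2).
  rewrite -!powRrM; congr (_ * (_ `^ _)); last by field; rewrite gt_eqF.
  have -> : p * (2 / p) = 2%:R by field; rewrite gt_eqF.
  by rewrite powR_mulrn// real_normK// num_real.
have hG : mean (fun x => (u x - m) ^+ 2 * v x `^ (p - 2)) <= G.
  under [X in mean X]eq_fun do rewrite -eG.
  apply: (mean_hoelder a1 F0 P0 _ _ _ _ _ hF).
  - by move=> x; exact: powR_ge0.
  - by move=> x; exact: powR_ge0.
  - exact: integ_continuous.
  - exact: integ_continuous.
  - by under [X in integ X]eq_fun do rewrite eG; exact: integ_continuous.
  - by rewrite PE.
have h2 : 0 < (2^-1 : R) < 1 by rewrite invr_gt0 ltr0n invf_lt1 ?ltr1n ?ltr0n.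
have c1 : continuous (fun x => v x `^ (2 - p) * k x ^+ 2).
  by move=> x; apply: cvgM; [exact: cP|apply: cvgM; exact: ck].
have sq (y : R) : 0 <= y -> (y ^+ 2) `^ 2^-1 = y.
  by move=> y0; rewrite -powR_mulrn// -powRrM mulfV ?powRr1// pnatr_eq0.
(* The weights [v^(p-2)] and [v^(2-p)] are inverse to each other, so Cauchy-Schwarz controls the
   unweighted product. *)
have eE x : ((u x - m) ^+ 2 * v x `^ (p - 2)) `^ 2^-1 *
    (v x `^ (2 - p) * k x ^+ 2) `^ (1 - 2^-1) = `|(u x - m) * k x|.
  have -> : 1 - 2^-1 = 2^-1 :> R by field.
  have vv : v x `^ (p - 2) * v x `^ (2 - p) = 1.
    rewrite -powRD; last by apply/implyP => _; rewrite gt_eqF.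
    by rewrite addrC subrKA subrr powRr0.
  rewrite -powRM; [|exact: mulr_ge0 (sqr_ge0 _) (powR_ge0 _ _)
    |exact: mulr_ge0 (powR_ge0 _ _) (sqr_ge0 _)].
  have -> : (u x - m) ^+ 2 * v x `^ (p - 2) * (v x `^ (2 - p) * k x ^+ 2) =
      (v x `^ (p - 2) * v x `^ (2 - p)) * ((u x - m) * k x) ^+ 2 by ring.
  by rewrite vv mul1r -real_normK ?num_real// sq.
pose G1 := L * E `^ (1 - 2 / p) * P `^ (2 / p - 1) * E.
have G10 : 0 < G1 by rewrite !mulr_gt0 ?powR_gt0.
have ci : continuous (fun x => (u x - m) * k x).
  by move=> x; apply: cvgM; [apply: cvgB; [exact: cu|exact: cvg_cst]|exact: ck].
have hE0 : mean (fun x => `|(u x - m) * k x|) <= G `^ 2^-1 * G1 `^ (1 - 2^-1).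
  under [X in mean X]eq_fun do rewrite -eE.
  apply: (mean_hoelder h2 G0 G10 _ _ _ _ _ hG hX).
  - by move=> x; exact: mulr_ge0 (sqr_ge0 _) (powR_ge0 _ _).
  - by move=> x; exact: mulr_ge0 (powR_ge0 _ _) (sqr_ge0 _).
  - exact: integ_continuous.
  - exact: integ_continuous.
  - under [X in integ X]eq_fun do rewrite eE.
    by apply: integ_norm; exact: integ_continuous.
have cwp : continuous (fun x => w x * psi x).
  by move=> x; apply: cvgM; [exact: cw|exact: cpsi].
have hE : E <= G `^ 2^-1 * G1 `^ (1 - 2^-1).
  apply: le_trans hE0; apply: le_trans (mean_norm (integ_continuous ci)).
  have r0 : 0 < p / (p - 1) by rewrite divr_gt0// subr_gt0.
  have Ew : E = mean (fun x => w x * psi x).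
    rewrite EE; apply: eq_mean => x; rewrite -(mulr_spow _ r0); congr (_ * spow _ _).
    by clear -p1; field; rewrite subr_eq0 gt_eqF.
  (* The integrand is the derivative of [(u - m) w], which takes equal values at both ends of the
     period. *)
  have : mean (fun x => (u x - m) * k x + w x * psi x) = 0.
    have cs : continuous (fun x => (u x - m) * k x + w x * psi x).
      by move=> x; apply: cvgD; [exact: ci|exact: cwp].
    have dT x : x \in `[0, tp] ->
        is_derive x 1 (fun x => (u x - m) * w x) ((u x - m) * k x + w x * psi x).
      move=> x01; have := is_deriveM (is_deriveB (du x x01) (is_derive_cst m x 1)) (dw x x01).
      by rewrite subr0.
    by rewrite (mean_FTC2 cs dT) u0 w0 subrr mulr0.
  rewrite meanD; [|exact: integ_continuous|exact: integ_continuous].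
  rewrite -Ew => /eqP; rewrite addrC addr_eq0 => /eqP ->.
  by rewrite -normrN ler_norm.
have := rigidity_balance p0 E0 P0 L0 l0 hE.
by rewrite leNgt Ll.
Qed.

End Rigidity.

(** * Sampling a Sobolev function on the grid *)

Section Sampling.
Context {R : realType} {U : set_system nat} {UF : UltraFilter U}.
Hypothesis Uoo : \oo `<=` U.
Local Notation tp := (pi *+ 2 : R).
Local Notation mu := (@lebesgue_measure R).
Implicit Types V d g : R -> R.

Definition sample V n (i : 'I_n.+1) : R := V (i%:R * @step R n).

Lemma seqof_sample V n k : 0 <= @grid R n k < tp -> seqof (sample V (n := n)) k = V (grid n k).
Proof.
move=> /andP[k0 k1]; have h0 := @step_gt0 R n.
have hs : n.+1%:R * @step R n = tp by rewrite /step mulrCA mulfV ?mulr1// pnatr_eq0.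
have kn : (n.+1 <= k)%N.
  by move: k0; rewrite /grid subr_ge0 -hs ler_pM2r// ler_nat.
have kn2 : (k - n.+1 < n.+1)%N.
  rewrite ltn_subLR// -(ltr_nat R) -(ltr_pM2r h0) natrD mulrDl hs.
  by move: k1; rewrite /grid ltrBlDr.
rewrite /seqof /sample inordK ?ltn_pmod//; congr V.
have -> : (k %% n.+1 = k - n.+1)%N by rewrite -{1}(subnK kn) modnDr modn_small.
by rewrite natrB// mulrBl hs.
Qed.

Lemma sample_mean g V C : continuous g -> continuous V ->
  (forall x, x \in `[0, tp] -> `|g (V x)| <= C) ->
  dmean (fun i => g (@sample V n i)) @[n --> U] --> mean (fun x => g (V x)).
Proof.
move=> cg cV hC.
have -> : (fun n => dmean (fun i => g (@sample V n i))) =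
    (fun n => n.+1%:R^-1 * \sum_(n.+1 <= i < n.+1 + n.+1) g (seqof (sample V (n := n)) i)).
  by apply/funext => n; rewrite dmean_seqof.
apply: (@mean_grid_lim R U _ Uoo (fun n k => g (seqof (sample V (n := n)) k)) (fun x => g (V x)) C).
- by move=> x; apply: continuous_comp; [exact: cV|exact: cg].
- move=> t /andP[t0 t1]; apply/gridcvgP => e e0.
  have cgV : {for t, continuous (fun x => g (V x))}.
    by apply: continuous_comp; [exact: cV|exact: cg].
  have /cvgrPdist_lt/(_ e e0)[dl /= dl0 hdl] := cgV.
  (* Staying strictly inside the period avoids the wrap-around of the sampled sequence. *)
  exists (Num.min dl (Num.min t (tp - t))); first by rewrite !lt_min dl0 t0 subr_gt0.
  apply: nearW => n k; rewrite !lt_min => /and3P[k1 k2 k3].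
  rewrite seqof_sample; last by move: k2 k3; rewrite !ltr_norml; lra.
  by rewrite distrC; apply: hdl; rewrite /= distrC.
- apply: nearW => n k; apply: hC; rewrite in_itv/=.
  have h0 := @step_gt0 R n.
  have hs : n.+1%:R * @step R n = tp by rewrite /step mulrCA mulfV ?mulr1// pnatr_eq0.
  by rewrite mulr_ge0 ?ler0n ?(ltW h0)//= -hs ler_pM2r// ler_nat ltnW.
Qed.

Lemma prim_cst1 (x : R) : 0 <= x <= tp -> prim (fun=> 1) x = x.
Proof.
move=> /andP[x0 x1]; rewrite prim_leb; last exact: integ_cst.
have -> : \int[mu]_(y in `]-oo, x]) ((fun=> 1 : R) \_ `[0, tp]) y = \int[mu]_(y in `[0, x]) (1 : R).
  rewrite Rintegral_mkcond [RHS]Rintegral_mkcond; apply: eq_Rintegral => y _.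
  rewrite !patchE !mem_itv !in_itv/=; have [yx|yx] := lerP y x; last by rewrite andbF.
  by rewrite (le_trans yx x1) !andbT.
rewrite Rintegral_cst// mul1r; have := lebesgue_measure_itv `[0, x].
rewrite /= lte_fin; move: x0; rewrite le_eqVlt => /orP[/eqP <-|x0].
  by rewrite ltxx => ->.
by rewrite x0 => ->; rewrite /= subr0.
Qed.

(** Jensen's inequality on the cell from [a] to [b]: the supporting line at the mean slope [m] is
    integrated against the cut-off [W]. *)
Lemma prim_jensen p d (a b : R) : 1 < p -> integ d -> integ (fun x => `|d x| `^ p) ->
  0 <= a -> a < b -> b <= tp ->
  (b - a) * `|(prim d b - prim d a) / (b - a)| `^ p <=
  prim (fun x => `|d x| `^ p) b - prim (fun x => `|d x| `^ p) a.
Proof.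
move=> p1 jd jdp a0 ab b1; have tp0 := twopi_gt0 R.
set m := (_ / _); set D := fun x => `|d x| `^ p.
have ba : 0 < b - a by rewrite subr_gt0.
pose W (x : R) : R := (x <= b)%R%:R - (x <= a)%R%:R.
have iW f : integ f -> integ (fun x => f x * W x).
  move=> jf; under [X in integ X]eq_fun do rewrite mulrBr.
  by apply: integB; exact: integ_cut.
have W0 x : 0 <= W x.
  rewrite /W; have [xa|xa] := lerP x a; last by rewrite subr0 ler0n.
  by rewrite (le_trans xa (ltW ab)) subrr.
have e1 : tp * mean (fun x => 1 * W x) = b - a.
  rewrite -(@primB _ (fun=> 1)) ?prim_cst1//; last exact: integ_cst.
  - by rewrite a0 (le_trans (ltW ab)).
  - by rewrite b1 (le_trans a0 (ltW ab)).
have e2 : tp * mean (fun x => d x * W x) = m * (b - a).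
  by rewrite -primB// /m divfK// gt_eqF.
have i1 := iW _ (integ_cst (1 : R)); have i2 := iW _ jd.
have -> : (b - a) * `|m| `^ p = tp * mean (fun x =>
    (`|m| `^ p - p * spow (p - 1) m * m) * (1 * W x) + p * spow (p - 1) m * (d x * W x)).
  rewrite meanD; [|exact: integZ|exact: integZ].
  by rewrite (meanZ _ i1) (meanZ _ i2) mulrDr !(mulrCA tp) e1 e2; ring.
rewrite primB// ler_pM2l//; apply: mean_le; [by apply: integD; exact: integZ|exact: iW|].
apply: aeW => x; have := ler_wpM2r (W0 x) (powR_tangent m (d x) p1).
by apply: le_trans; rewrite le_eqVlt; apply/orP; left; apply/eqP; ring.
Qed.

(** Sampling does not increase the energy: Jensen's inequality on each cell, then telescoping. This
    direction suffices, since a negative value has to stay negative. *)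
Lemma sample_slope p d (c : R) n : 1 < p -> integ d -> integ (fun x => `|d x| `^ p) ->
  mean d = 0 ->
  dpow p (dslope (sample (fun x => c + prim d x) (n := n))) <= mean (fun x => `|d x| `^ p).
Proof.
move=> p1 jd jdp md; have tp0 := twopi_gt0 R; have h0 := @step_gt0 R n.
have hs : n.+1%:R * @step R n = tp by rewrite /step mulrCA mulfV ?mulr1// pnatr_eq0.
set D := fun x => `|d x| `^ p.
have E (i : 'I_n.+1) : dslope (sample (fun x => c + prim d x) (n := n)) i =
    (prim d (i.+1%:R * @step R n) - prim d (i%:R * @step R n)) / @step R n.
  rewrite /dslope /sample; congr (_ / _); rewrite opprD addrACA subrr add0r; congr (_ - _).
  (* The last cell wraps around to node 0, where [prim d] agrees with its value at [tp] because
     [mean d = 0]. *)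
  rewrite /=; have := ltn_ord i; rewrite leq_eqVlt => /orP[/eqP[ii]|ii].
    by rewrite ii modnn mul0r prim0// hs prim_tp ?md ?mulr0.
  by rewrite modn_small.
rewrite /dpow /dmean.
apply: (@le_trans _ _ (n.+1%:R^-1 * \sum_(i < n.+1)
    (@step R n)^-1 * (prim D (i.+1%:R * @step R n) - prim D (i%:R * @step R n)))).
  rewrite ler_pM2l ?invr_gt0 ?ltr0n//; apply: ler_sum => i _; rewrite E.
  have e : @step R n = i.+1%:R * @step R n - i%:R * @step R n.
    by rewrite -mulrBl -natr1 addrAC subrr add0r mul1r.
  rewrite ler_pdivlMl//.
  have := @prim_jensen p d (i%:R * @step R n) (i.+1%:R * @step R n) p1 jd jdp.
  rewrite -e; apply.
  - by rewrite mulr_ge0// ltW.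
  - by rewrite ltr_pM2r// ltr_nat.
  - by rewrite -hs ler_pM2r// ler_nat ltn_ord.
rewrite -mulr_sumr -(big_mkord xpredT (fun i => prim D (i.+1%:R * @step R n) - prim D (i%:R * @step R n))).
rewrite telescope_sumr// hs mul0r prim_tp// prim0// subr0.
rewrite le_eqVlt; apply/orP; left; apply/eqP; rewrite -{1}hs.
have : (n.+1%:R : R) != 0 by rewrite pnatr_eq0.
clear -h0; move: (n.+1%:R) (step n) h0 (mean D) => N y y0 z N0.
by field; rewrite N0 gt_eqF.
Qed.

Lemma sample_negative p r s A eps c d del : 1 < p -> 0 < r -> 0 < s -> 0 <= A ->
  integ d -> integ (fun x => `|d x| `^ p) -> mean d = 0 ->
  let V x := c + prim d x in
  (mean (fun x => `|d x| `^ p)) `^ (2 / p) +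
    A * ((mean (fun x => `|V x| `^ r)) `^ (2 / r) - (mean (fun x => `|V x| `^ s)) `^ (2 / s)) +
    (mean (fun x => `|V x| `^ s)) ^+ 2 - eps * mean V < del ->
  \forall n \near U, exists f : 'I_n.+1 -> R, dJ p r s A eps f <= del.
Proof.
move=> p1 r0 s0 A0 jd jdp md V hdel.
have p0 : 0 < p by rewrite (lt_trans _ p1).
have cV : continuous V.
  by move=> x; apply: cvgD; [exact: cvg_cst|exact: prim_continuous].
have cpow a : 0 < a -> continuous (fun z : R => `|z| `^ a).
  by move=> a0 z; exact: normr_continuous_powR.
have lim g : continuous g ->
    dmean (fun i => g (@sample V n i)) @[n --> U] --> mean (fun x => g (V x)).
  move=> cg; have cgV : continuous (fun x => g (V x)).
    by move=> x; apply: continuous_comp; [exact: cV|exact: cg].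
  have [C hC] := continuous_le_circle cgV; exact: (sample_mean cg cV hC).
have ge a n : 0 <= dpow a (@sample V n) by exact: dpow_ge0.
have lr := lim _ (cpow r r0); have ls := lim _ (cpow s s0).
have lm : dmean (@sample V n) @[n --> U] --> mean V.
  by apply: (lim id) => z; exact: cvg_id.
pose D := (mean (fun x => `|d x| `^ p)) `^ (2 / p).
pose K n := D + A * ((dpow r (@sample V n)) `^ (2 / r) - (dpow s (@sample V n)) `^ (2 / s)) +
    (dpow s (@sample V n)) ^+ 2 - eps * dmean (@sample V n).
have JE : K n @[n --> U] -->
    D + A * ((mean (fun x => `|V x| `^ r)) `^ (2 / r) - (mean (fun x => `|V x| `^ s)) `^ (2 / s)) +
    (mean (fun x => `|V x| `^ s)) ^+ 2 - eps * mean V.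
  have r2 : 0 < 2 / r by rewrite divr_gt0.
  have s2 : 0 < 2 / s by rewrite divr_gt0.
  apply: cvgB; last by apply: cvgM; [exact: cvg_cst|exact: lm].
  apply: cvgD; last by apply: cvgM; exact: ls.
  apply: cvgD; first exact: cvg_cst.
  apply: cvgM; first exact: cvg_cst.
  by apply: cvgB; [exact: (cvg_powR_ge0 _ r2 (ge r) lr)|exact: (cvg_powR_ge0 _ s2 (ge s) ls)].
have JL : \forall n \near U, K n < del by exact: (cvgr_lt _ JE _ hdel).
apply: filterS JL => n h.
exists (sample V (n := n)); apply: le_trans (ltW h).
rewrite /dJ lerD2r lerD2r lerD2r; apply: ge0_ler_powR.
- by rewrite divr_ge0// ltW.
- by rewrite nnegrE dpow_ge0.
- by rewrite nnegrE; apply: mean_ge0 => x; exact: powR_ge0.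
- exact: sample_slope.
Qed.

End Sampling.

(** * The inequality for [q] different from [p] *)

Section Subcritical.
Variable R : realType.
Local Notation tp := (pi *+ 2 : R).
Implicit Types u du : R -> R.

Lemma constants_bound (s eps eta c : R) : 2 < s -> 0 <= eps -> eps <= 1 -> eps <= eta / 2 ->
  - (eta / 2) <= (`|c| `^ s) ^+ 2 - eps * c.
Proof.
move=> s2 e0 e1 e2; have h0 : 0 <= (`|c| `^ s) ^+ 2 by exact: sqr_ge0.
have ec : eps * c <= eps * `|c| by rewrite ler_wpM2l// ler_norm.
have [c1|c1] := lerP `|c| 1.
  have : eps * `|c| <= eps by rewrite -[leRHS]mulr1 ler_wpM2l.
  by move: (eps * c) (eps * `|c|) (_ ^+ 2) h0 ec => *; lra.
have h1 : `|c| <= `|c| `^ s.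
  rewrite -{1}(@powRr1 _ `|c|)//; apply: ler_powR; first exact: ltW.
  by lra.
have h2 : `|c| <= (`|c| `^ s) ^+ 2.
  by rewrite expr2 (le_trans h1)// -[leLHS]mulr1 ler_pM2l; lra.
have : eps * `|c| <= `|c| by rewrite -[leRHS]mul1r ler_wpM2r.
have : 0 <= eta / 2 by lra.
by move: (eps * c) (eps * `|c|) (_ ^+ 2) h2 ec => *; lra.
Qed.

(** Both orders of [p] and [q] are covered by [r] and [s], because [1 / (p - q)] and the difference
    of the squared norms change sign together. *)
Lemma no_negative (p q r s A L eps eta c : R) d : 2 < p -> p - 1 < q -> q != p ->
  r = Num.min p q -> s = Num.max p q -> A = L / (s - r) ->
  0 < L -> L < rayleigh_inf p p -> 0 < eps -> eps <= 1 -> eps <= eta / 2 -> 0 < eta ->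
  integ d -> integ (fun x => `|d x| `^ p) -> mean d = 0 ->
  let V x := c + prim d x in
  (mean (fun x => `|d x| `^ p)) `^ (2 / p) +
    A * ((mean (fun x => `|V x| `^ r)) `^ (2 / r) - (mean (fun x => `|V x| `^ s)) `^ (2 / s)) +
    (mean (fun x => `|V x| `^ s)) ^+ 2 - eps * mean V < - eta -> False.
Proof.
move=> p2 pq qp rE sE AE L0 Ll e0 e1 e2 eta0 jd jdp md V hV.
have rs : r < s.
  by rewrite rE sE gt_min !lt_max !ltxx/= orbF -neq_lt eq_sym.
have r1 : 1 < r.
  by rewrite rE lt_min (lt_trans _ p2) ?ltr1n// (le_lt_trans _ pq)// lerBrDr ltW.
have s2 : 2 < s by rewrite sE lt_max p2.
have A0 : 0 < A by rewrite AE divr_gt0// subr_gt0.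
have [U [UU Uoo]] := ultraFilterLemma (eventually_filter : ProperFilter \oo).
have p1 : 1 < p by rewrite (lt_trans _ p2)// ltr1n.
have p0 : 0 < p by rewrite (lt_trans _ p1).
have r0 : 0 < r by rewrite (lt_trans _ r1).
have s0 : 0 < s by rewrite (lt_trans _ rs).
have hneg : \forall n \near U, exists f : 'I_n.+1 -> R, dJ p r s A eps f <= - eta.
  exact: (sample_negative Uoo p1 r0 s0 (ltW A0) jd jdp md hV).
have [u [w]] := discrete_limit Uoo p2 r1 rs s2 A0 (ltW e0) eta0
  (fun z => @constants_bound s eps eta z s2 (ltW e0) e1 e2) hneg.
set E := mean _; set Pr := mean _; set Ps := mean _.
move=> [[cu cw u0] [[ut wt E0 Pr0 Ps0] [du dw]]].
have tp0 := twopi_gt0 R.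
pose B := E `^ (1 - 2 / p).
have B0 : 0 < B by rewrite powR_gt0.
pose P := mean (fun x => `|u x| `^ p).
(* For [p < q] the penalty enters [b] alone and the bound on [c0 * (p - q)] is an equality. For
   [q < p] it enters [c0] and lowers it by [B * p * Ps]. *)
have [b [c0 [e [ep0 kE hc P0]]]] : exists b c0 e, [/\ 0 < e,
    forall y, B * (A * Pr `^ (2 / r - 1) * y `^ (r - 1) -
      (A * Ps `^ (2 / s - 1) - s * Ps) * y `^ (s - 1) - eps / 2) =
      b * y `^ (q - 1) - c0 * y `^ (p - 1) - e,
    c0 * (p - q) <= L * B * P `^ (2 / p - 1) & 0 < P].
  have ee : 0 < B * (eps / 2) by rewrite mulr_gt0// divr_gt0.
  have [pq'|pq'] := ltP p q.
    have [rp sq] : r = p /\ s = q by rewrite rE sE min_l ?max_r// ltW.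
    exists (- (B * (A * Ps `^ (2 / s - 1) - s * Ps))), (- (B * (A * Pr `^ (2 / r - 1)))), (B * (eps / 2)).
    split; first exact: ee.
    - by move=> y; rewrite rp sq; move: (y `^ _) (y `^ _) (Ps `^ _) (Pr `^ _) => *; ring.
    - have -> : P = Pr by rewrite /Pr rp.
      rewrite AE rp sq le_eqVlt; apply/orP; left; apply/eqP.
      have h : q - p != 0 by rewrite subr_eq0.
      by move: (Pr `^ _) (B) => y z; clear -h; field.
    - by move: Pr0; rewrite /Pr rp.
  have {}pq' : q < p by rewrite lt_neqAle qp.
  have [rp sq] : r = q /\ s = p by rewrite rE sE min_r ?max_l// ltW.
  exists (B * (A * Pr `^ (2 / r - 1))), (B * (A * Ps `^ (2 / s - 1) - s * Ps)), (B * (eps / 2)).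
  have PP : P = Ps by rewrite /Ps sq.
  split; first exact: ee.
  - by move=> y; rewrite rp sq; move: (y `^ _) (y `^ _) (Ps `^ _) (Pr `^ _) => *; ring.
  - rewrite PP AE rp sq.
    have h : 0 < p - q by rewrite subr_gt0.
    have -> : B * (L / (p - q) * Ps `^ (2 / p - 1) - p * Ps) * (p - q) =
        L * B * Ps `^ (2 / p - 1) - B * p * Ps * (p - q).
      by move: (Ps `^ _) => y; clear -h; field; rewrite gt_eqF.
    rewrite gerBl; apply: mulr_ge0; last exact: ltW.
    by apply: mulr_ge0; [exact: (mulr_ge0 (ltW B0) (ltW p0))|exact: ltW].
  - by rewrite PP; exact: Ps0.
pose k (y : R) := b * `|y| `^ (q - 1) - c0 * `|y| `^ (p - 1) - e.
have q10 : 0 < q - 1 by rewrite subr_gt0 (le_lt_trans _ pq)// lerBrDr ltW.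
have p10 : 0 < p - 1 by rewrite subr_gt0.
have ck : continuous k.
  move=> y; apply: cvgB; last exact: cvg_cst.
  by apply: cvgB; (apply: cvgM; [exact: cvg_cst|exact: normr_continuous_powR]).
have dw' x : - tp < x -> is_derive x 1 w (k (u x)).
  by move=> hx; have := dw x hx; rewrite kE /k (ger0_norm (u0 x)).
have k0 : k 0 = - e.
  by rewrite /k normr0 !powR0 ?gt_eqF// !mulr0 subrr sub0r.
have upos := solution_pos p2 ep0 cu u0 ck k0 du dw'.
have cu' : {within `[0, tp], continuous u} by exact: continuous_subspaceT.
have [x0 x0i hmin] := EVT_min (ltW tp0) cu'.
have tpx x : x \in `[0, tp] -> - tp < x.
  by rewrite in_itv/= => /andP[h _]; rewrite (lt_le_trans _ h)// oppr_lt0.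
(* Cutting [u] off from below at its minimum over the period makes it positive on the line and
   leaves it unchanged on the period. *)
pose v x := Num.max (u x) (u x0).
have ux0 : 0 < u x0 by apply: upos; exact: tpx.
have cv : continuous v.
  by move=> x; apply: continuous_max; [exact: cu|exact: cvg_cst].
have v0 x : 0 < v x by rewrite lt_max ux0 orbT.
have uv x : x \in `[0, tp] -> u x = v x.
  by move=> hx; rewrite /v max_l// hmin.
apply: (@rigidity_contradiction _ p q b c0 e L u v w p2 pq (ltW ep0) cv cw v0 cu uv ut wt _ _ E0 P0 L0 Ll hc).
- by move=> x /tpx; exact: du.
- by move=> x hx; have := dw x (tpx x hx); rewrite kE (uv x hx).
Qed.

(* Scaling down [u] makes the quartic penalty term negligible. *)
Lemma functional_ge0 (p q r s L : R) u du : 2 < p -> p - 1 < q -> q != p ->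
  r = Num.min p q -> s = Num.max p q ->
  0 < L -> L < rayleigh_inf p p -> W1p p u du ->
  0 <= (mean (fun x => `|du x| `^ p)) `^ (2 / p) +
    L / (s - r) * ((mean (fun x => `|u x| `^ r)) `^ (2 / r) -
      (mean (fun x => `|u x| `^ s)) `^ (2 / s)).
Proof.
move=> p2 pq qp rE sE L0 Ll H; rewrite leNgt; apply/negP.
have p1 : 1 < p by rewrite (lt_trans _ p2)// ltr1n.
have [iu jd jdp] := W1p_integ (ltW p1) H.
have [md [c hc]] := W1p_repr (ltW p1) H.
have r1 : 1 < r.
  by rewrite rE lt_min (lt_trans _ p2) ?ltr1n// (le_lt_trans _ pq)// lerBrDr ltW.
have s2 : 2 < s by rewrite sE lt_max p2.
have r0 : 0 < r by rewrite (lt_trans _ r1).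
have s0 : 0 < s by rewrite (lt_trans _ s2).
pose V x := c + prim du x.
have cV : continuous V.
  by move=> x; apply: cvgD; [exact: cvg_cst|exact: prim_continuous].
have mV a : mean (fun x => `|u x| `^ a) = mean (fun x => `|V x| `^ a).
  apply: mean_ae.
  - by apply: meas_normr_powR; exact: integ_meas.
  - by apply: meas_normr_powR; exact: continuous_meas.
  - by apply: ae_imp hc => x ->.
rewrite !mV.
set F := _ + _ => F0.
pose Ps := mean (fun x => `|V x| `^ s).
(* Under scaling by [t <= 1] the value [F] gains [t ^ 2], and the penalty at most [t ^ 3]; this [t]
   keeps the sum negative. *)
pose t := Num.min 1 (- F / (2 * (1 + Ps ^+ 2))).
have Ps0 : 0 <= Ps ^+ 2 by exact: sqr_ge0.
have t0 : 0 < t by rewrite lt_min ltr01 divr_gt0//; lra.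
have t1 : t <= 1 by rewrite ge_min lexx.
have tF : F + t * Ps ^+ 2 < 0.
  have h : t * (2 * (1 + Ps ^+ 2)) <= - F.
    by rewrite -ler_pdivlMr ?ge_min ?lexx ?orbT//; lra.
  have e : t * (2 * (1 + Ps ^+ 2)) = 2 * t + 2 * (t * Ps ^+ 2) by ring.
  rewrite e in h; move: (t * Ps ^+ 2) (mulr_ge0 (ltW t0) Ps0) h => y y0 h.
  by clear -t0 y0 h; lra.
(* Minus a quarter of the penalized value, which leaves room for the linear term. *)
pose eta := - (t ^+ 2 * F + (t `^ s * Ps) ^+ 2) / 4.
have eta0 : 0 < eta.
  have ts : (t `^ s) ^+ 2 <= t ^+ 2 * t.
    have ts2 : t `^ s <= t ^+ 2.
      have -> : s = 2%:R + (s - 2) by rewrite addrC subrK.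
      rewrite powRD; last by apply/implyP => _; rewrite gt_eqF.
      rewrite powR_mulrn ?(ltW t0)// -[leRHS]mulr1 ler_pM2l ?exprn_gt0//.
      rewrite [leRHS](_ : 1 = 1 `^ (s - 2)); last by rewrite powR1.
      apply: ge0_ler_powR; rewrite ?nnegrE ?subr_ge0 ?(ltW s2) ?(ltW t0)//.
    have : (t `^ s) ^+ 2 <= (t ^+ 2) ^+ 2 by rewrite lerXn2r ?nnegrE ?powR_ge0 ?exprn_ge0 ?(ltW t0).
    move=> h; apply: (le_trans h); rewrite [X in X <= _]expr2 ler_pM2l ?exprn_gt0//.
    by rewrite expr2 -[leRHS]mulr1 ler_pM2l.
  have t2 : 0 < t ^+ 2 by rewrite exprn_gt0.
  have h1 := ler_wpM2r Ps0 ts.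
  have h2 : t ^+ 2 * (F + t * Ps ^+ 2) < 0 by rewrite pmulr_rlt0.
  rewrite divr_gt0// oppr_gt0 exprMn; apply: le_lt_trans h2.
  by rewrite [leRHS]mulrDr lerD2l mulrA.
pose M := mean (fun x => t * c + prim (fun y => t * du y) x).
(* The first two bounds serve [constants_bound]; the third keeps [eps * M] within [eta]. *)
pose eps := Num.min 1 (Num.min (eta / 2) (eta / (1 + `|M|))).
have eps0 : 0 < eps.
  have M1 : 0 < 1 + `|M| by rewrite ltr_pwDl.
  by rewrite /eps !lt_min ltr01 (divr_gt0 eta0 M1) (divr_gt0 eta0 (ltr0Sn R 1)).
have e1 : eps <= 1 by rewrite ge_min lexx.
have e2 : eps <= eta / 2 by rewrite !ge_min lexx orbT.
have eM : - (eps * M) <= eta.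
  have h1 : eps * (1 + `|M|) <= eta.
    by rewrite -ler_pdivlMr ?ltr_pwDl// /eps !ge_min lexx !orbT.
  rewrite -mulrN (le_trans _ h1)// ler_wpM2l ?(ltW eps0)//.
  by rewrite (le_trans (ler_norm _))// normrN lerDr.
have tn a y : `|t * y| `^ a = t `^ a * `|y| `^ a.
  by rewrite normrM powRM// gtr0_norm.
have mt a f : integ (fun x => `|f x| `^ a) ->
    mean (fun x => `|t * f x| `^ a) = t `^ a * mean (fun x => `|f x| `^ a).
  by move=> jf; under eq_mean do rewrite tn; rewrite meanZ.
have VE x : t * c + prim (fun y => t * du y) x = t * V x.
  rewrite /V [RHS]mulrDr; congr (_ + _).
  rewrite /prim [RHS]mulrCA -(meanZ t (integ_cut x jd)); congr (_ * _).
  by apply: eq_mean => y; rewrite mulrA.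
have jV a : 0 < a -> integ (fun x => `|V x| `^ a).
  move=> a0; apply: integ_continuous => x.
  apply: (@continuous_comp _ _ _ V (fun z => `|z| `^ a)); first exact: cV.
  exact: normr_continuous_powR.
have pw a m : 0 < a -> 0 <= m -> (t `^ a * m) `^ (2 / a) = t ^+ 2 * m `^ (2 / a).
  move=> a0 m0; rewrite powRM ?powR_ge0// -powRrM mulrCA mulfV ?mulr1 ?gt_eqF//.
  by rewrite powR_mulrn// ltW.
apply: (@no_negative p q r s (L / (s - r)) L eps eta (t * c) (fun x => t * du x)) => //.
- exact: integZ.
- by under [X in integ X]eq_fun do rewrite tn; exact: integZ.
- by rewrite meanZ// md mulr0.
rewrite -/M.
have E1 a : (fun x => `|t * c + prim (fun y => t * du y) x| `^ a) = fun x => `|t * V x| `^ a.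
  by apply/funext => x; rewrite VE.
have m0 a (f : R -> R) : 0 <= mean (fun x => `|f x| `^ a) by apply: mean_ge0 => x; exact: powR_ge0.
rewrite !E1 !mt//; [|exact: jV|exact: jV].
have p0 : 0 < p by rewrite (lt_trans _ p1).
rewrite (pw p (mean (fun x => `|du x| `^ p)) p0 (m0 _ _))
  (pw r (mean (fun x => `|V x| `^ r)) r0 (m0 _ _)) (pw s Ps s0 (m0 _ _)) -/Ps.
have -> (y z1 z2 z : R) : t ^+ 2 * y + z * (t ^+ 2 * z1 - t ^+ 2 * z2) =
  t ^+ 2 * (y + z * (z1 - z2)) by ring.
rewrite -/F.
have -> : t ^+ 2 * F + (t `^ s * Ps) ^+ 2 = - (4 * eta) by rewrite /eta; field.
by move: (eps * M) eM eta0 => z; clear; lra.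
Qed.

End Subcritical.

(** * Constants below the Rayleigh infimum, and the logarithmic inequality *)

Section Below.
Variable R : realType.
Implicit Types u du : R -> R.

Lemma le_of_perturbation (K X C : R) :
  (forall t, 0 < t <= 1 -> K <= X + t * C) -> K <= X.
Proof.
move=> h; rewrite leNgt; apply/negP => XK.
have C1 : 0 < 2 * (1 + `|C|) by rewrite mulr_gt0// ltr_pwDl.
pose t := Num.min 1 ((K - X) / (2 * (1 + `|C|))).
have t0 : 0 < t by rewrite /t lt_min ltr01 divr_gt0// subr_gt0.
have t1 : t <= 1 by rewrite /t ge_min lexx.
have tK : t * (2 * (1 + `|C|)) <= K - X by rewrite -ler_pdivlMr// /t ge_min lexx orbT.
have tC : t * C <= t * `|C| by rewrite ler_pM2l// ler_norm.
have := h t; rewrite t0 t1 => /(_ isT).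
have e : t * (2 * (1 + `|C|)) = 2 * t + 2 * (t * `|C|) by ring.
have tC0 : 0 <= t * `|C| by rewrite mulr_ge0// ltW.
rewrite e in tK; move: (t * C) (t * `|C|) tK tC tC0 t0 XK; clear => *; lra.
Qed.

(** Convexity in the exponent, from the tangent of the exponential. It is the link between the
    entropy and differences of powers. *)
Lemma powR_ge_tangent (a p q : R) : 0 <= a -> 0 < p -> 0 < q ->
  a `^ p * (1 + (q - p) * ln a) <= a `^ q.
Proof.
rewrite le_eqVlt => /orP[/eqP <-|a0] p0 q0; first by rewrite !powR0 ?gt_eqF// mul0r.
have -> : a `^ q = a `^ p * a `^ (q - p).
  by rewrite -powRD; [congr (_ `^ _); ring|apply/implyP => _; rewrite gt_eqF].
rewrite ler_pM2l ?powR_gt0// /powR gt_eqF//.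
exact: expR_ge1Dx.
Qed.

Lemma integ_entropy p u du : 1 < p -> W1p p u du ->
  integ (fun x => `|u x| `^ p * ln `|u x|).
Proof.
move=> p1 H; have [p0 p10] : 0 < p /\ 0 < p - 1 by split; lra.
have i a (a0 : 0 < a) := W1p_integ_powR (ltW p1) a0 H.
have mu' : measurable_fun setT u by have [iu _ _] := W1p_integ (ltW p1) H; exact: integ_meas.
apply: (@integ_le _ _ (fun x => `|u x| `^ (p + 1) + (`|u x| `^ p + `|u x| `^ (p - 1)))).
- apply: measurable_funM; first exact: meas_normr_powR.
  by apply: measurableT_comp; [exact: measurable_ln|exact: measurableT_comp].
- move=> x.
  (* The exponents [p + 1] and [p - 1] bound the entropy density from above and from below. *)
  have h1 := @powR_ge_tangent `|u x| p (p + 1) (normr_ge0 _) p0 (addr_gt0 p0 ltr01).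
  have h2 := @powR_ge_tangent `|u x| p (p - 1) (normr_ge0 _) p0 p10.
  move: h1 h2; rewrite ![_ + _ - p]addrAC subrr add0r.
  have := powR_ge0 `|u x| p; have := powR_ge0 `|u x| (p - 1); have := powR_ge0 `|u x| (p + 1).
  move: (`|u x| `^ p) (`|u x| `^ (p - 1)) (`|u x| `^ (p + 1)) (ln _) => y1 y2 y3 z.
  by clear => *; rewrite ler_norml; lra.
- by apply: integD; [apply: i; lra|apply: integD; exact: i].
Qed.

Lemma integ_log_quotient p N u du : 1 < p -> 0 < N -> W1p p u du ->
  integ (fun x => `|u x| `^ p * ln (`|u x| / N)).
Proof.
move=> p1 N0 H; have p0 : 0 < p by rewrite (lt_trans _ p1).
have := integB (integ_entropy p1 H) (integZ (ln N) (W1p_integ_powR (ltW p1) p0 H)).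
congr integ; apply/funext => x; have [->|ux] := eqVneq (u x) 0.
  by rewrite normr0 powR0 ?gt_eqF// !mul0r mulr0 subrr.
by rewrite ln_div ?posrE ?normr_gt0// mulrBr [ln N * _]mulrC.
Qed.

Lemma interp_neq p q L u du : 2 < p -> p - 1 < q -> q != p ->
  0 < L -> L < rayleigh_inf p p -> W1p p u du ->
  L / (p - q) * (Lr_norm p u ^+ 2 - Lr_norm q u ^+ 2) <= Lr_norm p du ^+ 2.
Proof.
move=> p2 pq qp L0 Ll H; rewrite !Lr_norm_sqr.
have := functional_ge0 p2 pq qp erefl erefl L0 Ll H.
have [pq'|pq'] := ltP p q; move=> h; rewrite -subr_ge0.
  have e (y1 y2 y3 : R) : y1 - L / (p - q) * (y2 - y3) = y1 + L / (q - p) * (y2 - y3).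
    by rewrite -(opprB q) invrN mulrN mulNr opprK.
  by rewrite e.
have e (y1 y2 y3 : R) : y1 - L / (p - q) * (y2 - y3) = y1 + L / (p - q) * (y3 - y2).
  by rewrite -mulrN opprB.
by rewrite e.
Qed.

(** Bernoulli's inequality fails for the exponents [a = 2 / q < 1] to which this is applied. It
    follows from [x / (1 + x) <= ln (1 + x)], and the lost factor [1 + x] tends to 1 in the
    application. *)
Lemma powR_frac_ge (x a : R) : 0 < x -> 0 < a -> a * x / (1 + x) <= (1 + x) `^ a - 1.
Proof.
move=> x0 a0; have x1 : 0 < 1 + x by lra.
have h1 : 1 + a * ln (1 + x) <= (1 + x) `^ a.
  by rewrite /powR gt_eqF//; exact: expR_ge1Dx.
have h2 : x / (1 + x) <= ln (1 + x).
  have e : 1 + - (x / (1 + x)) = (1 + x)^-1 by field; rewrite gt_eqF.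
  have := @le_ln1Dx _ (- (x / (1 + x))); rewrite e lnV ?posrE// lerN2; apply.
  by rewrite ltrN2 ltr_pdivrMr// mul1r ltrDr ltr01.
have : a * (x / (1 + x)) <= a * ln (1 + x) by rewrite ler_pM2l.
by rewrite mulrA; move: (a * ln _) (_ / (1 + x)) (_ `^ a) h1 => *; lra.
Qed.

(* Letting [q] decrease to [p] in the case [q > p]. *)
Lemma interp_log_normalized p L u du : 2 < p -> 0 < L -> L < rayleigh_inf p p ->
  W1p p u du -> mean (fun x => `|u x| `^ p) = 1 ->
  2 / p * L * mean (fun x => `|u x| `^ p * ln `|u x|) <= Lr_norm p du ^+ 2.
Proof.
move=> p2 L0 Ll H u1.
have p1 : 1 < p by rewrite (lt_trans _ p2)// ltr1n.
have p0 : 0 < p by rewrite (lt_trans _ p1).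
have jent := integ_entropy p1 H.
have D0 : 0 <= Lr_norm p du ^+ 2 by exact: sqr_ge0.
set D := Lr_norm p du ^+ 2 in D0 *; set Ent := mean _.
have [E0|E0] := lerP Ent 0.
  apply: (le_trans _ D0).
  by rewrite mulr_ge0_le0// mulr_ge0 ?divr_ge0 ?(ltW L0) ?(ltW p0).
suff : 2 * L * Ent <= D * p.
  by rewrite -ler_pdivrMr// => h; apply: le_trans h; rewrite le_eqVlt; apply/orP; left; apply/eqP; ring.
(* The remainder in the expansion of [D * ((p + t) * (1 + t * Ent))], with [t ^ 2] estimated by
   [t]. *)
apply: (@le_of_perturbation _ _ (D + D * p * Ent + D * Ent)) => t /andP[t0 t1].
pose q := p + t.
have pq : p - 1 < q by rewrite /q; lra.
have qp : q != p by rewrite /q -subr_eq0 addrAC subrr add0r gt_eqF.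
have q0 : 0 < q by rewrite /q; lra.
have := interp_neq p2 pq qp L0 Ll H.
rewrite !Lr_norm_sqr u1 powR1 -/(Lr_norm p du) -(Lr_norm_sqr p du) -/D.
have -> : p - q = - t by rewrite /q; ring.
have tE : 0 < t * Ent by exact: mulr_gt0 t0 E0.
have h1 : 1 + t * Ent <= mean (fun x => `|u x| `^ q).
  have -> : 1 + t * Ent = mean (fun x => `|u x| `^ p + t * (`|u x| `^ p * ln `|u x|)).
    rewrite meanD ?meanZ ?u1//; last exact: integZ.
    exact: W1p_integ_powR (ltW p1) p0 H.
  apply: mean_le.
  - by apply: integD; [exact: W1p_integ_powR (ltW p1) p0 H|exact: integZ].
  - exact: W1p_integ_powR (ltW p1) q0 H.
  apply: aeW => x; have := @powR_ge_tangent `|u x| p q (normr_ge0 _) p0 q0.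
  by rewrite /q addrAC subrr add0r mulrDr mulr1 mulrCA.
have h2 : (1 + t * Ent) `^ (2 / q) <= mean (fun x => `|u x| `^ q) `^ (2 / q).
  have e : 0 <= 1 + t * Ent by rewrite addr_ge0// ltW.
  by apply: ge0_ler_powR; rewrite ?nnegrE ?(le_trans e h1)// divr_ge0// ltW.
have q2 : 0 < 2 / q by rewrite divr_gt0.
have h3 := powR_frac_ge tE q2.
move=> h4.
have h5 : L / t * (2 / q * (t * Ent) / (1 + t * Ent)) <= D.
  apply: le_trans h4; rewrite invrN mulrN mulNr -mulrN opprB ler_pM2l ?divr_gt0//.
  by apply: (le_trans h3); rewrite lerB.
have h6 : 2 * L * Ent <= D * (q * (1 + t * Ent)).
  rewrite -ler_pdivrMr; last by rewrite mulr_gt0// addr_gt0.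
  apply: le_trans h5; rewrite le_eqVlt; apply/orP; left; apply/eqP.
  by field; rewrite !gt_eqF// addr_gt0.
apply: (le_trans h6); rewrite /q.
have -> : D * ((p + t) * (1 + t * Ent)) = D * p + t * (D + D * p * Ent + t * (D * Ent)) by ring.
rewrite lerD2l ler_pM2l// lerD2l -[leRHS]mul1r; apply: ler_wpM2r => //.
by apply: mulr_ge0 => //; exact: ltW.
Qed.

(** Both sides of the logarithmic inequality are homogeneous of degree 2, which reduces it to
    functions of norm one. *)
Lemma interp_lt_lambda1 p q L : 2 < p -> p - 1 < q -> 0 < L -> L < lambda1 p ->
  @interpolation_inequality R p q L.
Proof.
move=> p2 pq L0 Ll; split=> [qp u du H|_ u du H nz]; first exact: interp_neq.
have p1 : 1 < p by rewrite (lt_trans _ p2)// ltr1n.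
have p0 : 0 < p by rewrite (lt_trans _ p1).
set N := Lr_norm p u.
have N0 : 0 < N by exact: nonzero_Lr_norm_gt0 (ltW p1) p0 H nz.
have Nn (a : R) (f : R -> R) : (fun x => `|N^-1 * f x| `^ a) = fun x => N `^ (- a) * `|f x| `^ a.
  apply/funext => x; rewrite normrM powRM// gtr0_norm ?invr_gt0//; congr (_ * _).
  by rewrite powRN -(powR_inv1 (ltW N0)) -powRrM mulN1r powRN.
have H' : W1p p (fun x => N^-1 * u x) (fun x => N^-1 * du x).
  by have := W1p_affine 0 N^-1 (ltW p1) H; under eq_fun do rewrite add0r.
have [iu jd jdp] := W1p_integ (ltW p1) H.
have jp := W1p_integ_powR (ltW p1) p0 H.
have n1 : mean (fun x => `|N^-1 * u x| `^ p) = 1.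
  by rewrite Nn meanZ// powRN -Lr_norm_pow ?gt_eqF// mulVf// gt_eqF// powR_gt0.
have := interp_log_normalized p2 L0 Ll H' n1.
clearbody N.
have -> : Lr_norm p (fun x => N^-1 * du x) ^+ 2 = N ^- 2 * Lr_norm p du ^+ 2.
  rewrite !Lr_norm_sqr Nn meanZ// powRM ?powR_ge0//; last first.
    by apply: mean_ge0 => x; exact: powR_ge0.
  congr (_ * _); rewrite -powRrM mulNr mulrCA mulfV ?gt_eqF// mulr1 powRN.
  by rewrite powR_mulrn// ltW.
have eE : (fun x => `|N^-1 * u x| `^ p * ln `|N^-1 * u x|) =
    fun x => N `^ (- p) * (`|u x| `^ p * ln (`|u x| / N)).
  apply/funext => x; have /(congr1 (fun f => f x))/= -> := Nn p u.
  by rewrite -mulrA normrM gtr0_norm ?invr_gt0// [N^-1 * _]mulrC.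
rewrite eE.
rewrite meanZ; last exact: integ_log_quotient p1 N0 H.
rewrite ler_pdivlMl ?exprn_gt0//; apply: le_trans.
rewrite -/(mean _) le_eqVlt; apply/orP; left; apply/eqP.
have -> : N `^ (2 - p) = N ^+ 2 * N `^ (- p).
  rewrite powRD; last by apply/implyP => _; rewrite gt_eqF.
  by rewrite powR_mulrn// ltW.
by ring.
Qed.

End Below.

(** * The upper bound by second-order expansion at constants *)

Section Above.
Variable R : realType.
Local Notation sg := (dsigma R).
Implicit Types u du v dv : R -> R.

(** The mean value theorem raises the order of a remainder estimate by one; the Taylor bounds below
    iterate it. *)
Lemma MVT_pow_bound (f df : R -> R) (C : R) (k : nat) : f 0 = 0 -> 0 <= C ->
  (forall z : R, `|z| <= 2^-1 -> is_derive z 1 f (df z)) ->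
  (forall z : R, `|z| <= 2^-1 -> `|df z| <= C * `|z| ^+ k) ->
  forall y : R, `|y| <= 2^-1 -> `|f y| <= C * `|y| ^+ k.+1.
Proof.
move=> f0 C0 d b y hy.
have key (z : R) : `|z| <= `|y| -> `|df z| * `|y| <= C * `|y| ^+ k.+1.
  move=> zy; rewrite exprSr mulrA ler_wpM2r// (le_trans (b z (le_trans zy hy)))//.
  by rewrite ler_wpM2l// lerXn2r ?nnegrE.
have [y0|y0|y0] := ltgtP y 0.
- have [|z /andP[z1 z2] h] := @is_derive_MVT _ f df y 0 y0.
    move=> z; rewrite in_itv/= => /andP[a c]; apply: d.
    by move: hy; rewrite (ltr0_norm y0) ler0_norm//; lra.
  have -> : `|f y| = `|df z| * `|y|.
    by rewrite -normrM; move: h; rewrite f0 !sub0r mulrN => /oppr_inj ->.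
  by apply: key; rewrite !ltr0_norm ?lerN2 ?ltW//; lra.
- have [|z /andP[z1 z2] h] := @is_derive_MVT _ f df 0 y y0.
    move=> z; rewrite in_itv/= => /andP[a c]; apply: d.
    by move: hy; rewrite (gtr0_norm y0) ger0_norm//; lra.
  have -> : `|f y| = `|df z| * `|y|.
    by rewrite -normrM; move: h; rewrite f0 !subr0 => ->.
  by apply: key; rewrite !gtr0_norm ?ltW//; lra.
- by rewrite y0 f0 normr0 mulr_ge0// exprn_ge0.
Qed.

Lemma is_derive_powR1D (a y : R) : `|y| <= 2^-1 ->
  is_derive y 1 (fun y => (1 + y) `^ a) (a * (1 + y) `^ (a - 1)).
Proof.
rewrite ler_norml => /andP[h _]; have y0 : 0 < 1 + y by lra.
have d1 : is_derive y 1 (fun y : R => 1 + y) 1.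
  by have := is_deriveD (is_derive_cst (1 : R) y 1) (is_derive_id y (1 : R)); rewrite add0r.
by have := is_derive_powR_comp a y0 d1; rewrite mulr1.
Qed.

Lemma powR1D_taylor0 (a : R) : exists2 C, 0 <= C &
  forall y : R, `|y| <= 2^-1 -> `|(1 + y) `^ a - 1| <= C * `|y| ^+ 1.
Proof.
(* For [|y| <= 1/2] the logarithm of [1 + y] is at most 1 in absolute value, so the derivative is at
   most this constant. *)
exists (`|a| * expR `|a - 1|); first by rewrite mulr_ge0// expR_ge0.
apply: (@MVT_pow_bound _ (fun y => a * (1 + y) `^ (a - 1))).
- by rewrite addr0 powR1 subrr.
- by rewrite mulr_ge0// expR_ge0.
- move=> z hz; have := is_deriveB (is_derive_powR1D a hz) (is_derive_cst (1 : R) z 1).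
  by rewrite subr0.
- move=> z hz; have : - 2^-1 <= z <= 2^-1 by rewrite -ler_norml.
  move=> /andP[z1 z2]; have z0 : 0 < 1 + z by lra.
  rewrite expr0 mulr1 normrM ler_wpM2l// ger0_norm ?powR_ge0// /powR gt_eqF//.
  rewrite ler_expR (le_trans (ler_norm _))// normrM -[leRHS]mulr1 ler_wpM2l//.
  rewrite ler_norml; apply/andP; split; last first.
    by rewrite (le_trans (le_ln1Dx _))//; lra.
  have e : 0 < (1 + z)^-1 by rewrite invr_gt0.
  have := @le_ln1Dx R ((1 + z)^-1 - 1); rewrite [1 + (_ - 1)]addrC subrK lnV ?posrE// => h.
  have : (1 + z)^-1 <= 2 by rewrite -[2]invrK lef_pV2 ?posrE ?invr_gt0//; lra.
  by have := h; rewrite ltrBrDl subrr => /(_ e); lra.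
Qed.

Lemma powR1D_taylor1 (a : R) : exists2 C, 0 <= C &
  forall y : R, `|y| <= 2^-1 -> `|(1 + y) `^ a - 1 - a * y| <= C * `|y| ^+ 2.
Proof.
have [C C0 hC] := powR1D_taylor0 (a - 1).
exists (`|a| * C); first by rewrite mulr_ge0.
apply: (@MVT_pow_bound _ (fun y => a * ((1 + y) `^ (a - 1) - 1))).
- by rewrite addr0 powR1 subrr mulr0 subrr.
- by rewrite mulr_ge0.
- move=> z hz.
  have := is_deriveB (is_deriveB (is_derive_powR1D a hz) (is_derive_cst (1 : R) z 1))
    (is_deriveZ a (is_derive_id z (1 : R))).
  by rewrite subr0 /GRing.scale/= mulr1 mulrBr mulr1.
- by move=> z hz; rewrite normrM -mulrA ler_wpM2l// hC.
Qed.

Lemma powR1D_taylor2 (a : R) : exists2 C, 0 <= C & forall y : R, `|y| <= 2^-1 ->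
  `|(1 + y) `^ a - 1 - a * y - a * (a - 1) / 2 * y ^+ 2| <= C * `|y| ^+ 3.
Proof.
have [C C0 hC] := powR1D_taylor1 (a - 1).
exists (`|a| * C); first by rewrite mulr_ge0.
apply: (@MVT_pow_bound _ (fun y => a * ((1 + y) `^ (a - 1) - 1 - (a - 1) * y))).
- by rewrite addr0 powR1 subrr expr0n/= !mulr0 !subr0.
- by rewrite mulr_ge0.
- move=> z hz.
  have D := is_deriveB (is_deriveB (is_deriveB (is_derive_powR1D a hz) (is_derive_cst (1 : R) z 1))
    (is_deriveZ a (is_derive_id z (1 : R))))
    (is_deriveZ (a * (a - 1) / 2) (is_deriveX 2 (is_derive_id z (1 : R)))).
  apply: (is_derive_eq D); rewrite /GRing.scale/= expr1 !mulr1 subr0.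
  by move: (_ `^ _) => s; field.
- by move=> z hz; rewrite normrM -mulrA ler_wpM2l// hC.
Qed.

(** That is, [f t = c t^2 + O(t^3)] as [t] decreases to 0. The bound [t0 <= 1] lets higher powers of
    [t] be absorbed. *)
Definition second_order (f : R -> R) (c : R) := exists C t0, [/\ 0 <= C, 0 < t0, t0 <= 1 &
  forall t, 0 < t < t0 -> `|f t - c * t ^+ 2| <= C * t ^+ 3].

Lemma second_orderD f g c d : second_order f c -> second_order g d ->
  second_order (fun t => f t + g t) (c + d).
Proof.
move=> [C [t0 [C0 t00 t01 h]]] [D [s0 [D0 s00 s01 k]]].
exists (C + D), (Num.min t0 s0); rewrite addr_ge0 ?lt_min ?t00 ?s00 ?ge_min ?t01//.
split => // t; rewrite lt_min => /and3P[tt h1 h2].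
have -> : f t + g t - (c + d) * t ^+ 2 = (f t - c * t ^+ 2) + (g t - d * t ^+ 2) by ring.
rewrite (le_trans (ler_normD _ _))// mulrDl lerD//; first by apply: h; rewrite tt.
by apply: k; rewrite tt.
Qed.

Lemma second_orderZ a f c : second_order f c -> second_order (fun t => a * f t) (a * c).
Proof.
move=> [C [t0 [C0 t00 t01 h]]]; exists (`|a| * C), t0; split; rewrite ?mulr_ge0//.
move=> t ht; rewrite -mulrA -mulrBr normrM -mulrA ler_wpM2l//; exact: h.
Qed.

Lemma second_order_bound f c : second_order f c ->
  exists C t0, [/\ 0 <= C, 0 < t0, t0 <= 1 & forall t, 0 < t < t0 -> `|f t| <= C * t ^+ 2].
Proof.
move=> [C [t0 [C0 t00 t01 h]]]; exists (C + `|c|), t0; split=> //; first by rewrite addr_ge0.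
move=> t /andP[tt ht]; have := h t; rewrite tt ht => /(_ isT) {}h.
have -> : f t = (f t - c * t ^+ 2) + c * t ^+ 2 by ring.
rewrite (le_trans (ler_normD _ _))// mulrDl lerD//.
  rewrite (le_trans h)// ler_wpM2l// exprSr -[leRHS]mulr1 ler_wpM2l ?exprn_ge0 ?ltW//.
  exact: lt_le_trans ht t01.
by rewrite normrM ler_wpM2l// ger0_norm// exprn_ge0// ltW.
Qed.

Lemma second_orderM f g c d : second_order (fun t => f t - 1) c ->
  second_order (fun t => g t - 1) d -> second_order (fun t => f t * g t - 1) (c + d).
Proof.
move=> hf hg.
have [C [t0 [C0 t00 t01 h]]] := second_order_bound hf.
have [D [s0 [D0 s00 s01 k]]] := second_order_bound hg.
have hm : second_order (fun t => (f t - 1) * (g t - 1)) 0.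
  exists (C * D), (Num.min t0 s0); rewrite mulr_ge0 ?lt_min ?t00 ?s00 ?ge_min ?t01//.
  split => // t; rewrite lt_min => /and3P[tt h1 h2].
  rewrite mul0r subr0 normrM.
  have a1 : `|f t - 1| <= C * t ^+ 2 by apply: h; rewrite tt.
  have a2 : `|g t - 1| <= D * t ^+ 2 by apply: k; rewrite tt.
  apply: (le_trans (ler_pM (normr_ge0 _) (normr_ge0 _) a1 a2)).
  have -> : C * t ^+ 2 * (D * t ^+ 2) = C * D * (t ^+ 3 * t) by ring.
  rewrite ler_wpM2l ?mulr_ge0// -[leRHS]mulr1 ler_wpM2l ?exprn_ge0 ?ltW//.
  exact: lt_le_trans h1 t01.
have := second_orderD (second_orderD hf hg) hm; rewrite addr0.
by congr second_order; apply/funext => t; ring.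
Qed.

Lemma second_order_powR f c a : second_order (fun t => f t - 1) c ->
  second_order (fun t => f t `^ a - 1) (a * c).
Proof.
move=> hf; have [C [t0 [C0 t00 t01 h]]] := second_order_bound hf.
have [D D0 hD] := powR1D_taylor1 a.
have hm : second_order (fun t => f t `^ a - 1 - a * (f t - 1)) 0.
  have CC : 0 < 2 * (C + 1) by lra.
  (* This radius keeps [|f t - 1|] at most [1/2], the range of the Taylor bound. *)
  exists (D * C ^+ 2), (Num.min t0 (2 * (C + 1))^-1); split.
  - by rewrite mulr_ge0// sqr_ge0.
  - by rewrite lt_min t00 invr_gt0.
  - by rewrite ge_min t01.
  move=> t; rewrite lt_min => /and3P[tt h1 h2]; rewrite mul0r subr0.
  have a1 : `|f t - 1| <= C * t ^+ 2 by apply: h; rewrite tt.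
  have t1 : t <= 1 by rewrite (le_trans (ltW h1)).
  have tC : t * (2 * (C + 1)) <= 1 by rewrite -ler_pdivlMr// mul1r ltW.
  have a2 : `|f t - 1| <= 2^-1.
    apply: (le_trans a1); rewrite expr2.
    have : C * (t * t) <= C * t by rewrite ler_wpM2l// -[leRHS]mulr1 ler_wpM2l// ltW.
    by move: (C * (t * t)) => z; nra.
  have := hD _ a2; rewrite [1 + (_ - 1)]addrC subrK => h3; apply: (le_trans h3).
  rewrite -mulrA ler_wpM2l//.
  have : `|f t - 1| ^+ 2 <= (C * t ^+ 2) ^+ 2.
    by rewrite lerXn2r ?nnegrE// mulr_ge0// exprn_ge0// ltW.
  move=> h4; apply: (le_trans h4); rewrite exprMn ler_wpM2l ?sqr_ge0//.
  have -> : t ^+ 2 ^+ 2 = t ^+ 3 * t by ring.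
  by rewrite -[leRHS]mulr1 ler_wpM2l ?exprn_ge0 ?(ltW tt).
have := second_orderD hm (second_orderZ a hf); rewrite add0r.
by congr second_order; apply/funext => t; ring.
Qed.

Lemma second_order_le f c d : second_order f c ->
  (exists2 t0, 0 < t0 & forall t, 0 < t < t0 -> f t <= d * t ^+ 2) -> c <= d.
Proof.
move=> [C [t0 [C0 t00 t01 h]]] [s0 s00 k].
rewrite leNgt; apply/negP => dc.
have CC : 0 < C + 1 by lra.
pose m := Num.min t0 (Num.min s0 ((c - d) / (C + 1))).
have m0 : 0 < m by rewrite /m !lt_min t00 s00 divr_gt0// subr_gt0.
pose t := m / 2; have tt : 0 < t by rewrite divr_gt0.
have tm : t < m by rewrite /t ltr_pdivrMr//; lra.
have := tm; rewrite /m !lt_min => /and3P[h1 h2 h3].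
have := h t; rewrite tt h1 => /(_ isT); have := k t; rewrite tt h2 => /(_ isT) {}k.
rewrite ltr_pdivlMr// in h3.
rewrite ler_norml => /andP[{}h _].
have t2 : 0 < t ^+ 2 by rewrite exprn_gt0.
have e : (c - d) * t ^+ 2 <= (C * t) * t ^+ 2.
  have -> : C * t * t ^+ 2 = C * t ^+ 3 by ring.
  rewrite mulrBl; move: (C * t ^+ 3) (c * t ^+ 2) (d * t ^+ 2) (f t) k h.
  by clear => *; lra.
rewrite ler_pM2r// in e; lra.
Qed.

(** The linear term vanishes because [v] has mean zero, and the pointwise Taylor remainder is
    uniform because [v] is bounded. *)
Lemma mean_powR_second_order p r v dv : 1 < p -> 0 < r -> W1p p v dv -> mean v = 0 ->
  second_order (fun t => mean (fun x => `|1 + t * v x| `^ r) - 1)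
    (r * (r - 1) / 2 * mean (fun x => v x ^+ 2)).
Proof.
move=> p1 r0 H mv; have p1' := ltW p1.
have [M0 hM0] := W1p_bounded p1' H; have [iv _ _] := W1p_integ p1' H.
pose M := 1 + `|M0|; have M1 : 0 < M by rewrite ltr_pwDl.
have hM : {ae sg, forall x, `|v x| <= M}.
  by apply: ae_imp hM0 => x h; rewrite (le_trans h)// (le_trans (ler_norm _))// lerDr.
have iv2 : integ (fun x => v x ^+ 2).
  have := W1p_integ_powR p1' (ltr0Sn R 1) H; congr integ; apply/funext => x.
  by rewrite powR_mulrn// real_normK// num_real.
have [C C0 hC] := powR1D_taylor2 r.
exists (C * M ^+ 3), (Num.min 1 (2 * M)^-1); split.
- by rewrite mulr_ge0// exprn_ge0// ltW.
- by rewrite lt_min ltr01 invr_gt0 mulr_gt0.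
- by rewrite ge_min lexx.
move=> t; rewrite lt_min => /and3P[t0 t1 tM].
have tM2 : t * M <= 2^-1.
  have : t * (2 * M) <= 1 by rewrite -ler_pdivlMr ?mulr_gt0// mul1r ltW.
  by rewrite mulrCA; move: (t * M) => z; lra.
have small x : `|v x| <= M -> `|t * v x| <= t * M.
  by move=> h; rewrite normrM gtr0_norm// ler_wpM2l// ltW.
have ip : integ (fun x => `|1 + t * v x| `^ r).
  exact: W1p_integ_powR p1' r0 (W1p_affine 1 t p1' H).
pose c := r * (r - 1) / 2.
have i0 : integ (fun x => `|1 + t * v x| `^ r - 1) by apply: integB => //; exact: integ_cst.
have i1 := integZ (r * t) iv; have i2 := integZ (c * t ^+ 2) iv2.
have e : mean (fun x => `|1 + t * v x| `^ r) - 1 - c * mean (fun x => v x ^+ 2) * t ^+ 2 =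
    mean (fun x => `|1 + t * v x| `^ r - 1 - r * t * v x - c * t ^+ 2 * v x ^+ 2).
  rewrite meanB//; last exact: integB.
  rewrite meanB// meanB// ?mean_cst; last exact: integ_cst.
  by rewrite (meanZ _ iv) (meanZ _ iv2) mv mulr0 subr0 mulrAC.
rewrite e; have i3 : integ (fun x => `|1 + t * v x| `^ r - 1 - r * t * v x - c * t ^+ 2 * v x ^+ 2).
  by apply: integB => //; exact: integB.
apply: (le_trans (mean_norm i3)); rewrite -[leRHS]mean_cst.
apply: mean_le; [exact: integ_norm|exact: integ_cst|].
apply: ae_imp hM => x h; have tv := small x h.
have tv2 := le_trans tv tM2.
have pos : 0 < 1 + t * v x by move: tv2; rewrite ler_norml => /andP[a _]; lra.
rewrite (gtr0_norm pos).
have -> : (1 + t * v x) `^ r - 1 - r * t * v x - c * t ^+ 2 * v x ^+ 2 =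
  (1 + t * v x) `^ r - 1 - r * (t * v x) - c * (t * v x) ^+ 2.
  by move: (_ `^ r) => z; ring.
apply: (le_trans (hC _ tv2)); rewrite -mulrA ler_wpM2l// -exprMn mulrC.
rewrite mulrC in tv; rewrite mulrC [M * t]mulrC.
by rewrite lerXn2r ?nnegrE ?mulr_ge0 ?(ltW t0) ?(ltW M1)// mulrC.
Qed.

Lemma nonzero_of_mean (u : R -> R) : integ u -> mean u != 0 -> nonzero u.
Proof.
move=> iu /eqP h h0; apply: h; rewrite -[RHS](mean_cst (0 : R)).
by apply: mean_ae => //; exact: integ_meas.
Qed.

(** Replaces the logarithm by a difference quotient in the exponent, so that the case [q = p] only
    requires expansions of powers. *)
Lemma entropy_ge (p s K : R) u du : 1 < p -> 0 < s -> s < p -> 0 <= K ->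
  W1p p u du -> nonzero u ->
  K / (p - s) * (mean (fun x => `|u x| `^ p) `^ (2 / p) -
    mean (fun x => `|u x| `^ p) `^ ((2 - s) / p) * mean (fun x => `|u x| `^ s)) <=
  K * Lr_norm p u `^ (2 - p) * mean (fun x => `|u x| `^ p * ln (`|u x| / Lr_norm p u)).
Proof.
move=> p1 s0 sp K0 H nz; have p0 : 0 < p by rewrite (lt_trans _ p1).
pose y r := mean (fun x => `|u x| `^ r); rewrite -/(y p) -/(y s).
have N0 := nonzero_Lr_norm_gt0 (ltW p1) p0 H nz.
have yN : y p = Lr_norm p u `^ p by rewrite Lr_norm_pow ?gt_eqF.
set N := Lr_norm p u in yN N0 *.
have M a b : N `^ (a + b) = N `^ a * N `^ b.
  by rewrite powRD//; apply/implyP => _; rewrite gt_eqF.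
have ps : 0 < p - s by rewrite subr_gt0.
have jent := integ_log_quotient p1 N0 H.
have jp := W1p_integ_powR (ltW p1) p0 H; have js := W1p_integ_powR (ltW p1) s0 H.
have h : (y p - N `^ (p - s) * y s) / (p - s) <= mean (fun x => `|u x| `^ p * ln (`|u x| / N)).
  rewrite ler_pdivrMr// [leRHS]mulrC -(meanZ _ jent) /y -(meanZ _ js) -(meanB jp (integZ _ js)).
  apply: mean_le; [by apply: integB => //; exact: integZ|exact: integZ|].
  apply: aeW => x; have a0 : 0 <= `|u x| / N by rewrite divr_ge0// ltW.
  have := powR_ge_tangent a0 p0 s0.
  have uE r : `|u x| `^ r = N `^ r * (`|u x| / N) `^ r.
    by rewrite -powRM ?(ltW N0)// mulrCA mulfV ?mulr1// gt_eqF.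
  rewrite 2!uE mulrA -M subrK -mulrBr [X in _ -> _ <= X]mulrCA -[X in _ -> _ <= X]mulrA.
  rewrite ler_pM2l ?powR_gt0//.
  by move: (_ `^ p) (_ `^ s) (ln _) => *; nra.
rewrite yN -!powRrM -[leRHS]mulrA -mulrA ler_wpM2l//.
have -> : p * (2 / p) = (2 - p) + p by field; rewrite gt_eqF.
have -> : p * ((2 - s) / p) = (2 - p) + (p - s) by field; rewrite gt_eqF.
rewrite (M _ p) (M _ (p - s)) -[N `^ _ * _ * y s]mulrA -mulrBr mulrCA ler_pM2l ?powR_gt0// mulrC -yN.
exact: h.
Qed.

Lemma interp_le_rayleigh p q L v dv : 2 < p -> p - 1 < q ->
  @interpolation_inequality R p q L -> calW1 p v dv ->
  L <= Lr_norm p dv ^+ 2 / Lr_norm 2 v ^+ 2.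
Proof.
move=> p2 pq [hneq heq] [H nz mv].
have p1 : 1 < p by rewrite (lt_trans _ p2)// ltr1n.
have p0 : 0 < p by rewrite (lt_trans _ p1).
have q1 : 1 < q by rewrite (le_lt_trans _ pq)// lerBrDr ltW.
have q0 : 0 < q by rewrite (lt_trans _ q1).
have V0 := nonzero_Lr_norm_gt0 (ltW p1) (ltr0Sn R 1) H nz.
rewrite ler_pdivlMr ?exprn_gt0//.
set D := Lr_norm p dv ^+ 2; have D0 : 0 <= D by exact: sqr_ge0.
set V := mean (fun x => v x ^+ 2).
have VE : Lr_norm 2 v ^+ 2 = V.
  rewrite Lr_norm_sqr divff ?pnatr_eq0// powRr1; last by apply: mean_ge0 => x; exact: powR_ge0.
  by apply: eq_mean => x; rewrite powR_mulrn// real_normK// num_real.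
rewrite VE in V0 *.
pose y r t := mean (fun x => `|1 + t * v x| `^ r).
have yS r : 0 < r -> second_order (fun t => y r t - 1) (r * (r - 1) / 2 * V).
  by move=> r0; exact: mean_powR_second_order p1 r0 H mv.
have Ht t : W1p p (fun x => 1 + t * v x) (fun x => t * dv x) by exact: W1p_affine (ltW p1) H.
have Dt t : 0 < t -> Lr_norm p (fun x => t * dv x) ^+ 2 = D * t ^+ 2.
  move=> t0; rewrite /D !Lr_norm_sqr.
  have [_ _ jdp] := W1p_integ (ltW p1) H.
  have -> : (fun x => `|t * dv x| `^ p) = fun x => t `^ p * `|dv x| `^ p.
    by apply/funext => x; rewrite normrM powRM// gtr0_norm.
  rewrite meanZ// powRM ?powR_ge0//; last by apply: mean_ge0 => x; exact: powR_ge0.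
  by rewrite -powRrM mulrCA mulfV ?gt_eqF// mulr1 mulrC powR_mulrn// ltW.
have cancel1 (a b : R) : a - 1 + -1 * (b - 1) = a - b by ring.
have [qp|qp] := eqVneq q p; last first.
  (* The squared norms have coefficients [(p - 1) V] and [(q - 1) V], whose difference cancels the
     denominator [p - q]. *)
  have s1 : second_order (fun t => L / (p - q) * (y p t `^ (2 / p) - y q t `^ (2 / q))) (L * V).
    have h1 := second_order_powR (2 / p) (yS p p0).
    have h2 := second_order_powR (2 / q) (yS q q0).
    have := second_orderZ (L / (p - q)) (second_orderD h1 (second_orderZ (- 1) h2)).
    congr second_order; first by apply/funext => t; rewrite cancel1.
    have pq0 : p - q != 0 by rewrite subr_eq0 eq_sym.
    have [pn qn] : p != 0 /\ q != 0 by rewrite !gt_eqF.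
    by clear -pq0 pn qn; field; rewrite ?pq0 ?pn ?qn.
  apply: (second_order_le s1); exists 1 => // t /andP[t0 _].
  by have := hneq qp _ _ (Ht t); rewrite Dt// !Lr_norm_sqr.
(* [entropy_ge] takes a nonnegative factor; for [L <= 0] the claim is immediate. *)
have [L0|L0] := lerP L 0.
  by rewrite (le_trans _ D0)// mulr_le0_ge0// -VE sqr_ge0.
(* The factor [s / p] is the price of the difference quotient, and it tends to 1 as [s] increases to
   [p]. *)
have key s : 0 < s -> s < p -> s / p * L * V <= D.
  move=> s0 sp.
  have s1 : second_order (fun t => 2 / p * L / (p - s) *
      (y p t `^ (2 / p) - y p t `^ ((2 - s) / p) * y s t)) (s / p * L * V).
    have h1 := second_order_powR (2 / p) (yS p p0).
    have h2 := second_orderM (second_order_powR ((2 - s) / p) (yS p p0)) (yS s s0).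
    have := second_orderZ (2 / p * L / (p - s)) (second_orderD h1 (second_orderZ (- 1) h2)).
    congr second_order; first by apply/funext => t; rewrite cancel1.
    have ps0 : p - s != 0 by rewrite subr_eq0 gt_eqF.
    have pn : p != 0 by rewrite gt_eqF.
    by clear -ps0 pn; field; rewrite ?ps0 ?pn.
  apply: (second_order_le s1); exists 1 => // t /andP[t0 _].
  have nzt : nonzero (fun x => 1 + t * v x).
    apply: nonzero_of_mean; have [iv _ _] := W1p_integ (ltW p1) H.
      by apply: integD; [exact: integ_cst|exact: integZ].
    rewrite meanD; [|exact: integ_cst|exact: integZ].
    by rewrite mean_cst meanZ// [X in _ * X]mv mulr0 addr0 oner_eq0.
  have := heq qp _ _ (Ht t) nzt; rewrite Dt//; apply: le_trans.
  have pL : 0 < 2 / p * L by rewrite mulr_gt0// divr_gt0.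
  exact: (entropy_ge p1 s0 sp (ltW pL) (Ht t) nzt).
apply: (@le_of_perturbation _ _ _ (L * V / p)) => t /andP[t0 t1].
have tp' : 0 < p - t by rewrite subr_gt0 (le_lt_trans t1).
have tp2 : p - t < p by rewrite ltrBlDr ltrDl.
have := key _ tp' tp2; rewrite -subr_ge0 => h; rewrite -subr_ge0; apply: (le_trans h).
rewrite le_eqVlt; apply/orP; left; apply/eqP; clear -p0.
by field; rewrite gt_eqF.
Qed.

End Above.

(** * Attainment and bounds of the sharp constant *)

Section SharpConstant.
Variable R : realType.

(** The coefficient [K] has no fixed sign: if it is nonpositive, any member of [S] suffices; if it
    is positive, dividing by it bounds all members. *)
Lemma mul_sup_le (S : set R) (K D : R) : has_sup S ->
  (forall L, S L -> K * L <= D) -> K * sup S <= D.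
Proof.
move=> [[L0 SL0] ubS] h; have ub L (SL : S L) : L <= sup S by exact: ub_le_sup.
have [K0|K0] := lerP K 0.
  by apply: le_trans (h _ SL0); rewrite ler_wnM2l// ub.
rewrite mulrC -ler_pdivlMr//; apply: ge_sup; first by exists L0.
by move=> L SL; rewrite ler_pdivlMr// mulrC h.
Qed.

End SharpConstant.

Theorem theorem1p1 (R : realType) (p q : R) (hp : 2 < p) (hq : p - 1 < q) :
  exists Lambda : R,
    [/\ 0 < Lambda,
        interpolation_inequality p q Lambda,
        forall L : R, interpolation_inequality p q L -> L <= Lambda,
        lambda1 p <= Lambda
      & Lambda <= lambda1_star p].
Proof.
pose S := [set L : R | interpolation_inequality p q L].
have p1 : 1 < p by rewrite (lt_trans _ hp)// ltr1n.
have p0 : 0 < p by rewrite (lt_trans _ p1).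
have l0 : 0 < lambda1 p by exact: rayleigh_inf_gt0.
have mem L : 0 < L -> L < lambda1 p -> S L by exact: interp_lt_lambda1.
have up L : S L -> L <= lambda1_star p.
  move=> SL; apply: rayleigh_inf_ge => // v dv.
  exact: interp_le_rayleigh hp hq SL.
have S2 : S (lambda1 p / 2) by apply: mem; rewrite ?divr_gt0// ltr_pdivrMr// ltr_pMr// ltr1n.
have hS : has_sup S by split; [exists (lambda1 p / 2)|exists (lambda1_star p) => L; exact: up].
have ub L : S L -> L <= sup S by move=> SL; apply: ub_le_sup => //; exact: hS.2.
exists (sup S); split.
- by apply: lt_le_trans (ub _ S2); rewrite divr_gt0.
- split=> [qp u du H|qp u du H nz].
    rewrite -mulrA mulrC; apply: (mul_sup_le hS) => L [h _].
    by rewrite mulrC mulrA; exact: h.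
  rewrite (mulrAC (2 / p)) (mulrAC (2 / p * _)); apply: (mul_sup_le hS) => L [_ h].
  by rewrite -(mulrAC (2 / p * _)) -(mulrAC (2 / p)); exact: h.
- exact: ub.
- rewrite leNgt; apply/negP => h.
  have s0 : 0 < sup S by apply: lt_le_trans (ub _ S2); rewrite divr_gt0.
  (* Were [sup S] below [lambda1 p], this midpoint would be admissible and exceed the supremum. *)
  pose L := (sup S + lambda1 p) / 2.
  have : L <= sup S.
    by apply: ub; apply: mem; rewrite /L ?ltr_pdivrMr ?divr_gt0 ?addr_gt0//; lra.
  by rewrite /L ler_pdivrMr//; lra.
- by apply: ge_sup; [exists (lambda1 p / 2)|exact: up].
Qed.
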